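(* There exist a Jordan domain $\Omega\subset\mathbb{C}$ and a homeomorphism $\varphi\colon\partial\mathbb{D}\to\partial\Omega$ such that $$\int_{\Omega}h_{\Omega}(z,z_0)\,\mathrm{d}z<\infty\quad\text{for some } z_0\in\Omega,$$ and yet $\varphi$ does not have a homeomorphic $W^{1,1}$-extension; that is, there is no homeomorphism $\Phi\colon\overline{\mathbb{D}}\to\overline{\Omega}$ with $\Phi|_{\partial\mathbb{D}}=\varphi$ and $\Phi|_{\mathbb{D}}\in W^{1,1}(\mathbb{D},\mathbb{C})$.
   Context: $\mathbb{D}$ is the open unit disk in $\mathbb{C}$. A Jordan domain is the bounded (interior) component of the complement in $\mathbb{C}$ of a Jordan curve, i.e. of a homeomorphic image of $\partial\mathbb{D}$ in $\mathbb{C}$. The integral is with respect to two-dimensional Lebesgue measure. $h_\Omega$ denotes the hyperbolic distance of $\Omega$: the hyperbolic distance $h_{\mathbb{H}^+}$ of the upper half plane $\mathbb{H}^+$ is the path metric with density $1/\operatorname{Im} z$ (equivalently, $h_{\mathbb{D}}$ is the path metric with density $2/(1-|z|^2)$), and $h_\Omega$ is defined by conformal invariance, $h_\Omega(f(z),f(w))=h_{\mathbb{D}}(z,w)$ for any conformal bijection $f\colon\mathbb{D}\to\Omega$. $W^{1,1}(\mathbb{D},\mathbb{C})$ is the Sobolev space of complex-valued integrable functions on $\mathbb{D}$ whose first-order distributional derivatives belong to $L^1(\mathbb{D})$. *)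

(* Defs.v *)
From HB Require Import structures.
From mathcomp Require Import all_boot all_order all_algebra complex.
From mathcomp Require Import all_classical all_reals all_analysis.

Set Implicit Arguments.
Unset Strict Implicit.
Unset Printing Implicit Defensive.

Import Order.TTheory GRing.Theory Num.Theory.
Import numFieldNormedType.Exports.

Local Open Scope classical_set_scope.
Local Open Scope ring_scope.
Local Open Scope complex_scope.

(* The regular module [R[i]^o] is the copy of [R[i]] that carries the norm
   topology and is a normed module over [R[i]] itself. *)
Notation Cplx R := ((complex R)^o).

Section Topology.
Variable R : realType.

Definition unit_disk : set (Cplx R) := [set z | `|z| < 1].
Definition closed_unit_disk : set (Cplx R) := [set z | `|z| <= 1].
Definition unit_circle : set (Cplx R) := [set z | `|z| = 1].

Definition boundary (T : topologicalType) (A : set T) : set T :=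
  closure A `\` interior A.

(* Values of [f] outside [A] are irrelevant. *)
Definition homeomorphism_on (T U : topologicalType) (A : set T) (B : set U)
    (f : T -> U) : Prop :=
  [/\ set_bij A B f, {within A, continuous f} &
      exists g : U -> T, {within B, continuous g} /\ {in A, cancel f g}].

Definition jordan_curve (G : set (Cplx R)) : Prop :=
  exists f : Cplx R -> Cplx R, homeomorphism_on unit_circle G f.

Definition jordan_domain (Omega : set (Cplx R)) : Prop :=
  exists2 G : set (Cplx R), jordan_curve G &
    bounded_set Omega /\
    exists2 z : Cplx R, (~` G) z & Omega = connected_component (~` G) z.

End Topology.

Section Hyperbolic.
Variable R : realType.

Definition conformal_bijection (U V : set (Cplx R)) (f : Cplx R -> Cplx R) :
    Prop :=
  (forall z, U z -> derivable f z 1) /\ set_bij U V f.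

Definition C1_path (U : set (Cplx R)) (z w : Cplx R) (g : R -> Cplx R) :
    Prop :=
  let x t := complex.Re (g t) in let y t := complex.Im (g t) in
  [/\ g 0 = z /\ g 1 = w,
      forall t, t \in `[0, 1]%R -> U (g t),
      forall t, t \in `[0, 1]%R -> derivable x t 1 /\ derivable y t 1 &
      {within `[0, 1], continuous (derive1 x)} /\
      {within `[0, 1], continuous (derive1 y)}].

Definition hyperbolic_length (g : R -> Cplx R) : \bar R :=
  let x t := complex.Re (g t) in let y t := complex.Im (g t) in
  (\int[lebesgue_measure]_(t in `[0%R, 1%R])
    (2 * Num.sqrt (derive1 x t ^+ 2 + derive1 y t ^+ 2)
       / (1 - (x t ^+ 2 + y t ^+ 2)))%:E)%E.

Definition hyperbolic_dist_disk (z w : Cplx R) : \bar R :=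
  ereal_inf [set hyperbolic_length g | g in C1_path (@unit_disk R) z w].

(* By conformal invariance of the distance of the disk the set below has at
   most one element, so that the infimum only extracts the common value
   provided by all the conformal bijections; it is [+oo] if there is none. *)
Definition hyperbolic_dist (Omega : set (Cplx R)) (p q : Cplx R) : \bar R :=
  ereal_inf [set d | exists f z w,
    [/\ conformal_bijection (@unit_disk R) Omega f,
        unit_disk z /\ unit_disk w,
        f z = p /\ f w = q &
        d = hyperbolic_dist_disk z w]].

End Hyperbolic.

Section Sobolev.
Variable R : realType.

Definition plane_measure := (@lebesgue_measure R \x @lebesgue_measure R)%E.

Definition toC (p : R * R) : Cplx R := p.1 +i* p.2.

Fixpoint Cn (n : nat) (f : R * R -> R) : Prop :=
  if n is n'.+1 then
    [/\ continuous f,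
        forall p, derivable f p (1, 0) /\ derivable f p (0, 1),
        Cn n' ('D_(1, 0) f) & Cn n' ('D_(0, 1) f)]
  else continuous f.

Definition test_function (U : set (R * R)) (psi : R * R -> R) : Prop :=
  [/\ forall n, Cn n psi,
      compact (closure [set p | psi p != 0]) &
      closure [set p | psi p != 0] `<=` U].

Definition weak_derivative (U : set (R * R)) (v : R * R) (f g : R * R -> R) :
    Prop :=
  forall psi, test_function U psi ->
    \int[plane_measure]_(p in U) (f p * 'D_v psi p) =
    - \int[plane_measure]_(p in U) (g p * psi p).

Definition W11_real (U : set (R * R)) (f : R * R -> R) : Prop :=
  plane_measure.-integrable U (EFin \o f) /\
  forall v, v = (1, 0) \/ v = (0, 1) ->
    exists2 g : R * R -> R,
      plane_measure.-integrable U (EFin \o g) & weak_derivative U v f g.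

Definition W11 (U : set (Cplx R)) (f : Cplx R -> Cplx R) : Prop :=
  W11_real (toC @^-1` U) (fun p => complex.Re (f (toC p))) /\
  W11_real (toC @^-1` U) (fun p => complex.Im (f (toC p))).

End Sobolev.

(* Main.v *)
From HB Require Import structures.
Require Import Defs.
From mathcomp Require Import all_boot all_order all_algebra complex.
From mathcomp Require Import all_classical all_reals all_analysis measurable_realfun.
From mathcomp Require Import ring lra.
Set Implicit Arguments.
Unset Strict Implicit.
Unset Printing Implicit Defensive.
Import Order.TTheory GRing.Theory Num.Theory.
Import numFieldNormedType.Exports.
Local Open Scope classical_set_scope.
Local Open Scope ring_scope.

(** The domain is a corridor of infinite length that spirals into the origin,
together with a parametrization of its boundary that runs down the corridor far
too fast.

The Cayley map [c = 2 / (1 - z)] sends the closed disk without [1] into the half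
plane [Re c >= 1], and [L = e^4 + Log c] then lies in a half strip.  With
[u = Log L], the map [spiral L = e^(i u) / u] wraps the half strip around the
origin: [Re u] is the polar angle and [1 / |u|] is about the distance to the
origin.  Extended by [0] at [1], the composition [disk_map] is continuous and
injective on the closed disk and conformal inside, so that the image of the open
disk is a Jordan domain ([disk_map_inj], [disk_map_continuous],
[image_jordan_domain]).

The integral.  By conformal invariance the distance from [disk_map z] to
[disk_map 0] is at most [- 2 * ln (1 - |z|)].  In the coordinate
[t = Log ((1 + z) / (1 - z))], which ranges over the band [|Im t| < pi / 2], this
is at most a constant plus [2 * |Re t|] plus twice the logarithm of the inverse
distance to the sides of the band, while the map from the band to the corridor
has derivative at most [width x] with [x = |Re t|], of order [1 / (x * ln x)].
Covering the band by squares whose size is comparable to their distance to the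
sides, the integral is bounded by a multiple of the sum of [n / (n * ln n) ^ 2],
which converges, if only just ([cell_cover], [integral_majorant],
[hyperbolic_integral_finite]).

The missing extension.  Let the depth of a point of the corridor be the real part
of [Log u].  The derivatives of [Log u] and of [e^(i u) / u] both have modulus
about [|u'| / |u|], so that depth is locally a Lipschitz function of the position
in the corridor ([depth_control]).  The boundary map is [disk_map] after a
homeomorphism of the circle that fixes [1] and pushes the other points towards
[1] at the rate of a four times iterated exponential.  As depth is a three times
iterated logarithm, the image of the boundary point of height [y] has depth at
least [y ^- 2 / 2] ([depth_circle]).

Suppose that a homeomorphism [Phi] of class [W^(1,1)] extends this map, and
consider the depth of [Phi] on the disk.  It is bounded on a segment of the
vertical diameter and at least [y ^- 2 / 2 - 1] near the right end of the
horizontal chord of height [y].  A continuous function with an integrable weak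
derivative is absolutely continuous on almost every chord ([acl_estimate]), and
through the Lipschitz bound the increment of the depth is dominated by the
integral of the weak derivative of [Phi] over the chord ([chord_estimate]).  So
this integral is at least of order [y ^- 2], and by Fubini the weak derivative is
not integrable ([no_steep_boundary]), a contradiction. *)

(** * Smooth transition functions *)

Lemma is_derive_epsdelta (K : numFieldType) (f : K^o -> K^o) (x d : K) :
  (forall e, 0 < e -> exists2 r, 0 < r &
     forall h, `|h| < r -> `|f (x + h) - f x - d * h| <= e * `|h|) ->
  is_derive (x : K^o) (1 : K^o) f d.
Proof.
move=> H; suff L : h^-1 *: (f (h *: (1:K^o) + x) - f x) @[h --> (0:K)^'] --> (d : K^o).
  by apply: DeriveDef; [apply/cvg_ex; exists d|exact: cvg_lim].
apply/cvgrPdist_le => e e0; have [r r0 Hr] := H e e0.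
near=> h.
have h0 : h != 0 by near: h; exact: nbhs_dnbhs_neq.
have -> : h *: (1 : K^o) + x = x + h by rewrite addrC [_ *: _]mulr1.
have -> : d - h^-1 *: (f (x + h) - f x) = - (h^-1 * (f (x + h) - f x - d * h)).
  by rewrite mulrBr mulrCA mulVf// mulr1 opprB.
rewrite normrN normrM normfV ler_pdivrMl ?normr_gt0// [leRHS]mulrC; apply: Hr.
near: h; apply: dnbhs0_lt; exact: r0.
Unshelve. all: by end_near. Qed.

Section Smooth.
Variable R : realType.
Implicit Types f g : R -> R.

(** Successive derivatives serve as witnesses, which makes the closure under
    sums, products and inverses a direct induction. *)
Fixpoint Ck (n : nat) (f : R -> R) : Prop :=
  if n is n'.+1 then exists2 f' : R -> R, (forall x : R, is_derive x (1:R) f (f' x)) & Ck n' f'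
  else continuous f.

Definition smooth f := forall n, Ck n f.

Lemma is_derive_continuous f (x d : R) : is_derive x (1:R) f d -> {for x, continuous f}.
Proof.
by move=> [df _]; apply: differentiable_continuous; apply/derivable1_diffP.
Qed.

Lemma Ck_continuous n f : Ck n f -> continuous f.
Proof. by case: n => //= n [f' ff' _] x; exact: is_derive_continuous (ff' x). Qed.

Lemma CkW n f : Ck n.+1 f -> Ck n f.
Proof.
elim: n f => [|n IH] f; first exact: Ck_continuous.
by move=> [f' ff' Cf']; exists f'; [exact: ff'|exact: (IH f' Cf')].
Qed.

Lemma Ck_cst n (c : R) : Ck n (cst c).
Proof.
elim: n c => [|n IH] c; first exact: cst_continuous.
by exists (cst 0); [move=> x; exact: is_derive_cst|exact: IH].
Qed.

Lemma CkD n f g : Ck n f -> Ck n g -> Ck n (f \+ g).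
Proof.
elim: n f g => [|n IH] f g /=; first by move=> cf cg x; apply: continuousD; [exact: cf|exact: cg].
by move=> [f' ff' Cf] [g' gg' Cg]; exists (f' \+ g'); [move=> x; exact: is_deriveD|exact: IH].
Qed.

Lemma CkM n f g : Ck n f -> Ck n g -> Ck n (f \* g).
Proof.
elim: n f g => [|n IH] f g; first by move=> cf cg x; apply: continuousM; [exact: cf|exact: cg].
move=> Hf Hg; have [f' ff' Cf] := Hf; have [g' gg' Cg] := Hg.
exists ((f \* g') \+ (g \* f')) => [x|]; first exact: is_deriveM.
by apply: CkD; apply: IH => //; apply: CkW.
Qed.

Lemma CkV n f : (forall x, f x != 0) -> Ck n f -> Ck n (fun x => (f x)^-1).
Proof.
move=> f0; elim: n => [|n IH]; first by move=> cf x; apply: continuousV => //; exact: cf.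
move=> Hf; have [f' ff' Cf] := Hf.
exists ((cst (-1) \* ((fun x => (f x)^-1) \* (fun x => (f x)^-1))) \* f') => [x|].
  have := @is_deriveV _ f x (f' x) 1 (f0 x) (ff' x).
  by rewrite /GRing.scale /= expr2 invfM !mulNr !mul1r.
apply: CkM => //; apply: CkM; first exact: Ck_cst.
by apply: CkM; apply: IH; apply: CkW.
Qed.

Lemma is_derive_affine f (a b x d : R) :
  is_derive (a * x + b) (1:R) f d -> is_derive x (1:R) (fun x => f (a * x + b)) (a * d).
Proof.
move=> H.
have Ha : is_derive x (1:R) (fun x => a * x + b) a.
  apply: (is_derive_eq (is_deriveD (is_deriveZ a (is_derive_id x 1))
    (is_derive_cst b x 1))).
  by rewrite addr0 /GRing.scale /= mulr1.
rewrite mulrC.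
exact: (@is_derive1_comp _ f (fun x => a * x + b) x d a).
Qed.

Lemma Ck_affine n f (a b : R) : Ck n f -> Ck n (fun x => f (a * x + b)).
Proof.
elim: n f => [|n IH] f.
  move=> cf x; apply: (continuous_comp (f := fun x => a * x + b) (g := f)); last exact: cf.
  by apply: continuousD; [apply: mulrl_continuous | exact: cst_continuous].
move=> [f' ff' Cf]; exists (cst a \* (fun x => f' (a * x + b))).
  by move=> x; apply: is_derive_affine.
by apply: CkM; [exact: Ck_cst|exact: IH].
Qed.

(** The family [x ^- k * exp (- 1 / x)], extended by [0] to the left half
    line, is closed under differentiation up to linear combinations. *)
Definition flat (k : nat) (x : R) : R :=
  if 0 < x then x^-1 ^+ k * expR (- x^-1) else 0.

Lemma flat_ge0 k x : 0 <= flat k x.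
Proof.
rewrite /flat; case: ifP => // x0; rewrite mulr_ge0 ?expR_ge0// exprn_ge0//.
by rewrite invr_ge0 ltW.
Qed.

Lemma flat_le0 k x : x <= 0 -> flat k x = 0.
Proof. by rewrite /flat leNgt => /negbTE ->. Qed.

Lemma flat0_gt0 x : 0 < x -> 0 < flat 0 x.
Proof. by move=> x0; rewrite /flat x0 expr0 mul1r expR_gt0. Qed.

(** The exponential beats every power of [x^-1]; the quadratic bound is what the
    derivative at [0] needs. *)
Lemma flat_quadratic k : exists C : R, forall x, flat k x <= C * x ^+ 2.
Proof.
exists (k.+2)`!%:R => x; rewrite /flat; case: ifPn => x0; last first.
  by rewrite mulr_ge0// sqr_ge0.
have y0 : 0 <= x^-1 by rewrite invr_ge0 ltW.
rewrite expRN -ler_pdivrMr; last exact: exprn_gt0.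
rewrite -mulrA [_ * x ^- 2]mulrC mulrA -exprVn -exprD addn2 ler_pdivrMr ?expR_gt0//.
have := @expR_ge1Dxn R x^-1 k.+1 y0.
move=> H; rewrite -ler_pdivrMl; last by rewrite ltr0n fact_gt0.
by rewrite mulrC; apply: le_trans H; rewrite lerDr.
Qed.

Lemma is_derive_flat k (x : R) :
  is_derive x (1:R) (flat k) (flat k.+2 x - k%:R * flat k.+1 x).
Proof.
have [x0|x0|->] := ltgtP x 0.
- rewrite !flat_le0 ?(ltW x0)// mulr0 subr0.
  apply: (near_eq_is_derive (f := cst (0:R))).
  near=> y; rewrite flat_le0//; near: y; exact: lt_le_nbhsl.
- rewrite /flat x0.
  have xn0 : x != 0 by rewrite gt_eqF.
  apply: (near_eq_is_derive
    (f := (fun y : R => y^-1) ^+ k * (fun y => expR (- y^-1)))).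
    near=> y; rewrite /flat ifT ?fctE//; near: y; exact: (cvgr_gt x cvg_id).
  have Hi : is_derive x (1:R) (fun y => y^-1) (- x ^- 2).
    have := @is_deriveV _ id x 1 1 xn0 (is_derive_id x 1).
    by rewrite /GRing.scale /= mulr1.
  have He : is_derive x (1:R) (fun y : R => expR (- y^-1)) (expR (- x^-1) * x ^- 2).
    apply: (is_derive_eq (is_derive1_comp (is_derive_expR _) (is_deriveN Hi))).
    by rewrite opprK.
  apply: (is_derive_eq (is_deriveM (is_deriveX k Hi) He)).
  rewrite /GRing.scale /=; case: (k) => [|j] /=.
    by rewrite !fctE /=; field.
  by rewrite !fctE /= !exprS; field.
- rewrite !flat_le0// mulr0 subr0.
  apply: is_derive_epsdelta => e e0.
  have [C HC] := flat_quadratic k.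
  have C0 : 0 <= C by have := HC 1; rewrite expr1n mulr1; exact/le_trans/flat_ge0.
  exists (e / (C + 1)); first by rewrite divr_gt0// ltr_wpDl.
  move=> h hr; rewrite add0r (@flat_le0 k 0)// subr0 mul0r subr0 ger0_norm ?flat_ge0//.
  apply: (le_trans (HC h)); rewrite -(real_normK (num_real h)) expr2 mulrA.
  rewrite ler_wpM2r//; move: hr; rewrite ltr_pdivlMr ?ltr_wpDl// => /ltW; apply: le_trans.
  by rewrite mulrC ler_wpM2l// lerDl.
Unshelve. all: by end_near. Qed.

Lemma smooth_flat k : smooth (flat k).
Proof.
move=> n; elim: n k => [|n IH] k.
  by move=> x; exact: is_derive_continuous (is_derive_flat k x).
exists (flat k.+2 \+ (cst (- k%:R) \* flat k.+1)).
  by move=> x; apply: (is_derive_eq (is_derive_flat k x)); rewrite /= mulNr.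
by apply: CkD => //; apply: CkM; [exact: Ck_cst|].
Qed.

(** A smooth transition from [0] on the left of [0] to [1] on the right of
    [1]. *)
Definition sstep (x : R) : R := flat 0 x * (flat 0 x + flat 0 (1 - x))^-1.

Let sstep_den_gt0 (x : R) : 0 < flat 0 x + flat 0 (1 - x).
Proof.
have [x0|x0] := ltP 0 x.
  by rewrite ltr_pwDl ?flat_ge0// flat0_gt0.
by rewrite ltr_wpDl ?flat_ge0// flat0_gt0// subr_gt0; apply: le_lt_trans x0 _.
Qed.

Lemma smooth_sstep : smooth sstep.
Proof.
move=> n; apply: CkM; first exact: smooth_flat.
apply: CkV; first by move=> x; rewrite gt_eqF// sstep_den_gt0.
apply: CkD; first exact: smooth_flat.
have := @Ck_affine n (flat 0) (-1) 1 (smooth_flat 0 n).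
by congr (Ck n _); apply/funext => x; rewrite mulN1r addrC.
Qed.

Lemma sstep_le0 x : x <= 0 -> sstep x = 0.
Proof. by move=> x0; rewrite /sstep flat_le0// mul0r. Qed.

Lemma sstep_ge1 x : 1 <= x -> sstep x = 1.
Proof.
move=> x1; rewrite /sstep [X in _ + X]flat_le0 ?subr_le0// addr0 divff// gt_eqF//.
by rewrite flat0_gt0// (lt_le_trans _ x1).
Qed.

Lemma sstep_ge0 x : 0 <= sstep x.
Proof. by rewrite /sstep mulr_ge0 ?flat_ge0// invr_ge0 ltW// sstep_den_gt0. Qed.

Lemma sstep_le1 x : sstep x <= 1.
Proof. by rewrite /sstep ler_pdivrMr ?sstep_den_gt0// mul1r lerDl flat_ge0. Qed.

Lemma smooth_derive1 f : smooth f ->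
  (forall x : R, is_derive x (1:R) f ((derive1 f) x)) /\ smooth (derive1 f).
Proof.
move=> sf; have [f' ff' _] := sf 1%N.
have E : (derive1 f) = f' by apply/funext => x; rewrite derive1E; case: (ff' x).
split=> [x|n]; first by rewrite E; exact: ff'.
have [g fg Cg] := sf n.+1; rewrite E.
by have -> : f' = g by apply/funext => x; case: (ff' x) => _ <-; case: (fg x).
Qed.

Lemma is_derive_tensor1 (X Y : R -> R) (p : R * R) (d : R) :
  is_derive p.1 (1:R) X d ->
  is_derive p ((1:R), (0:R)) (fun p : R * R => X p.1 * Y p.2) (d * Y p.2).
Proof.
case: p => x y /= Hd.
suff L : h^-1 *: (X (h *: (1:R) + x) * Y (h *: (0:R) + y) - X x * Y y)
    @[h --> (0:R)^'] --> d * Y y.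
  by apply: DeriveDef; [apply/cvg_ex; eexists; exact: L|exact: cvg_lim L].
have [dX <-] := Hd.
have -> : (fun h : R => h^-1 *: (X (h *: (1:R) + x) * Y (h *: (0:R) + y) - X x * Y y)) =
  (fun h => (h^-1 *: (X (h *: (1:R) + x) - X x)) * Y y).
  apply/funext => h; rewrite scaler0 add0r -mulrBl /GRing.scale /=.
  by rewrite mulrA.
apply: cvgM; last exact: cvg_cst.
exact: dX.
Qed.

Lemma is_derive_tensor2 (X Y : R -> R) (p : R * R) (d : R) :
  is_derive p.2 (1:R) Y d ->
  is_derive p ((0:R), (1:R)) (fun p : R * R => X p.1 * Y p.2) (X p.1 * d).
Proof.
case: p => x y /= Hd.
suff L : h^-1 *: (X (h *: (0:R) + x) * Y (h *: (1:R) + y) - X x * Y y)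
    @[h --> (0:R)^'] --> X x * d.
  by apply: DeriveDef; [apply/cvg_ex; eexists; exact: L|exact: cvg_lim L].
have [dX <-] := Hd.
have -> : (fun h : R => h^-1 *: (X (h *: (0:R) + x) * Y (h *: (1:R) + y) - X x * Y y)) =
  (fun h => X x * (h^-1 *: (Y (h *: (1:R) + y) - Y y))).
  apply/funext => h; rewrite scaler0 add0r -mulrBr /GRing.scale /=.
  by rewrite mulrCA.
apply: cvgM; first exact: cvg_cst.
exact: dX.
Qed.

(** Differentiating a product [X p.1 * Y p.2] along an axis gives a product of
    the same kind. *)
Lemma Cn_tensor n (X Y : R -> R) : smooth X -> smooth Y ->
  Cn n (fun p : R * R => X p.1 * Y p.2).
Proof.
have cXY (X' Y' : R -> R) : continuous X' -> continuous Y' ->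
    continuous (fun p : R * R => X' p.1 * Y' p.2).
  move=> cX cY p; apply: cvgM.
    by apply: (continuous_comp (g := X')); [exact: cvg_fst|exact: cX].
  by apply: (continuous_comp (g := Y')); [exact: cvg_snd|exact: cY].
elim: n X Y => [|n IH] X Y sX sY /=.
  by apply: cXY; [exact: sX 0%N|exact: sY 0%N].
have [dX sX'] := smooth_derive1 sX; have [dY sY'] := smooth_derive1 sY.
split.
- by apply: cXY; [exact: sX 0%N|exact: sY 0%N].
- move=> p; split.
    by have [] := @is_derive_tensor1 X Y p _ (dX p.1).
  by have [] := @is_derive_tensor2 X Y p _ (dY p.2).
- have -> : 'D_(1, 0) (fun p : R * R => X p.1 * Y p.2) =
      (fun p : R * R => (derive1 X) p.1 * Y p.2).
    by apply/funext => p; have [] := @is_derive_tensor1 X Y p _ (dX p.1).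
  exact: IH.
- have -> : 'D_(0, 1) (fun p : R * R => X p.1 * Y p.2) =
      (fun p : R * R => X p.1 * (derive1 Y) p.2).
    by apply/funext => p; have [] := @is_derive_tensor2 X Y p _ (dY p.2).
  exact: IH.
Qed.

End Smooth.

(** * Averages against product kernels *)

Section Averages.
Variable R : realType.
Local Notation mu := (@lebesgue_measure R).
Local Notation mu2 := (@plane_measure R).
Local Notation plane := (measurableTypeR R * measurableTypeR R)%type.

Lemma measurable_box (a b c d : R) :
  measurable (`[a, b]%classic `*` `[c, d]%classic : set plane).
Proof. exact: measurableX. Qed.

Lemma plane_measure_box (a b c d : R) : a <= b -> c <= d ->
  mu2 (`[a, b]%classic `*` `[c, d]%classic) = ((b - a) * (d - c))%:E.
Proof.
move=> ab cd; rewrite /plane_measure product_measure1E//=.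
rewrite !lebesgue_measure_itv /= !lte_fin.
have [?|ba] := ltP a b; last first.
  by have -> : a = b; [apply/le_anti; rewrite ab ba|rewrite subrr mul0r mul0e].
have [?|dc] := ltP c d; last first.
  by have -> : c = d; [apply/le_anti; rewrite cd dc|rewrite subrr mulr0 mule0].
by rewrite -!EFinD -EFinM.
Qed.

Lemma measurable_tensor (u v : R -> R) : continuous u -> continuous v ->
  measurable_fun setT (fun p : plane => u p.1 * v p.2).
Proof.
move=> cu cv; apply: measurable_funM; apply: measurableT_comp => //.
  exact: continuous_measurable_fun.
exact: continuous_measurable_fun.
Qed.

Lemma bounded_itv (u : R -> R) (a b : R) : continuous u ->
  exists2 M : R, 0 <= M & forall x, a <= x <= b -> `|u x| <= M.
Proof.
move=> cu; have : compact (u @` `[a, b]%classic).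
  apply: continuous_compact; last exact: segment_compact.
  exact: continuous_subspaceT.
move=> /compact_bounded [M0 [_ HM]]; exists (`|M0| + 1); first by rewrite addr_ge0.
move=> x xab; apply: (HM (`|M0| + 1)); first by rewrite (le_lt_trans (ler_norm _))// ltrDl.
by exists x => //=; rewrite in_itv.
Qed.

Lemma integrable_tensor (u v : R -> R) (a b c d : R) :
  continuous u -> continuous v -> a <= b -> c <= d ->
  mu2.-integrable (`[a, b]%classic `*` `[c, d]%classic)
    (EFin \o (fun p : R * R => u p.1 * v p.2)).
Proof.
move=> cu cv ab cd; apply: measurable_bounded_integrable => //.
- exact: measurable_box.
- by have := ltry ((b - a) * (d - c)); rewrite -plane_measure_box.
- by apply: measurable_funTS; exact: measurable_tensor.
have [M M0 HM] := bounded_itv a b cu; have [N N0 HN] := bounded_itv c d cv.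
exists (M * N); split=> [|x MNx p [/= p1 p2]]; first by rewrite num_real.
rewrite (le_trans _ (ltW MNx))// normrM ler_pM//.
  by apply: HM; move: p1; rewrite in_itv.
by apply: HN; move: p2; rewrite in_itv.
Qed.

Lemma integral_tensor (u v : R -> R) (a b c d : R) :
  continuous u -> continuous v -> a <= b -> c <= d ->
  \int[mu2]_(p in `[a, b]%classic `*` `[c, d]%classic) (u p.1 * v p.2) =
  (\int[mu]_(x in `[a, b]) u x) * (\int[mu]_(y in `[c, d]) v y).
Proof.
move=> cu cv ab cd.
have iuv := integrable_tensor cu cv ab cd.
have iu : mu.-integrable setT (EFin \o (u \_ `[a, b]%classic)).
  rewrite -restrict_EFin; apply/(integrable_mkcond _ _).1 => //.
  by apply: continuous_compact_integrable; [exact: segment_compact|exact: continuous_subspaceT].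
have iv : mu.-integrable setT (EFin \o (v \_ `[c, d]%classic)).
  rewrite -restrict_EFin; apply/(integrable_mkcond _ _).1 => //.
  by apply: continuous_compact_integrable; [exact: segment_compact|exact: continuous_subspaceT].
have E : (fun p : R * R => u p.1 * v p.2) \_ (`[a, b]%classic `*` `[c, d]%classic) =
    (fun p : R * R => (u \_ `[a, b]%classic) p.1 * (v \_ `[c, d]%classic) p.2).
  apply/funext => -[x y]; rewrite !patchE in_setX /=.
  by case: (x \in _); case: (y \in _); rewrite /= ?mul0r ?mulr0.
rewrite [X in _ = X * _]Rintegral_mkcond [X in _ = _ * X]Rintegral_mkcond [LHS]Rintegral_mkcond E.
move: iuv; rewrite integrable_mkcond; last exact: measurable_box.
rewrite restrict_EFin E => iuv.
rewrite /Rintegral -integral12_prod_meas1//.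
transitivity (fine (\int[mu]_x (((u \_ `[a, b]%classic) x)%:E *
    \int[mu]_y ((v \_ `[c, d]%classic) y)%:E))%E).
  congr fine; apply: eq_integral => x _.
  by rewrite /fubini_F -integralZl.
rewrite -(fineK (integrable_fin_num _ iv))//.
by rewrite /= integralZr// fineM//; exact: integrable_fin_num.
Qed.

(** The factors [u] and [v] may change sign; only their masses and sizes enter,
    and the sizes cost the factor [M ^+ 2]. *)
Lemma tensor_average (F : R * R -> R) (u v : R -> R) (c y0 e M L delta : R) :
  0 < e -> continuous u -> continuous v ->
  (forall x, `|u x| <= M / e) -> (forall y, `|v y| <= M / e) ->
  \int[mu]_(x in `[c, c + e]) u x = 1 ->
  \int[mu]_(y in `[y0, y0 + e]) v y = 1 ->
  let B := `[c, c + e]%classic `*` `[y0, y0 + e]%classic in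
  measurable_fun (B : set plane) (F : plane -> R) -> (forall p, B p -> `|F p - L| <= delta) ->
  `|\int[mu2]_(p in B) (F p * (u p.1 * v p.2)) - L| <= delta * M ^+ 2.
Proof.
move=> e0 cu cv uM vM u1 v1 B mF FL.
have ce : c <= c + e by rewrite lerDl ltW.
have ye : y0 <= y0 + e by rewrite lerDl ltW.
have mB : measurable (B : set plane) := measurable_box _ _ _ _.
have Bfin : (mu2 B < +oo)%E.
  by have := ltry ((c + e - c) * (y0 + e - y0)); rewrite -plane_measure_box.
have iw := integrable_tensor cu cv ce ye.
have uvM p : `|u p.1 * v p.2| <= (M / e) ^+ 2 by rewrite normrM expr2 ler_pM.
have iFw : mu2.-integrable B (EFin \o (fun p => (F p - L) * (u p.1 * v p.2))).
  apply: measurable_bounded_integrable => //.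
    apply: measurable_funM; first by apply: measurable_funB => //; exact: measurable_cst.
    by apply: measurable_funTS; exact: measurable_tensor.
  exists (delta * (M / e) ^+ 2); split=> [|x MNx p Bp]; first by rewrite num_real.
  by rewrite /= (le_trans _ (ltW MNx))// normrM ler_pM// FL.
have -> : \int[mu2]_(p in B) (F p * (u p.1 * v p.2)) - L =
    \int[mu2]_(p in B) ((F p - L) * (u p.1 * v p.2)).
  have E : L = \int[mu2]_(p in B) (L * (u p.1 * v p.2)).
    by rewrite RintegralZl// integral_tensor// u1 v1 !mulr1.
  rewrite {1}E.
  have iLw : mu2.-integrable B (EFin \o (fun p => L * (u p.1 * v p.2))).
    move: (integrableZl mB L iw); apply: (eq_integrable mB) => p _ /=.
    by rewrite EFinM.
  rewrite -RintegralB//.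
    by apply: eq_Rintegral => p _; rewrite mulrBl.
  move: (integrableD mB iFw iLw); apply: (eq_integrable mB) => p _ /=.
  by rewrite -EFinD; congr EFin; ring.
apply: (le_trans (le_normr_Rintegral mB iFw)).
have -> : delta * M ^+ 2 = \int[mu2]_(p in B) (delta * (M / e) ^+ 2).
  rewrite Rintegral_cst//.
  transitivity (delta * (M / e) ^+ 2 * ((c + e - c) * (y0 + e - y0))).
    by field; rewrite gt_eqF.
  by congr (_ * _); have /(congr1 fine) /= <- := plane_measure_box ce ye.
apply: le_Rintegral => //.
- by move: (integrable_abse iFw); apply: (eq_integrable mB).
- apply: measurable_bounded_integrable => //.
  exact: bounded_cst.
- by move=> p Bp /=; rewrite normrM ler_pM// FL.
Qed.

(** A smooth bump of mass one on [[c, c + e]], the derivative of a transition *)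
Definition bump (c e x : R) : R := e^-1 * derive1 (@sstep R) ((x - c) / e).

Lemma is_derive_sstep_affine (c e x : R) :
  is_derive x (1:R) (fun x => @sstep R ((x - c) / e)) (bump c e x).
Proof.
have [dS _] := smooth_derive1 (@smooth_sstep R).
have := @is_derive_affine R (@sstep R) e^-1 (- (c / e)) x _ (dS _).
have E (z : R) : e^-1 * z - c / e = (z - c) / e by rewrite mulrC mulrBl.
by rewrite E; congr is_derive; apply/funext => z; rewrite E.
Qed.

Lemma smooth_bump c e : smooth (bump c e).
Proof.
have [_ sS] := smooth_derive1 (@smooth_sstep R).
move=> n; have := @Ck_affine R n (derive1 (@sstep R)) e^-1 (- (c / e)) (sS n).
move=> /(@CkM R n _ _ (Ck_cst n e^-1)); congr (Ck n _).
by apply/funext => x; rewrite /bump /= mulrBl [x / e]mulrC.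
Qed.

Lemma bump_eq0 c e x : 0 < e -> ~~ (c <= x <= c + e) -> bump c e x = 0.
Proof.
move=> e0; have [dS _] := smooth_derive1 (@smooth_sstep R).
have dE (y d : R) : is_derive y (1:R) (@sstep R) d -> derive1 (@sstep R) y = d.
  by move=> [_ <-]; rewrite derive1E.
rewrite negb_and -!ltNge /bump => xce.
suff -> : derive1 (@sstep R) ((x - c) / e) = 0 by rewrite mulr0.
apply: dE; case/orP: xce => [xc|cx].
  apply: (near_eq_is_derive (f := cst (0:R))).
  near=> z; rewrite /= sstep_le0//; near: z; apply: lt_le_nbhsl.
  by rewrite pmulr_llt0 ?invr_gt0// subr_lt0.
apply: (near_eq_is_derive (f := cst (1:R))).
near=> z; rewrite /= sstep_ge1//; apply/ltW; near: z; apply: (cvgr_gt _ cvg_id).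
by rewrite ltr_pdivlMr// mul1r ltrBrDl.
Unshelve. all: by end_near. Qed.

Lemma bump_bounded : exists2 M : R, 0 < M &
  forall c e x, 0 < e -> `|bump c e x| <= M / e.
Proof.
have [_ sS] := smooth_derive1 (@smooth_sstep R).
have [M M0 HM] := @bounded_itv (derive1 (@sstep R)) 0 1 (sS 0%N).
exists (M + 1); first by rewrite ltr_wpDl.
move=> c e x e0.
have [/andP[cx xc]|/bump_eq0 ->//] := boolP (c <= x <= c + e); last first.
  by rewrite normr0 divr_ge0 ?ltW// ltr_wpDl.
rewrite /bump normrM mulrC [X in _ * X]ger0_norm ?invr_ge0 ?(ltW e0)//.
rewrite ler_pM2r ?invr_gt0//; apply: (le_trans (HM _ _)); last by rewrite lerDl.
by rewrite divr_ge0 ?subr_ge0 ?cx ?(ltW e0)//= ler_pdivrMr// mul1r lerBlDl.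
Qed.

Lemma integral_bump c e : 0 < e -> \int[mu]_(x in `[c, c + e]) bump c e x = 1.
Proof.
move=> e0; rewrite /Rintegral.
rewrite (@continuous_FTC2 R _ (fun x => @sstep R ((x - c) / e)) c (c + e)).
- rewrite subrr mul0r (@sstep_le0 R 0)// (_ : c + e - c = e) ?divff ?gt_eqF//; last by ring.
  rewrite sstep_ge1//.
  by rewrite -EFinB subr0.
- by rewrite ltrDl.
- by apply: continuous_subspaceT; exact: (smooth_bump c e 0%N).
- have cS (x : R) : {for x, continuous (fun x => @sstep R ((x - c) / e))}.
    exact: is_derive_continuous (is_derive_sstep_affine c e x).
  split=> [x _||]; first by case: (is_derive_sstep_affine c e x).
    by apply: cvg_at_right_filter; exact: cS.
  by apply: cvg_at_left_filter; exact: cS.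
- by move=> x _; rewrite derive1E; case: (is_derive_sstep_affine c e x).
Qed.

End Averages.

(** * Weak derivatives and horizontal segments *)

Section Slices.
Variable R : realType.
Local Notation mu := (@lebesgue_measure R).
Local Notation mu2 := (@plane_measure R).
Local Notation plane := (measurableTypeR R * measurableTypeR R)%type.

Definition disk2 : set (R * R) := [set p | p.1 ^+ 2 + p.2 ^+ 2 < 1].

Lemma preimage_unit_disk : @toC R @^-1` @unit_disk R = disk2.
Proof.
apply/seteqP; split=> -[x y]; rewrite /disk2 /unit_disk /= normc_def /= ltcR;
  by have := @ltr_sqrt R (x ^+ 2 + y ^+ 2) 1 ltr01; rewrite sqrtr1 => ->.
Qed.

Lemma measurable_disk2 : measurable (disk2 : set plane).
Proof.
have mf : measurable_fun setT (fun p : plane => p.1 ^+ 2 + p.2 ^+ 2).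
  by apply: measurable_funD; apply: measurable_funX.
have -> : disk2 = setT `&` (fun p : plane => p.1 ^+ 2 + p.2 ^+ 2) @^-1` `]-oo, 1[%classic.
  by apply/seteqP; split=> p /=; rewrite /disk2 /= in_itv//= => -[].
exact: mf.
Qed.

Lemma disk2_segment a x b y : disk2 (a, y) -> disk2 (b, y) -> a <= x -> x <= b ->
  disk2 (x, y).
Proof.
rewrite /disk2 /= => ay bY ax xb; have [x0|x0] := leP 0 x.
  by apply: le_lt_trans bY; rewrite lerD2r ler_sqr ?nnegrE ?(le_trans x0).
apply: le_lt_trans ay; rewrite lerD2r -sqrrN -[leRHS]sqrrN.
by rewrite ler_sqr ?nnegrE ?lerN2// oppr_ge0 ?ltW// (le_lt_trans ax).
Qed.

Lemma disk2_box (a b y0 e x y : R) : a ^+ 2 + (`|y0| + e) ^+ 2 < 1 ->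
  b ^+ 2 + (`|y0| + e) ^+ 2 < 1 -> a <= x <= b -> y0 <= y <= y0 + e ->
  disk2 (x, y).
Proof.
move=> ay bY /andP[ax xb] /andP[y0y yy0].
have := @disk2_segment a x b (`|y0| + e) ay bY ax xb; rewrite /disk2 /=.
apply: le_lt_trans; rewrite lerD2l -[y ^+ 2]real_normK ?num_real//.
have e0 : 0 <= e by have := le_trans y0y yy0; rewrite lerDl.
rewrite ler_sqr ?nnegrE ?addr_ge0// ler_norml.
have := ler_norm y0; have := ler_norm (- y0); rewrite normrN => *.
by apply/andP; split; lra.
Qed.

Let dist_triangle4 (u v x y d : R) : `|u - x| <= d -> `|v - y| <= d ->
  `|y - x| <= 2 * d + `|u - v|.
Proof.
move=> ux vy; have -> : y - x = (u - x) - (v - y) - (u - v) by ring.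
apply: (le_trans (ler_normB _ _)); rewrite lerD2r.
by apply: (le_trans (ler_normB _ _)); lra.
Qed.

Variables F g : R * R -> R.
Hypothesis iF : mu2.-integrable (disk2 : set plane) (EFin \o F).
Hypothesis ig : mu2.-integrable (disk2 : set plane) (EFin \o g).
Hypothesis wd : weak_derivative disk2 (1, 0) F g.
Hypothesis cF : forall p, disk2 p -> {for p, continuous F}.

(** The mass of [g] on the part of a horizontal segment that lies in the disk.
    The restriction to [disk2] makes it meaningful for all segments. *)
Definition slice (a b y : R) : \bar R :=
  \int[mu]_(x in `[a, b]) (`|(g \_ disk2) (x, y)|)%:E.

Variable M : R.
Hypothesis M0 : 0 < M.
Hypothesis HM : forall c e x : R, 0 < e -> `|bump c e x| <= M / e.

Let G (a b : R) (p : plane) : \bar R := (`|(g \_ disk2) p| * \1_(`[a, b]%classic) p.1)%:E.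

Let mG a b : measurable_fun setT (G a b).
Proof.
apply/measurable_EFinP; apply: measurable_funM.
  have mg : measurable_fun (disk2 : set plane) (g : plane -> R).
    by apply/measurable_EFinP; exact: measurable_int ig.
  apply: measurableT_comp => //.
  exact: (measurable_restrictT (g : plane -> R) measurable_disk2).1.
apply: measurableT_comp => //; exact: measurable_indic.
Qed.

Let G0 a b p : (0 <= G a b p)%E.
Proof. by rewrite lee_fin mulr_ge0. Qed.

Let GE a b y : (\int[mu]_x G a b (x, y) = slice a b y)%E.
Proof.
rewrite /slice [RHS]integral_mkcond; apply: eq_integral => x _.
by rewrite /G indicE /= [RHS]patchE; case: ifP => h; rewrite /= ?mulr1 ?mulr0.
Qed.

Section rectangle.
Variables (a b b' y0 e delta : R).
Hypotheses (ab : a < b) (e0 : 0 < e) (eb : b + e <= b').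
Hypothesis ay : a ^+ 2 + (`|y0| + e) ^+ 2 < 1.
Hypothesis by' : b' ^+ 2 + (`|y0| + e) ^+ 2 < 1.
Hypothesis da : forall p, a <= p.1 <= a + e -> y0 <= p.2 <= y0 + e ->
  `|F p - F (a, y0)| <= delta.
Hypothesis db : forall p, b <= p.1 <= b + e -> y0 <= p.2 <= y0 + e ->
  `|F p - F (b, y0)| <= delta.

Let X x : R := sstep ((x - a) / e) - sstep ((x - b) / e).
Let Y := bump y0 e.
Let psi (p : R * R) : R := X p.1 * Y p.2.
Let w c (p : R * R) := bump c e p.1 * bump y0 e p.2.
Let B c := `[c, c + e]%classic `*` `[y0, y0 + e]%classic.

Let sX : smooth X.
Proof.
move=> n; rewrite /X.
have H c : Ck n (fun x : R => @sstep R ((x - c) / e)).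
  have := @Ck_affine R n (@sstep R) e^-1 (- (c / e)) (@smooth_sstep R n).
  by congr (Ck n _); apply/funext => x; rewrite mulrBl [x / e]mulrC.
have := CkD (H a) (CkM (Ck_cst n (-1)) (H b)).
by congr (Ck n _); apply/funext => x /=; rewrite mulN1r.
Qed.

Let dX x : is_derive x (1:R) X (bump a e x - bump b e x).
Proof. by apply: is_deriveB; exact: is_derive_sstep_affine. Qed.

Let XE x : ~~ (a <= x <= b + e) -> X x = 0.
Proof.
rewrite negb_and -!ltNge /X => /orP[xa|bx].
  by rewrite !sstep_le0 ?subrr// pmulr_lle0 ?invr_gt0// subr_le0 ltW// (lt_trans xa).
have h c : c <= b -> sstep ((x - c) / e) = 1.
  by move=> cb; rewrite sstep_ge1// ler_pdivlMr// mul1r; lra.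
by rewrite !h ?subrr// ltW.
Qed.

Let X1 x : `|X x| <= 1.
Proof.
rewrite /X ler_norml; have := @sstep_ge0 R ((x - a) / e).
have := @sstep_ge0 R ((x - b) / e); have := @sstep_le1 R ((x - a) / e).
by have := @sstep_le1 R ((x - b) / e) => ? ? ? ?; apply/andP; split; lra.
Qed.

Let psi_test : test_function disk2 psi.
Proof.
have ub : [set p | psi p != 0] `<=` `[a, b + e]%classic `*` `[y0, y0 + e]%classic.
  move=> p /=; apply: contraNP => /not_andP; rewrite /psi !in_itv /= => -[|] /negP h.
    by rewrite XE// mul0r.
  by rewrite /Y bump_eq0// mulr0.
have cpt : compact (`[a, b + e]%classic `*` `[y0, y0 + e]%classic : set (R * R)).
  by apply: compact_setX; exact: segment_compact.
have clo : closed (`[a, b + e]%classic `*` `[y0, y0 + e]%classic : set (R * R)).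
  by apply: compact_closed => //; exact: norm_hausdorff.
have cub : closure [set p | psi p != 0] `<=` `[a, b + e]%classic `*` `[y0, y0 + e]%classic.
  by rewrite closureE => p; apply; split.
split.
- by move=> n; apply: Cn_tensor => //; exact: smooth_bump.
- by apply: (subclosed_compact _ cpt) => //; exact: closed_closure.
- move=> [x y] /cub [] /=; rewrite !in_itv /= => xab yy0.
  apply: (disk2_box ay by' _ yy0); move: xab => /andP[-> /=].
  by move=> xb; apply: le_trans xb _.
Qed.

Let Dpsi : 'D_(1, 0) psi = (fun p => w a p - w b p).
Proof.
apply/funext => p; have [_ ->] := @is_derive_tensor1 R X Y p _ (dX p.1).
by rewrite mulrBl.
Qed.

Let Bdisk c : a <= c <= b -> B c `<=` disk2.
Proof.
move=> /andP[ac cb] [x y] [] /=; rewrite !in_itv /= => /andP[cx xc] yy.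
apply: (disk2_box ay by' _ yy); rewrite (le_trans ac cx) (le_trans xc)//.
by rewrite (le_trans _ eb)// lerD2r.
Qed.

Let measurable_w c : measurable_fun setT (w c : plane -> R).
Proof.
apply: measurable_tensor; [exact: (@smooth_bump R c e 0%N)|exact: (@smooth_bump R y0 e 0%N)].
Qed.

Let w_le c p : `|w c p| <= (M / e) ^+ 2.
Proof. by rewrite normrM expr2 ler_pM// HM. Qed.

Let iFw c : mu2.-integrable (disk2 : set plane) (EFin \o (fun p => F p * w c p)).
Proof.
have := @integrableMr _ _ _ mu2 _ measurable_disk2 (w c) _ (measurable_funTS (measurable_w c)) _ iF.
move=> H; apply: (eq_integrable measurable_disk2 _ _ _ (H _)).
  by move=> p _ /=; rewrite -EFinM mulrC.
exists ((M / e) ^+ 2); split; first exact: num_real.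
by move=> x Mx p _; exact: le_trans (w_le c p) (ltW Mx).
Qed.

Let avg c : a <= c <= b ->
  (forall p, c <= p.1 <= c + e -> y0 <= p.2 <= y0 + e -> `|F p - F (c, y0)| <= delta) ->
  `|\int[mu2]_(p in disk2) (F p * w c p) - F (c, y0)| <= delta * M ^+ 2.
Proof.
move=> acb dc.
have -> : \int[mu2]_(p in disk2) (F p * w c p) = \int[mu2]_(p in B c) (F p * w c p).
  rewrite Rintegral_mkcond [RHS]Rintegral_mkcond; congr Rintegral; apply/funext => p.
  rewrite !patchE; have [pB|pB] := boolP (p \in B c).
    by rewrite mem_set//; apply: (Bdisk acb); exact/set_mem.
  case: ifP => // _; suff -> : w c p = 0 by rewrite mulr0.
  move/negP: pB; rewrite inE /B /= !in_itv /= => /not_andP[|] /negP h.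
    by rewrite /w (bump_eq0 e0 h) mul0r.
  by rewrite /w (bump_eq0 e0 h) mulr0.
apply: (@tensor_average R F (bump c e) (bump y0 e)) => //.
- exact: (@smooth_bump R c e 0%N).
- exact: (@smooth_bump R y0 e 0%N).
- by move=> x; exact: HM.
- by move=> x; exact: HM.
- exact: integral_bump.
- exact: integral_bump.
- apply: measurable_funS measurable_disk2 (Bdisk acb) _.
  by apply/measurable_EFinP; exact: measurable_int iF.
- by move=> p [] /=; rewrite !in_itv /=; exact: dc.
Qed.

Let weak_bound : (`|\int[mu2]_(p in disk2) (g p * psi p)|%:E <=
  (M / e)%:E * \int[mu]_(y in `[y0, (y0 + e)%R]) slice a b' y)%E.
Proof.
have mgpsi : measurable_fun (disk2 : set plane) (fun p => g p * psi p).
  apply: measurable_funM; first by apply/measurable_EFinP; exact: measurable_int ig.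
  apply: measurable_funTS; apply: measurable_tensor; first exact: (sX 0%N).
  exact: (@smooth_bump R y0 e 0%N).
have psiM p : `|psi p| <= M / e.
  by rewrite normrM -[leRHS]mul1r ler_pM// HM.
have igpsi : mu2.-integrable (disk2 : set plane) (EFin \o (fun p => g p * psi p)).
  have mpsi : measurable_fun (disk2 : set plane) (psi : plane -> R).
    apply: measurable_funTS; apply: measurable_tensor; first exact: (sX 0%N).
    exact: (@smooth_bump R y0 e 0%N).
  have H := @integrableMr _ _ _ mu2 _ measurable_disk2 psi _ mpsi _ ig.
  apply: (eq_integrable measurable_disk2 _ _ _ (H _)).
    by move=> p _ /=; rewrite -EFinM mulrC.
  exists (M / e); split; first exact: num_real.
  by move=> x Mx p _; exact: le_trans (psiM p) (ltW Mx).
have mE : measurable_fun setT (fun p : plane => (\1_(`[y0, y0 + e]%classic) p.2)%:E : \bar R).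
  by apply/measurable_EFinP; apply: measurableT_comp => //; exact: measurable_indic.
have GE0 p : (0 <= G a b' p * (\1_(`[y0, y0 + e]%classic) p.2)%:E)%E.
  by rewrite mule_ge0// lee_fin.
have mGE : measurable_fun setT (fun p : plane => G a b' p * (\1_(`[y0, y0 + e]%classic) p.2)%:E)%E.
  exact: emeasurable_funM.
rewrite (@le_trans _ _ (\int[mu2]_(p in disk2) (`|g p * psi p|)%:E)%E)//.
  rewrite EFin_normr_Rintegral//; last exact: measurable_disk2.
  by apply: le_abse_integral; [exact: measurable_disk2|exact/measurable_EFinP].
rewrite integral_mkcond.
apply: (@le_trans _ _ (\int[mu2]_p ((M / e)%:E * (G a b' p * (\1_(`[y0, y0 + e]%classic) p.2)%:E)))%E).
  apply: ge0_le_integral => //.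
  - by move=> p _; rewrite patchE; case: ifP => // _; rewrite lee_fin.
  - have H : measurable_fun (disk2 : set plane) (fun p : plane => (`|g p * psi p|)%:E : \bar R).
      by apply/measurable_EFinP; exact: measurableT_comp.
    exact: (measurable_restrictT _ measurable_disk2).1.
  - exact: measurable_funeM.
  move=> p _; rewrite patchE; case: ifP => [pD|_]; last first.
    by rewrite mule_ge0// lee_fin divr_ge0// ltW.
  rewrite /G !indicE -!EFinM lee_fin patchE pD normrM.
  have [pX|pX] := boolP (p.1 \in `[a, b']%classic); last first.
    rewrite /psi XE ?mul0r ?normr0 ?mulr0 ?mul0r ?mulr0//.
    by apply: contra pX; rewrite inE /= in_itv /= => /andP[-> /le_trans]; apply.
  have [pY|pY] := boolP (p.2 \in `[y0, y0 + e]%classic); last first.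
    rewrite /psi /Y bump_eq0 ?mulr0 ?normr0 ?mulr0//.
    by apply: contra pY; rewrite inE /= in_itv.
  by rewrite !mulr1 mulrC ler_wpM2r.
rewrite ge0_integralZl//; last by rewrite lee_fin divr_ge0// ltW.
rewrite lee_wpmul2l//; first by rewrite lee_fin divr_ge0// ltW.
rewrite fubini_tonelli2// [leRHS]integral_mkcond.
rewrite le_eqVlt; apply/orP; left; apply/eqP; apply: eq_integral => y _.
rewrite /fubini_G /= patchE indicE; case: ifP => _ /=; last first.
  by rewrite integral0_eq// => x _; rewrite mule0.
by rewrite -GE; apply: eq_integral => x _; rewrite mule1.
Qed.

(** The weak derivative is tested against [psi], a smooth version of the
    indicator of [[a, b]] times a bump of width [e] at height [y0].  The
    derivative of [psi] is a difference of two kernels of mass one near the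
    points [(a, y0)] and [(b, y0)], so that testing [F] gives [F (a, y0)] minus
    [F (b, y0)] up to the oscillation [delta] of [F], whereas testing [g] gives
    at most an average of the mass of [g] over heights near [y0]. *)
Lemma rectangle_estimate : (`|F (b, y0) - F (a, y0)|%:E <=
  (2 * delta * M ^+ 2)%:E +
  (M / e)%:E * \int[mu]_(y in `[y0, (y0 + e)%R]) slice a b' y)%E.
Proof.
have Aa := @avg a _ da; have Ab := @avg b _ db.
have H := wd psi_test.
have {}H : \int[mu2]_(p in disk2) (F p * (w a p - w b p)) =
    - \int[mu2]_(p in disk2) (g p * psi p).
  rewrite -H; apply: eq_Rintegral => p _; congr (_ * _).
  by have /(congr1 (fun f => f p)) := Dpsi.
have E : \int[mu2]_(p in disk2) (F p * (w a p - w b p)) =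
  \int[mu2]_(p in disk2) (F p * w a p) - \int[mu2]_(p in disk2) (F p * w b p).
  rewrite -RintegralB//.
  - by apply: eq_Rintegral => p _; rewrite mulrBr.
  - exact: measurable_disk2.
rewrite E in H.
apply: (@le_trans _ _ ((2 * delta * M ^+ 2)%:E +
  `|\int[mu2]_(p in disk2) (g p * psi p)|%:E)%E); last by rewrite leeD2l// weak_bound.
rewrite -EFinD lee_fin.
have {}Aa : `|\int[mu2]_(p in disk2) (F p * w a p) - F (a, y0)| <= delta * M ^+ 2.
  by apply: Aa; rewrite lexx ltW.
have {}Ab : `|\int[mu2]_(p in disk2) (F p * w b p) - F (b, y0)| <= delta * M ^+ 2.
  by apply: Ab; rewrite lexx ltW.
rewrite -[`|\int[mu2]_(p in disk2) (g p * psi p)|]normrN -H.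
move: Aa Ab; set A1 := (X in `|X - _|); set A2 := (X in _ -> `|X - _| <= _ -> _).
by rewrite -mulrA; exact: dist_triangle4.
Qed.

End rectangle.

Lemma slice_measurable a b : measurable_fun setT (slice a b).
Proof.
have := measurable_fun_fubini_tonelli_G (m1 := mu) _ (mG a b) (G0 a b).
by apply: eq_measurable_fun => y _; rewrite /fubini_G GE.
Qed.

Lemma slice_ge0 a b y : (0 <= slice a b y)%E.
Proof. exact: integral_ge0. Qed.

Lemma slice_integrable a b : mu.-integrable setT (slice a b).
Proof.
apply/integrableP; split; first exact: slice_measurable.
under eq_integral do rewrite gee0_abs ?slice_ge0// -GE.
rewrite -(fubini_tonelli2 (m1 := mu) (m2 := mu) _ (mG a b) (G0 a b)).
have /integrableP [mg] := ig; apply: le_lt_trans.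
rewrite [leRHS]integral_mkcond; apply: ge0_le_integral => //.
- have H : measurable_fun (disk2 : set plane) (fun p : plane => `|(g p)%:E|%E) by exact: measurableT_comp.
  exact: (measurable_restrictT _ measurable_disk2).1.
move=> p _; rewrite /G !patchE; case: ifP => _ /=; last by rewrite normr0 mul0r.
by rewrite lee_fin indicE ler_piMr// lern1 leq_b1.
Qed.

(** At a Lebesgue point of the slice as a function of the height,
    [rectangle_estimate] with [e] tending to [0] turns the average of the slices
    into the slice itself; the margin between [b] and [b'] absorbs the width of
    the test function. *)
Lemma slice_estimate a b b' : a < b -> b < b' ->
  {ae mu, forall y, disk2 (a, y) -> disk2 (b', y) ->
    (`|F (b, y) - F (a, y)|%:E <= M%:E * slice a b' y)%E}.
Proof.
move=> ab bb'.
pose k y := fine (slice a b' y).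
have fK := integrable_ae measurableT (slice_integrable a b').
have kK : {ae mu, forall y, slice a b' y = (k y)%:E}.
  by apply: filterS fK => y /(_ I) yf; rewrite /k fineK.
have mk : measurable_fun setT k.
  apply: (measurableT_comp (f := fine)); first exact: fine_measurable.
  exact: slice_measurable.
have ik : mu.-integrable setT (EFin \o k).
  have /integrableP [ms si] := slice_integrable a b'.
  apply/integrableP; split; first exact/measurable_EFinP.
  apply: le_lt_trans si; rewrite le_eqVlt; apply/orP; left; apply/eqP.
  apply: ae_eq_integral => //.
  - by apply: measurableT_comp => //; exact/measurable_EFinP.
  - exact: measurableT_comp.
  - by apply: (@filterS _ _ (ae_filter_ringOfSetsType mu) _ _ _ kK) => y ->.
have lk : locally_integrable setT k by apply: open_integrable_locally => //; exact: openT.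
have Lk := lebesgue_differentiation lk.
apply: (@filterS2 _ _ (ae_filter_ringOfSetsType mu) _ _ _ _ kK Lk) => y0 ky0 Lk0 ya yb'.
have ybb : disk2 (b, y0).
  exact: disk2_segment ya yb' (ltW ab) (ltW bb').
pose E (x : R) n := `[x, x + n.+1%:R^-1]%classic : set R.
have n0 n : 0 < n.+1%:R^-1 :> R by rewrite invr_gt0.
have muE x n : mu (E x n) = (n.+1%:R^-1)%:E.
  by rewrite lebesgue_measure_itv /= lte_fin ltrDl n0 -EFinD addrAC subrr add0r.
(* The heights above [y0] only: the averages over one-sided intervals
   converge at almost every point as well. *)
have nE x : nicely_shrinking x (E x).
  split=> [n|]; first exact: measurable_itv.
  exists (4, fun n => PosNum (mulr_gt0 (ltr0n R 2) (n0 n))); split => //=.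
  - rewrite -(mulr0 2); apply: cvgMr; exact: cvg_harmonic.
  - move=> n z; rewrite /E /ball /= in_itv /= => /andP[xz zx].
    rewrite ler0_norm ?subr_le0// opprB ltrBlDl (le_lt_trans zx)// ltrD2l.
    by rewrite ltr_pMl// ltr1n.
  - move=> n; rewrite muE lebesgue_measure_ball ?mulr_ge0 ?(ltW (n0 n))//.
    rewrite -EFinM lee_fin; move: (_^-1) => t; rewrite le_eqVlt; apply/orP; left.
    by apply/eqP; ring.
rewrite ky0 -EFinM lee_fin; apply/ler_addgt0Pr => eta eta0.
have /fine_cvgP[_] := nice_lebesgue_differentiation nE lk Lk0.
move=> /cvgrPdist_lt /(_ (eta / (2 * M))) kav.
have eM : 0 < eta / (2 * M) by rewrite divr_gt0// mulr_gt0.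
(* With this oscillation, and an average of the slices within
   [eta / (2 * M)] of its limit, the total error is [eta]. *)
pose delta := eta / (4 * M ^+ 2).
have d0 : 0 < delta by rewrite divr_gt0// mulr_gt0// exprn_gt0.
have cont c : disk2 (c, y0) -> exists2 r : R, 0 < r & forall e : R, e < r ->
    forall p, c <= p.1 <= c + e -> y0 <= p.2 <= y0 + e ->
    `|F p - F (c, y0)| <= delta.
  move=> /cF /cvgrPdist_le /(_ delta d0) /nbhs_ballP [r /= r0 Hr].
  exists r => // e er [x y] /= /andP[cx xc] /andP[yy0 yy].
  rewrite distrC; apply: Hr; split; rewrite /ball /= ler0_norm ?subr_le0// opprB;
    by apply: le_lt_trans er; rewrite lerBlDl.
have [ra ra0 Ha] := cont a ya; have [rb rb0 Hb] := cont b ybb.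
have room c : disk2 (c, y0) -> exists2 r : R, 0 < r & forall e : R, 0 < e -> e < r ->
    c ^+ 2 + (`|y0| + e) ^+ 2 < 1.
  rewrite /disk2 /= => cy; exists (Num.min 1 ((1 - c ^+ 2 - y0 ^+ 2) / 3)).
    by rewrite lt_min ltr01 /= divr_gt0//; lra.
  move=> e e0; rewrite lt_min => /andP[e1 e3].
  have y1 : `|y0| < 1.
    rewrite -(@ltr_pXn2r _ 2) ?nnegrE// expr1n real_normK ?num_real//.
    by have := sqr_ge0 c; lra.
  have y0E : `|y0| ^+ 2 = y0 ^+ 2 by rewrite real_normK ?num_real.
  have := normr_ge0 y0; move: y1 y0E e3; set t := `|y0| => *; nra.
have [r1 r10 H1] := room a ya; have [r2 r20 H2] := room b' yb'.
have small r : 0 < r -> \forall n \near \oo, n.+1%:R^-1 < r :> R.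
  by move=> r0; exact: (near_infty_natSinv_lt (PosNum r0)).
near \oo => n.
have era : n.+1%:R^-1 < ra by near: n; exact: small.
have erb : n.+1%:R^-1 < rb by near: n; exact: small.
have er1 : n.+1%:R^-1 < r1 by near: n; exact: small.
have er2 : n.+1%:R^-1 < r2 by near: n; exact: small.
have ebb : n.+1%:R^-1 < b' - b by near: n; apply: small; rewrite subr_gt0.
have avn : `|k y0 - fine ((mu (E y0 n))^-1 * \int[mu]_(y in E y0 n) (k y)%:E)| <
    eta / (2 * M) by near: n; exact: kav.
have e0 := n0 n; set e : R := n.+1%:R^-1 in e0 era erb er1 er2 ebb.
have eb : b + e <= b' by move: ebb; rewrite ltrBrDl => /ltW.
have := rectangle_estimate ab e0 eb (H1 e e0 er1) (H2 e e0 er2) (Ha e era) (Hb e erb).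
have -> : (\int[mu]_(y in `[y0, (y0 + e)%R]) slice a b' y =
    \int[mu]_(y in E y0 n) (k y)%:E)%E.
  apply: ae_eq_integral => //.
  - by apply: measurable_funTS; exact: slice_measurable.
  - by apply: measurable_funTS; exact/measurable_EFinP.
  - by apply: (@filterS _ _ (ae_filter_ringOfSetsType mu) _ _ _ kK) => y -> _.
have kf : (\int[mu]_(y in E y0 n) (k y)%:E)%E \is a fin_num.
  have mE : measurable (E y0 n : set (measurableTypeR R)) by exact: measurable_itv.
  have iE : mu.-integrable (E y0 n) (EFin \o k).
    by move: ik; apply: integrableS => //; exact: measurableT.
  exact: (integrable_fin_num mE iE).
move: avn; rewrite muE -(fineK kf); set I := fine (\int[mu]_(y in _) _)%E.
rewrite inver (gt_eqF (n0 n)) -EFinM /= => avn.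
rewrite -EFinM -EFinD lee_fin => /le_trans; apply.
have -> : 2 * delta * M ^+ 2 = eta / 2.
  by rewrite /delta; field; rewrite gt_eqF.
have : e^-1 * I <= k y0 + eta / (2 * M).
  by move: avn; rewrite ltr_norml => /andP[+ _]; rewrite -/e; lra.
move=> /(ler_wpM2l (ltW M0)); rewrite mulrDr mulrA.
have -> : M * (eta / (2 * M)) = eta / 2 by field; rewrite gt_eqF.
lra.
Unshelve. all: by end_near. Qed.

End Slices.

(** * Absolute continuity on almost every line *)

(** The supremum of the points related to [a] is itself related to [a], and it
    is exceeded by another such point unless it is [b]. *)
Lemma real_induction (R : realType) (C : R -> R -> Prop) (a b : R) :
  a <= b ->
  (forall x y z, a <= x -> x <= y -> y <= z -> z <= b -> C x y -> C y z -> C x z) ->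
  (forall t, a <= t <= b -> exists2 r : R, 0 < r &
    forall s, a <= s <= b -> `|s - t| < r ->
      (s <= t -> C s t) /\ (t <= s -> C t s)) ->
  C a b.
Proof.
move=> ab tr loc.
pose S : set R := [set x | a <= x <= b /\ C a x].
have Sa : S a.
  have aab : a <= a <= b by rewrite lexx.
  split=> //; have [r r0 Hr] := loc a aab.
  by have [|] := Hr a aab; [rewrite subrr normr0|move=> + _; apply].
have Sub : ubound S b by move=> x [/andP[]].
have hS : has_sup S by split; [exists a|exists b].
set t := sup S.
have tab : a <= t <= b by rewrite (ub_le_sup hS.2 Sa)/= (ge_sup hS.1 Sub).
have /andP[at_ tb] := tab.
have [r r0 Hr] := loc t tab.
have Ct : C a t.
  have [s Ss ts] := sup_adherent r0 hS.
  have [/andP[as_ sb] Cas] := Ss.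
  have st : s <= t by exact: ub_le_sup hS.2 _ Ss.
  apply: (tr a s t) => //.
  have asb : a <= s <= b by rewrite as_.
  have [|+ _] := Hr s asb; last exact.
  by rewrite ler0_norm ?subr_le0// opprB ltrBlDl -ltrBlDr.
have [bt|tb'] := leP b t; first by have -> : b = t by apply/le_anti; rewrite bt tb.
pose s := Num.min b (t + r / 2).
have ts : t < s by rewrite lt_min tb' ltrDl divr_gt0.
have sb : s <= b by rewrite ge_min lexx.
have as_ : a <= s by exact: le_trans at_ (ltW ts).
have Ss : S s.
  split; first by rewrite as_.
  apply: (tr a t s) => //; first exact: ltW.
  have asb : a <= s <= b by rewrite as_.
  have [|_] := Hr s asb; last by apply; exact: ltW.
  rewrite ger0_norm ?subr_ge0 ?(ltW ts)// ltrBlDl.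
  have : s <= t + r / 2 by rewrite ge_min lexx orbT.
  by move/le_lt_trans; apply; rewrite ltrD2l ltr_pdivrMr// ltr_pMr// ltr1n.
by have := ub_le_sup hS.2 Ss; rewrite leNgt ts.
Qed.

Section AbsoluteContinuity.
Variable R : realType.
Local Notation mu := (@lebesgue_measure R).
Local Notation mu2 := (@plane_measure R).
Local Notation plane := (measurableTypeR R * measurableTypeR R)%type.
Implicit Types (F g : R * R -> R) (a b c y : R).

Lemma measurable_section g y : measurable_fun (@disk2 R : set plane) (g : plane -> R) ->
  measurable_fun setT (fun x : measurableTypeR R => (`|(g \_ (@disk2 R)) (x, y)|)%:E : \bar R).
Proof.
move=> mg; apply/measurable_EFinP; apply: measurableT_comp => //.
have := (measurable_restrictT (g : plane -> R) (@measurable_disk2 R)).1 mg.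
by move=> H; apply: (measurableT_comp H); exact: measurable_pair2.
Qed.

Lemma slice_le g a b a' b' y : measurable_fun (@disk2 R : set plane) (g : plane -> R) ->
  a' <= a -> b <= b' -> (slice g a b y <= slice g a' b' y)%E.
Proof.
move=> mg aa bb; apply: ge0_subset_integral => //.
- by apply: measurable_funTS; exact: measurable_section.
- by move=> x /=; rewrite !in_itv /= => /andP[ax xb]; rewrite (le_trans aa ax) (le_trans xb bb).
Qed.

Lemma slice_split g a c b y : measurable_fun (@disk2 R : set plane) (g : plane -> R) ->
  a <= c -> c <= b -> (slice g a c y + slice g c b y = slice g a b y)%E.
Proof.
move=> mg ac cb.
have mgs := measurable_section y mg.
rewrite /slice [X in (_ + X)%E](_ : _ =
   \int[mu]_(x in `]c, b]) (`|(g \_ (@disk2 R)) (x, y)|)%:E)%E; last first.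
  rewrite integral_itv_obnd_cbnd//.
  exact: measurable_funTS.
rewrite -ge0_integral_setU//.
- congr integral; apply/seteqP; split=> x /=; rewrite !in_itv /=.
    by case=> /andP[H1 H2]; [rewrite H1 (le_trans H2)|rewrite H2 (le_trans ac (ltW H1))].
  by move=> /andP[-> xb]; have [xc|xc] := leP x c; [left|right].
- exact: measurable_funTS.
- apply/disj_setPS => x [] /=; rewrite !in_itv /=.
  by move=> /andP[_ xc] /andP[cx _]; move: xc; rewrite leNgt cx.
Qed.

(** Sobolev functions are absolutely continuous on almost every line: a weak
    derivative controls the increments of a continuous function. *)
Lemma acl_estimate : exists2 M : R, 0 < M & forall F g,
  mu2.-integrable (@disk2 R : set plane) (EFin \o F) ->
  mu2.-integrable (@disk2 R : set plane) (EFin \o g) ->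
  weak_derivative (@disk2 R) (1, 0) F g ->
  (forall p, disk2 p -> {for p, continuous F}) ->
  {ae mu, forall y : R, forall a b : R, a < b -> disk2 (a, y) -> disk2 (b, y) ->
    (`|F (b, y) - F (a, y)|%:E <= M%:E * slice g a b y)%E}.
Proof.
have [M M0 HM] := bump_bounded R; exists M => // F g iF ig wd cF.
have mg : measurable_fun (@disk2 R : set plane) (g : plane -> R).
  by apply/measurable_EFinP; exact: measurable_int ig.
(* Almost every height is good for all rational triples at once; the limit
   below then extends the estimate to all segments by continuity. *)
pose P (n : nat) (y : measurableTypeR R) : Prop := forall q1 q2 q3 : rat,
  unpickle n = Some (q1, q2, q3) -> q1 < q2 -> q2 < q3 ->
  disk2 (ratr q1 : R, y) -> disk2 (ratr q3 : R, y) ->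
  (`|F (ratr q2, y) - F (ratr q1, y)|%:E <= M%:E * slice g (ratr q1) (ratr q3) y)%E.
have HP : {ae mu, forall y, forall n, P n y}.
  apply: ae_foralln => n; rewrite /P.
  case E : (unpickle n : option (rat * rat * rat)) => [[[q1 q2] q3]|]; last exact: aeW.
  have [q12|] := boolP (q1 < q2); last by move=> /negP h; apply: aeW => y ? ? ? [<- <- _] /h.
  have [q23|] := boolP (q2 < q3); last by move=> /negP h; apply: aeW => y ? ? ? [_ <- <-] _ /h.
  have H := slice_estimate iF ig wd cF M0 HM (a := ratr q1) (b := ratr q2) (b' := ratr q3).
  rewrite !ltr_rat in H.
  apply: (@filterS _ _ (ae_filter_ringOfSetsType mu) _ _ _ (H q12 q23)).
  by move=> y Hy ? ? ? [<- <- <-] _ _; exact: Hy.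
apply: (@filterS _ _ (ae_filter_ringOfSetsType mu) _ _ _ HP) => y Hy a b ab ya yb.
have cFx c : disk2 (c, y) -> {for c, continuous (fun x => F (x, y))}.
  move=> yc; apply: (continuous_comp (f := fun x => (x, y))); last exact: cF.
  exact: (cvg_pair (@cvg_id _ (nbhs c)) (cvg_cst y)).
have slb : slice g a b y \is a fin_num \/ slice g a b y = +oo%E.
  have := slice_ge0 g a b y; case: (slice g a b y) => // [r _|_]; by [left|right].
have [sf|->] := slb; last by rewrite gt0_muley ?lte_fin// leey.
rewrite -(fineK sf) -EFinM lee_fin; apply/ler_addgt0Pr => e e0.
have e20 : 0 < e / 2 by rewrite divr_gt0.
have /cvgrPdist_le /(_ _ e20) /nbhs_ballP [ra /= ra0 Ha] := cFx a ya.
have /cvgrPdist_le /(_ _ e20) /nbhs_ballP [rb /= rb0 Hb] := cFx b yb.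
pose m := (a + b) / 2.
have am : a < m by rewrite /m; lra.
have mb : m < b by rewrite /m; lra.
have : a < Num.min m (a + ra) by rewrite lt_min am ltrDl.
move=> /rat_in_itvoo [q1]; rewrite in_itv /= lt_min => /andP[aq1 /andP[q1m q1a]].
have : Num.max m (b - rb) < b by rewrite gt_max mb ltrBlDr ltrDl.
move=> /[dup] bb /rat_in_itvoo [q2]; rewrite in_itv /= gt_max => /andP[/andP[mq2 bq2] q2b].
have /rat_in_itvoo [q3] := q2b; rewrite in_itv /= => /andP[q23 q3b].
have q12 : ratr q1 < ratr q2 :> R by exact: lt_trans mq2.
have D x : a <= x -> x <= b -> disk2 (x, y) by exact: disk2_segment.
have := Hy (pickle (q1, q2, q3)) q1 q2 q3.
rewrite pickleK -(ltr_rat R q1) -(ltr_rat R q2) => /(_ erefl q12 q23).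
have aq3 : a < ratr q3 by apply: lt_trans q23; exact: lt_trans q12.
have q1b : ratr q1 < b by exact: lt_trans mb.
have d1 : disk2 (ratr q1 : R, y) by apply: D; exact: ltW.
have d3 : disk2 (ratr q3 : R, y) by apply: D; exact: ltW.
move=> /(_ d1 d3) est.
have sl : (slice g (ratr q1) (ratr q3) y <= slice g a b y)%E.
  by apply: slice_le => //; exact: ltW.
have {}est : `|F (ratr q2, y) - F (ratr q1, y)| <= M * fine (slice g a b y).
  rewrite -lee_fin EFinM fineK//; apply: (le_trans est).
  by rewrite lee_wpmul2l// lee_fin ltW.
have h1 : `|F (a, y) - F (ratr q1, y)| <= e / 2.
  by apply: Ha; rewrite /ball /= ltr0_norm ?subr_lt0// opprB ltrBlDl.
have h2 : `|F (b, y) - F (ratr q2, y)| <= e / 2.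
  by apply: Hb; rewrite /ball /= gtr0_norm ?subr_gt0// ltrBlDr -ltrBlDl.
move: est h1 h2; move: (fine _) (F (ratr q1, y)) (F (ratr q2, y)) (F (a, y)) (F (b, y)) => S f1 f2 fa fb.
clear; rewrite !ler_norml => /andP[? ?] /andP[? ?] /andP[? ?]; apply/andP; split; lra.
Qed.

End AbsoluteContinuity.

(** * Mass of the weak derivative on chords *)

Section Chords.
Variable R : realType.
Local Notation mu := (@lebesgue_measure R).
Local Notation mu2 := (@plane_measure R).
Local Notation plane := (measurableTypeR R * measurableTypeR R)%type.

Variables F1 F2 g1 g2 P : R * R -> R.
Variable C : R.
Hypothesis C0 : 0 <= C.
Hypothesis iF1 : mu2.-integrable (@disk2 R : set plane) (EFin \o F1).
Hypothesis iF2 : mu2.-integrable (@disk2 R : set plane) (EFin \o F2).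
Hypothesis ig1 : mu2.-integrable (@disk2 R : set plane) (EFin \o g1).
Hypothesis ig2 : mu2.-integrable (@disk2 R : set plane) (EFin \o g2).
Hypothesis wd1 : weak_derivative (@disk2 R) (1, 0) F1 g1.
Hypothesis wd2 : weak_derivative (@disk2 R) (1, 0) F2 g2.
Hypothesis cF1 : forall p, disk2 p -> {for p, continuous F1}.
Hypothesis cF2 : forall p, disk2 p -> {for p, continuous F2}.
Hypothesis lipP : forall p, disk2 p -> exists2 r : R, 0 < r &
  forall x, `|x - p.1| < r ->
    `|P (x, p.2) - P p| <= C * (`|F1 (x, p.2) - F1 p| + `|F2 (x, p.2) - F2 p|).

(** The radius in the local bound [lipP] depends on the point. Real induction
    along the chord adds up the local bounds, as the mass of the weak derivative
    is additive there. *)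
Lemma chord_estimate : exists2 N : R, 0 <= N &
  {ae mu, forall y : R, forall a b : R, a < b -> disk2 (a, y) -> disk2 (b, y) ->
    (`|P (b, y) - P (a, y)|%:E <= N%:E * (slice g1 a b y + slice g2 a b y))%E}.
Proof.
have [M M0 acl] := acl_estimate R; exists (C * M); first by rewrite mulr_ge0// ltW.
have mg1 : measurable_fun (@disk2 R : set plane) (g1 : plane -> R).
  by apply/measurable_EFinP; exact: measurable_int ig1.
have mg2 : measurable_fun (@disk2 R : set plane) (g2 : plane -> R).
  by apply/measurable_EFinP; exact: measurable_int ig2.
apply: (@filterS2 _ _ (ae_filter_ringOfSetsType mu) _ _ _ _
  (acl F1 g1 iF1 ig1 wd1 cF1) (acl F2 g2 iF2 ig2 wd2 cF2)).
move=> y H1 H2 a b ab ya yb.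
have D x : a <= x -> x <= b -> disk2 (x, y) by exact: disk2_segment.
have CM0 : (0%:E <= (C * M)%:E)%E by rewrite lee_fin mulr_ge0// ltW.
have s0 u v : (0 <= slice g1 u v y + slice g2 u v y)%E by rewrite adde_ge0// slice_ge0.
have step u v : a <= u -> u <= v -> v <= b ->
    `|P (v, y) - P (u, y)| <= C * (`|F1 (v, y) - F1 (u, y)| + `|F2 (v, y) - F2 (u, y)|) ->
    (`|P (v, y) - P (u, y)|%:E <= (C * M)%:E * (slice g1 u v y + slice g2 u v y))%E.
  move=> au uv vb H.
  have [->|uv'] := eqVneq u v; first by rewrite subrr normr0 mule_ge0.
  have {uv'} uv' : u < v by rewrite lt_neqAle uv' uv.
  have du : disk2 (u, y) by apply: D => //; exact: le_trans vb.
  have dv : disk2 (v, y) by apply: D => //; exact: le_trans uv.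
  apply: (@le_trans _ _ (C%:E * (`|F1 (v, y) - F1 (u, y)|%:E + `|F2 (v, y) - F2 (u, y)|%:E))%E).
    by rewrite -EFinD -EFinM lee_fin.
  rewrite EFinM -muleA lee_wpmul2l ?lee_fin// ge0_muleDr ?slice_ge0//.
  by rewrite leeD ?H1 ?H2.
apply: (real_induction (C := fun u v =>
  (`|P (v, y) - P (u, y)|%:E <= (C * M)%:E * (slice g1 u v y + slice g2 u v y))%E)).
- exact: ltW.
- move=> u v w au uv vw wb Huv Hvw.
  rewrite -(slice_split (c := v))// -[slice g2 u w y](slice_split (c := v))//.
  rewrite addeACA ge0_muleDr//; apply: le_trans (leeD Huv Hvw).
  by rewrite -EFinD lee_fin [leRHS]addrC; apply: ler_distD.
- move=> t /andP[at_ tb]; have [r r0 Hr] := lipP (D t at_ tb).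
  exists r => // s /andP[as_ sb] /Hr /= {}Hr; split=> st.
    apply: step => //.
    by rewrite distrC [`|F1 _ - _|]distrC [`|F2 _ - _|]distrC.
  exact: step.
Qed.

Definition line_mass (g : R * R -> R) (y : R) : \bar R :=
  \int[mu]_x (`|(g \_ (@disk2 R)) (x, y)|)%:E.

Lemma line_mass_finite (g : R * R -> R) :
  mu2.-integrable (@disk2 R : set plane) (EFin \o g) ->
  measurable_fun setT (line_mass g) /\ (\int[mu]_y line_mass g y < +oo)%E.
Proof.
move=> ig; have mg : measurable_fun (@disk2 R : set plane) (g : plane -> R).
  by apply/measurable_EFinP; exact: measurable_int ig.
pose G (p : plane) : \bar R := (`|(g \_ (@disk2 R)) p|)%:E.
have mG : measurable_fun setT G.
  apply/measurable_EFinP; apply: measurableT_comp => //.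
  exact: (measurable_restrictT (g : plane -> R) (@measurable_disk2 R)).1.
have G0 p : (0 <= G p)%E by rewrite lee_fin.
split; first exact: (measurable_fun_fubini_tonelli_G (m1 := mu) _ mG G0).
have <- := fubini_tonelli2 (m1 := mu) (m2 := mu) _ mG G0.
have /integrableP [_] := ig; rewrite integral_mkcond; apply: le_lt_trans.
rewrite le_eqVlt; apply/orP; left; apply/eqP; apply: eq_integral => p _.
by rewrite /G !patchE; case: ifP => //= _; rewrite normr0.
Qed.

(** The mass of the weak derivative on the chord at height [y] would be at
    least of order [y ^- 2], which is not integrable near [0]. *)
Lemma no_steep_boundary (Q0 : R) :
  (forall y : R, 0 < y < 2^-1 -> `|P (0, y)| <= Q0) ->
  (forall y : R, 0 < y < 2^-1 -> exists b : R, [/\ 0 < b, disk2 (b, y) & y ^- 2 / 2 - 1 <= P (b, y)]) ->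
  False.
Proof.
move=> P0 Pb.
have [N N0 chord] := chord_estimate.
have [m1 f1] := line_mass_finite ig1; have [m2 f2] := line_mass_finite ig2.
have mg1 : measurable_fun (@disk2 R : set plane) (g1 : plane -> R).
  by apply/measurable_EFinP; exact: measurable_int ig1.
have mg2 : measurable_fun (@disk2 R : set plane) (g2 : plane -> R).
  by apply/measurable_EFinP; exact: measurable_int ig2.
have lm0 g y : (0 <= line_mass g y)%E by apply: integral_ge0 => x _; rewrite lee_fin.
have sl g a b y : measurable_fun (@disk2 R : set plane) (g : plane -> R) ->
    (slice g a b y <= line_mass g y)%E.
  move=> mg; apply: ge0_subset_integral => //; exact: measurable_section.
pose T y := (N%:E * (line_mass g1 y + line_mass g2 y))%E.
have mT : measurable_fun setT T by apply: measurable_funeM; exact: emeasurable_funD.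
have T0 y : (0 <= T y)%E by rewrite mule_ge0 ?lee_fin// adde_ge0.
have iT : (\int[mu]_y T y < +oo)%E.
  rewrite ge0_integralZl//; [|exact: emeasurable_funD|by move=> y _; rewrite adde_ge0].
  have -> : (\int[mu]_y (line_mass g1 y + line_mass g2 y) =
      \int[mu]_y line_mass g1 y + \int[mu]_y line_mass g2 y)%E.
    by apply: ge0_integralD => // y _; exact: lm0.
  apply: lte_mul_pinfty; [by rewrite lee_fin|by []|exact: lte_add_pinfty].
have HT : {ae mu, forall y : R, 0 < y < 2^-1 -> ((y ^- 2 / 2 - 1 - Q0)%:E <= T y)%E}.
  apply: (@filterS _ _ (ae_filter_ringOfSetsType mu) _ _ _ chord) => y Hy y0.
  have [b [b0 db Pby]] := Pb y y0.
  have d0 : disk2 (0, y).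
    move: db; rewrite /disk2 /= expr0n add0r; apply: le_lt_trans.
    by rewrite lerDr sqr_ge0.
  apply: (@le_trans _ _ (`|P (b, y) - P (0, y)|%:E)).
    rewrite lee_fin; have := P0 y y0; have := ler_norm (P (b, y) - P (0, y)).
    have := ler_norm (P (0, y)); lra.
  apply: (le_trans (Hy 0 b b0 d0 db)); rewrite lee_wpmul2l ?lee_fin//.
  by rewrite leeD// sl.
pose I := fine (\int[mu]_y T y)%E.
have IE : (\int[mu]_y T y)%E = I%:E.
  by rewrite fineK// ge0_fin_numE//; apply: integral_ge0.
have I0 : 0 <= I by rewrite fine_ge0// integral_ge0.
have Q00 : 0 <= Q0.
  have := P0 4^-1; have -> : 0 < (4^-1 : R) < 2^-1 by apply/andP; split; lra.
  by move=> /(_ isT); apply: le_trans.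
(* Integration over the heights between [c] and [2 * c]: the length [c] of the
   interval is beaten by the bound [c ^- 2]. *)
have key (c : R) : 0 < c -> c < 4^-1 -> c * (c ^- 2 / 8 - 1 - Q0) <= I.
  move=> c0 c4; rewrite -lee_fin -IE.
  apply: (@le_trans _ _ (\int[mu]_(y in `]c, (2 * c)%R[) T y)%E); last first.
    apply: ge0_subset_integral => //.
  have [neg|pos] := leP (c ^- 2 / 8 - 1 - Q0) 0.
    apply: (@le_trans _ _ 0%E); first by rewrite lee_fin mulr_ge0_le0// ltW.
    exact: integral_ge0.
  apply: (@le_trans _ _ (\int[mu]_(y in `]c, (2 * c)%R[) (c ^- 2 / 8 - 1 - Q0)%:E)%E).
    rewrite integral_cst//= lebesgue_measure_itv /= lte_fin.
    have -> : c < 2 * c by lra.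
    by rewrite -EFinD -EFinM lee_fin mulrC le_eqVlt; apply/orP; left; apply/eqP; ring.
  apply: ae_ge0_le_integral => //.
  - by move=> y _; rewrite lee_fin ltW.
  - exact: measurable_funTS.
  apply: (@filterS _ _ (ae_filter_ringOfSetsType mu) _ _ _ HT) => y Hy.
  rewrite /= in_itv /= => /andP[cy yc]; apply: le_trans (Hy _); last first.
    by move: c0 c4 cy yc => *; apply/andP; split; lra.
  rewrite lee_fin !lerD2r.
  have y0 : 0 < y by exact: lt_trans cy.
  have -> : c ^- 2 / 8 = (2 * c) ^- 2 / 2 by field; rewrite gt_eqF.
  rewrite ler_pM2r// lef_pV2 ?posrE ?exprn_gt0 ?mulr_gt0//.
  by rewrite ler_sqr ?nnegrE ?mulr_ge0 ?ltW.
pose c := (8 * (I + Q0 + 5))^-1.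
have s0 : 0 < 8 * (I + Q0 + 5) by nra.
have c0 : 0 < c by rewrite invr_gt0.
have c4 : c < 4^-1 by rewrite ltf_pV2 ?posrE//; nra.
have := key c c0 c4.
have -> : c * (c ^- 2 / 8 - 1 - Q0) = c^-1 / 8 - c * (1 + Q0).
  by field; rewrite gt_eqF.
have -> : c^-1 / 8 = I + Q0 + 5 by rewrite /c invrK; field.
nra.
Qed.

End Chords.

Local Open Scope complex_scope.

(** * Modulus and topology of the complex plane *)

Import ComplexField.

Section Modulus.
Variable R : realType.
Implicit Types z w : R[i].

(** The norm of [R[i]] takes its values in [R[i]]; real values suit estimates
    better. *)
Definition cabs z : R := Num.sqrt (complex.Re z ^+ 2 + complex.Im z ^+ 2).

Lemma normcE z : `|z| = (cabs z)%:C.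
Proof. exact: normc_def. Qed.

Lemma cabs_ge0 z : 0 <= cabs z. Proof. exact: sqrtr_ge0. Qed.

Lemma cabs0 : cabs 0 = 0.
Proof. by apply: complexI; rewrite -normcE normr0. Qed.

Lemma cabs1 : cabs 1 = 1.
Proof. by apply: complexI; rewrite -normcE normr1. Qed.

Lemma cabs_eq0 z : (cabs z == 0) = (z == 0).
Proof. by rewrite -(inj_eq (@complexI R)) -normcE normr_eq0. Qed.

Lemma cabs_gt0 z : (0 < cabs z) = (z != 0).
Proof. by rewrite lt_def cabs_eq0 cabs_ge0 andbT. Qed.

Lemma cabsM z w : cabs (z * w) = cabs z * cabs w.
Proof. by apply: complexI; rewrite -normcE normrM !normcE -rmorphM. Qed.

Lemma cabsV z : cabs z^-1 = (cabs z)^-1.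
Proof. by apply: complexI; rewrite -normcE normfV normcE fmorphV. Qed.

Lemma cabsN z : cabs (- z) = cabs z.
Proof. by apply: complexI; rewrite -!normcE normrN. Qed.

Lemma cabs_distC z w : cabs (z - w) = cabs (w - z).
Proof. by rewrite -cabsN opprB. Qed.

Lemma cabsD z w : cabs (z + w) <= cabs z + cabs w.
Proof. by rewrite -lecR rmorphD /= -!normcE ler_normD. Qed.

Lemma cabsB z w : cabs (z - w) <= cabs z + cabs w.
Proof. by rewrite -(cabsN w) cabsD. Qed.

Lemma cabs_dist_triangle w z z' : cabs (z - z') <= cabs (z - w) + cabs (w - z').
Proof. by rewrite (_ : z - z' = (z - w) + (w - z')) ?cabsD// addrA subrK. Qed.

Lemma cabs_sub_le z w : cabs z - cabs w <= cabs (z - w).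
Proof. by rewrite lerBlDr -{1}(subrK w z) cabsD. Qed.

Lemma cabs_real (x : R) : cabs x%:C = `|x|.
Proof. by rewrite /cabs /= expr0n addr0 sqrtr_sqr. Qed.

Lemma cabs_i : cabs 'i = 1.
Proof. by rewrite /cabs /= expr0n expr1n add0r sqrtr1. Qed.

Lemma Re_le_cabs z : `|complex.Re z| <= cabs z.
Proof. by rewrite -sqrtr_sqr ler_wsqrtr// lerDl sqr_ge0. Qed.

Lemma Im_le_cabs z : `|complex.Im z| <= cabs z.
Proof. by rewrite -sqrtr_sqr ler_wsqrtr// lerDr sqr_ge0. Qed.

Lemma cabs_sqr z : cabs z ^+ 2 = complex.Re z ^+ 2 + complex.Im z ^+ 2.
Proof. by rewrite sqr_sqrtr// addr_ge0// sqr_ge0. Qed.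

Lemma cabs_le_ReIm z : cabs z <= `|complex.Re z| + `|complex.Im z|.
Proof.
rewrite -(@ler_pXn2r _ 2) ?nnegrE ?cabs_ge0 ?addr_ge0// cabs_sqr sqrrD.
by rewrite !real_normK ?num_real// lerD2r lerDl mulrn_wge0// mulr_ge0.
Qed.

Lemma Re_add z w : complex.Re (z + w) = complex.Re z + complex.Re w.
Proof. by case: z; case: w. Qed.
Lemma Im_add z w : complex.Im (z + w) = complex.Im z + complex.Im w.
Proof. by case: z; case: w. Qed.
Lemma Re_opp z : complex.Re (- z) = - complex.Re z. Proof. by case: z. Qed.
Lemma Im_opp z : complex.Im (- z) = - complex.Im z. Proof. by case: z. Qed.
Lemma Re_mul z w : complex.Re (z * w) =
  complex.Re z * complex.Re w - complex.Im z * complex.Im w.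
Proof. by case: z; case: w. Qed.
Lemma Im_mul z w : complex.Im (z * w) =
  complex.Re z * complex.Im w + complex.Im z * complex.Re w.
Proof. by case: z; case: w. Qed.
Lemma Re_inv z : complex.Re z^-1 = complex.Re z / cabs z ^+ 2.
Proof. by rewrite cabs_sqr; case: z. Qed.
Lemma Im_inv z : complex.Im z^-1 = - complex.Im z / cabs z ^+ 2.
Proof. by rewrite cabs_sqr mulNr; case: z. Qed.

Lemma complex_eq z w : complex.Re z = complex.Re w -> complex.Im z = complex.Im w -> z = w.
Proof. by case: z; case: w => ? ? ? ? /= -> ->. Qed.

End Modulus.

Section PlaneTopology.
Variable R : realType.
Local Notation C := (Cplx R).
Implicit Types (z w : C) (A : set C).

Lemma cplx_nbhsP z A :
  nbhs z A <-> exists2 r : R, 0 < r & forall w, cabs (w - z) < r -> A w.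
Proof.
split=> [/nbhs_ballP [e /= e0 He]|[r r0 Hr]].
  have eE : e = (complex.Re e)%:C by case: e e0 {He} => a b; rewrite ltcE /= => /andP[/eqP -> _].
  exists (complex.Re e); first by move: e0; rewrite {1}eE ltcR.
  by move=> w wz; apply: He; rewrite /ball /= distrC normcE eE ltcR.
apply/nbhs_ballP; exists r%:C => /=; first by rewrite ltcR.
by move=> w; rewrite /ball /= distrC normcE ltcR; exact: Hr.
Qed.

Lemma cplx_continuousP (f : C -> C) z : {for z, continuous f} <->
  forall e : R, 0 < e -> exists2 r : R, 0 < r &
    forall w, cabs (w - z) < r -> cabs (f w - f z) < e.
Proof.
split=> [cf e e0|H].
  apply/(cplx_nbhsP z (fun w => cabs (f w - f z) < e)); apply: (cf (fun w => cabs (w - f z) < e)).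
  by apply/cplx_nbhsP; exists e.
move=> A /cplx_nbhsP [e e0 HA]; have [r r0 Hr] := H e e0.
by apply/cplx_nbhsP; exists r => // w /Hr /HA.
Qed.

Lemma continuous_Re : continuous (@complex.Re R : C -> R).
Proof.
move=> z A /nbhs_ballP [e /= e0 He]; apply/cplx_nbhsP; exists e => // w wz.
apply: He; rewrite /ball /= distrC; apply: le_lt_trans wz.
by rewrite -Re_opp -Re_add; exact: Re_le_cabs.
Qed.

Lemma continuous_Im : continuous (@complex.Im R : C -> R).
Proof.
move=> z A /nbhs_ballP [e /= e0 He]; apply/cplx_nbhsP; exists e => // w wz.
apply: He; rewrite /ball /= distrC; apply: le_lt_trans wz.
by rewrite -Im_opp -Im_add; exact: Im_le_cabs.
Qed.

Lemma continuous_toC : continuous (@toC R).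
Proof.
move=> [x y] A /cplx_nbhsP [e e0 HA]; apply/nbhs_ballP.
exists (e / 2) => /=; first by rewrite divr_gt0.
move=> [x' y'] [/= xx yy]; apply: HA.
apply: le_lt_trans (cabs_le_ReIm _) _; rewrite /toC /= -/(x' - x) -/(y' - y).
move: xx yy; rewrite /ball /= [`|x - _|]distrC [`|y - _|]distrC => xx yy.
by rewrite (splitr e) ltrD.
Qed.

Lemma continuous_cabs : continuous (@cabs R : C -> R).
Proof.
move=> z A /nbhs_ballP [e /= e0 He]; apply/cplx_nbhsP; exists e => // w wz.
apply: He; rewrite /ball /=; apply: le_lt_trans wz; rewrite ler_norml.
by rewrite lerNl opprB cabs_sub_le /= cabs_distC cabs_sub_le.
Qed.

Lemma cplx_withinP A (f : C -> C) : {within A, continuous f} <->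
  forall z, A z -> forall e : R, 0 < e -> exists2 r : R, 0 < r &
    forall w, A w -> cabs (w - z) < r -> cabs (f w - f z) < e.
Proof.
split=> [/subspace_continuousP cf z Az e e0|H].
  have : nbhs (f z) [set w | cabs (w - f z) < e] by apply/cplx_nbhsP; exists e.
  move=> /(cf z Az) /cplx_nbhsP [r r0 Hr]; exists r => // w Aw wz; exact: Hr.
apply/subspace_continuousP => z Az B /cplx_nbhsP [e e0 HB].
have [r r0 Hr] := H z Az e e0; apply/cplx_nbhsP; exists r => // w wz Aw.
exact/HB/Hr.
Qed.

(** Compactness makes the inverse continuous: points with close images cannot
    stay apart. *)
Lemma compact_homeomorphism A (f : C -> C) : compact A ->
  {within A, continuous f} -> {in A &, injective f} ->
  homeomorphism_on A (f @` A) f.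
Proof.
move=> cA cf injf; split => //.
  by split; [move=> x Ax; exists x|exact: injf|].
pose g w : C := if pselect (exists2 x, A x & f x = w) is left h then projT1 (cid2 h) else 0.
have gf x : A x -> g (f x) = x.
  move=> Ax; rewrite /g; case: pselect => [h|[]]; last by exists x.
  by case: (cid2 h) => x' Ax' /=; apply: injf; exact/mem_set.
exists g; split; last by move=> x /set_mem; exact: gf.
apply/cplx_withinP => _ [z Az <-] e e0; rewrite gf//; apply: contrapT => H.
have {}H (r : R) : 0 < r -> exists w, [/\ A w, cabs (f w - f z) < r & e <= cabs (w - z)].
  move=> r0; apply: contrapT => K; apply: H; exists r => // _ [w Aw <-] wr.
  rewrite gf// ltNge; apply/negP => ew; apply: K; by exists w.
(* A sequence that stays away from [z] while its images tend to [f z] has a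
   cluster point with image [f z], which is not [z]. *)
have [w_ Hw] := choice (fun n : nat => H n.+1%:R^-1 ltac:(by rewrite invr_gt0)).
have [|l [Al cl]] := cA (w_ n @[n --> \oo]) _ _.
  by exists 0%N => // n _; case: (Hw n).
have fl : f l = f z.
  apply/eqP; rewrite -subr_eq0 -cabs_eq0 eq_le cabs_ge0 andbT.
  apply/ler_addgt0Pr => d d0; rewrite add0r.
  have d20 : 0 < d / 2 by rewrite divr_gt0.
  have [r r0 Hr] := (cplx_withinP A f).1 cf l Al _ d20.
  have N1 : \forall n \near \oo, cabs (f (w_ n) - f z) < d / 2.
    near=> n; have [_ + _] := Hw n; move=> /lt_trans; apply.
    by near: n; exact: (near_infty_natSinv_lt (PosNum d20)).
  have N2 : nbhs l [set w | cabs (w - l) < r] by apply/cplx_nbhsP; exists r.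
  have N3 : \forall n \near \oo, A (w_ n) /\ cabs (f (w_ n) - f z) < d / 2.
    by apply: filterS N1 => n fn; split => //; case: (Hw n).
  have [w [[Aw fw] lw]] := cl [set w | A w /\ cabs (f w - f z) < d / 2] _ N3 N2.
  rewrite (splitr d) (le_trans (cabs_dist_triangle (f w) _ _))// ltW// ltrD//.
  by rewrite cabs_distC; exact: Hr.
have lz : l = z by apply: injf; rewrite ?inE.
have N2 : nbhs l [set w | cabs (w - l) < e] by apply/cplx_nbhsP; exists e.
have [w [/= ew]] := cl [set w | e <= cabs (w - z)] _
  ltac:(by exists 0%N => // n _; case: (Hw n)) N2.
by rewrite lz ltNge ew.
Unshelve. all: by end_near. Qed.

End PlaneTopology.

(** * Complex derivatives *)

Section ComplexDerivative.
Variable R : realType.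
Implicit Types (z w d : R[i]) (f g : R[i] -> R[i]).

(** Complex differentiability with real moduli, which suits estimates on segments
    better than the filters of the normed module structure. *)
Definition cderiv f z d := forall e : R, 0 < e -> exists2 r : R, 0 < r &
  forall h, cabs h < r -> cabs (f (z + h) - f z - d * h) <= e * cabs h.

Lemma cderiv_derivable (f : Cplx R -> Cplx R) (z : Cplx R) (d : R[i]) :
  cderiv f z d -> derivable f z 1.
Proof.
move=> H; suff [] : is_derive (z : (R[i])^o) (1 : (R[i])^o) f d by [].
apply: is_derive_epsdelta => e e0.
have eE : e = (complex.Re e)%:C.
  by case: e e0 => a b; rewrite ltcE /= => /andP[/eqP -> _].
have re0 : 0 < complex.Re e by move: e0; rewrite {1}eE ltcR.
have [r r0 Hr] := H _ re0; exists r%:C; first by rewrite ltcR.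
move=> h; rewrite normcE ltcR => /Hr; rewrite -lecR rmorphM /= -!normcE -eE.
by rewrite normcE.
Qed.

Lemma cderiv_local f z d : cderiv f z d ->
  exists2 r : R, 0 < r & forall h, cabs h < r ->
    cabs (f (z + h) - f z) <= (cabs d + 1) * cabs h.
Proof.
move=> /(_ 1 ltr01) [r r0 Hr]; exists r => // h /Hr H.
rewrite -[X in cabs X](subrK (d * h)).
by apply: (le_trans (cabsD _ _)); rewrite cabsM mulrDl addrC lerD2l.
Qed.

Lemma cderiv_continuous f z d : cderiv f z d ->
  forall e : R, 0 < e -> exists2 r : R, 0 < r &
    forall h, cabs h < r -> cabs (f (z + h) - f z) < e.
Proof.
move=> /cderiv_local [r r0 Hr] e e0.
have d1 : 0 < cabs d + 1 by rewrite ltr_wpDl ?cabs_ge0.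
exists (Num.min r (e / (cabs d + 1))); first by rewrite lt_min r0 divr_gt0.
move=> h; rewrite lt_min => /andP[/Hr /le_lt_trans H].
by rewrite ltr_pdivlMr// mulrC => /H.
Qed.

Lemma cderiv_continuous_at (f : Cplx R -> Cplx R) (z : Cplx R) (d : R[i]) :
  cderiv f z d -> {for z, continuous f}.
Proof.
move=> /cderiv_continuous H; apply/cplx_continuousP => e /H [r r0 Hr].
exists r => // w wz; have := Hr (w - z) wz.
by rewrite (_ : z + (w - z) = w)// addrC subrK.
Qed.

Lemma cderiv_near f g z d (r : R) : 0 < r ->
  (forall h, cabs h < r -> f (z + h) = g (z + h)) -> cderiv f z d -> cderiv g z d.
Proof.
move=> r0 fg H e e0; have [r' r'0 Hr'] := H e e0.
exists (Num.min r r'); first by rewrite lt_min r0.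
move=> h; rewrite lt_min => /andP[hr hr'].
have := fg 0; rewrite cabs0 addr0 => /(_ r0) <-; rewrite -fg//; exact: Hr'.
Qed.

Lemma cderiv_id z : cderiv id z 1.
Proof.
move=> e e0; exists 1 => // h _; rewrite /= (_ : z + h - z - 1 * h = 0) ?cabs0; last by ring.
by rewrite mulr_ge0 ?cabs_ge0 ?ltW.
Qed.

Lemma cderiv_cst c z : cderiv (fun=> c) z 0.
Proof.
move=> e e0; exists 1 => // h _; rewrite mul0r subrr subrr cabs0.
by rewrite mulr_ge0 ?cabs_ge0 ?ltW.
Qed.

Lemma cderivD f g z d d' : cderiv f z d -> cderiv g z d' ->
  cderiv (fun w => f w + g w) z (d + d').
Proof.
move=> Hf Hg e e0; have e20 : 0 < e / 2 by rewrite divr_gt0.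
have [r r0 Hr] := Hf _ e20; have [s s0 Hs] := Hg _ e20.
exists (Num.min r s); first by rewrite lt_min r0.
move=> h; rewrite lt_min => /andP[/Hr H1 /Hs H2].
have -> : f (z + h) + g (z + h) - (f z + g z) - (d + d') * h =
  (f (z + h) - f z - d * h) + (g (z + h) - g z - d' * h) by ring.
by rewrite (le_trans (cabsD _ _))// (splitr e) mulrDl lerD.
Qed.

Lemma cderivZ f z d c : cderiv f z d -> cderiv (fun w => c * f w) z (c * d).
Proof.
move=> Hf e e0; have c1 : 0 < cabs c + 1 by rewrite ltr_wpDl ?cabs_ge0.
have [r r0 Hr] := Hf _ (divr_gt0 e0 c1); exists r => // h /Hr H.
have -> : c * f (z + h) - c * f z - c * d * h = c * (f (z + h) - f z - d * h) by ring.
rewrite cabsM; apply: (le_trans (ler_wpM2l (cabs_ge0 c) H)).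
rewrite mulrA ler_wpM2r ?cabs_ge0// mulrCA ler_piMr ?ltW// ltr_pdivrMr// mul1r.
by rewrite ltrDl.
Qed.

Lemma cderivB f g z d d' : cderiv f z d -> cderiv g z d' ->
  cderiv (fun w => f w - g w) z (d - d').
Proof.
move=> Hf Hg; have := cderivD Hf (cderivZ (-1) Hg).
rewrite mulN1r; apply: (cderiv_near ltr01) => h _; by rewrite mulN1r.
Qed.

Lemma cderiv_comp f g z d d' : cderiv f z d -> cderiv g (f z) d' ->
  cderiv (fun w => g (f w)) z (d' * d).
Proof.
move=> Hf Hg e e0.
have d1 : 0 < cabs d + 1 by rewrite ltr_wpDl ?cabs_ge0.
have d1' : 0 < cabs d' + 1 by rewrite ltr_wpDl ?cabs_ge0.
have e1 : 0 < e / 2 / (cabs d + 1) by rewrite !divr_gt0.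
have e2 : 0 < e / 2 / (cabs d' + 1) by rewrite !divr_gt0.
have [r1 r10 H1] := Hg _ e1; have [r2 r20 H2] := Hf _ e2.
have [r3 r30 H3] := cderiv_local Hf; have [r4 r40 H4] := cderiv_continuous Hf r10.
exists (Num.min (Num.min r2 r3) r4); first by rewrite !lt_min r20 r30.
move=> h; rewrite !lt_min => /andP[/andP[/H2 {}H2 /H3 {}H3] /H4 {}H4].
have := H1 _ H4; rewrite (_ : f z + (f (z + h) - f z) = f (z + h)); last by rewrite addrC subrK.
move=> {}H1.
have -> : g (f (z + h)) - g (f z) - d' * d * h =
  (g (f (z + h)) - g (f z) - d' * (f (z + h) - f z)) + d' * (f (z + h) - f z - d * h) by ring.
apply: (le_trans (cabsD _ _)); rewrite (splitr e) mulrDl; apply: lerD.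
  apply: (le_trans H1); rewrite -mulrA ler_wpM2l ?divr_ge0 ?(ltW e0)//.
  by rewrite ler_pdivrMl.
rewrite cabsM; apply: (le_trans (ler_wpM2l (cabs_ge0 _) H2)).
rewrite mulrA ler_wpM2r ?cabs_ge0// mulrCA ler_piMr ?divr_ge0 ?ltW// ltr_pdivrMr// mul1r.
by rewrite ltrDl.
Qed.

Lemma cderiv_inv z : z != 0 -> cderiv (fun w => w^-1) z (- z^-1 ^+ 2).
Proof.
move=> z0 e e0; have az : 0 < cabs z by rewrite cabs_gt0.
pose r := Num.min (cabs z / 2) (e * cabs z ^+ 3 / 2).
exists r; first by rewrite lt_min !divr_gt0// mulr_gt0// exprn_gt0.
move=> h; rewrite lt_min => /andP[h1 h2].
have zh : cabs z / 2 <= cabs (z + h).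
  by have := cabs_sub_le z (- h); rewrite cabsN opprK; lra.
have zh0 : z + h != 0 by rewrite -cabs_gt0; apply: lt_le_trans zh; rewrite divr_gt0.
have -> : (z + h)^-1 - z^-1 - - z^-1 ^+ 2 * h = h * h * (z^-1 ^+ 2) * (z + h)^-1.
  by field; rewrite z0 zh0.
rewrite !cabsM !cabsV -!mulrA [_ * cabs h]mulrC ler_wpM2l ?cabs_ge0//.
have -> : cabs h * ((cabs z)^-1 * ((cabs z)^-1 / cabs (z + h))) =
    cabs h / (cabs z ^+ 2 * cabs (z + h)).
  by field; rewrite !gt_eqF// cabs_gt0.
rewrite ler_pdivrMr ?mulr_gt0 ?exprn_gt0 ?cabs_gt0//.
apply: (le_trans (ltW h2)).
have -> : e * cabs z ^+ 3 / 2 = e * (cabs z ^+ 2 * (cabs z / 2)) by ring.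
by rewrite ler_pM2l// ler_pM2l// exprn_gt0.
Qed.

(** Real induction on the segment, as a complex function need not attain its mean
    slope. *)
Lemma cderiv_mean_value f (a b : R[i]) (M : R) : 0 <= M ->
  (forall t : R, 0 <= t <= 1 ->
    exists2 d, cderiv f (a + t%:C * (b - a)) d & cabs d <= M) ->
  cabs (f b - f a) <= M * cabs (b - a).
Proof.
move=> M0 H.
have [->|ba] := eqVneq b a; first by rewrite !subrr cabs0 mulr0.
have l0 : 0 < cabs (b - a) by rewrite cabs_gt0 subr_eq0.
apply/ler_addgt0Pr => e e0.
pose N := M * cabs (b - a) + e.
pose y (t : R) := f (a + t%:C * (b - a)).
(* The bound is additive along the segment, and it holds locally with the
   constant [M] increased by [e] over the length of the segment. *)
have := @real_induction R (fun s t => cabs (y t - y s) <= N * (t - s)) 0 1 ler01.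
rewrite /y subr0 mulr1 rmorph1 rmorph0 mul1r mul0r addr0 [a + _]addrC subrK.
apply.
  move=> s t u _ _ _ _ H1 H2.
  rewrite (le_trans (cabs_dist_triangle (f (a + t%:C * (b - a))) _ _))//.
  have -> : N * (u - s) = N * (u - t) + N * (t - s) by ring.
  exact: lerD H2 H1.
move=> t t01; have [d Hd dM] := H t t01.
have e'0 : 0 < e / cabs (b - a) by rewrite divr_gt0.
have [r r0 Hr] := Hd _ e'0.
exists (r / cabs (b - a)); first by rewrite divr_gt0.
move=> s _; rewrite ltr_pdivlMr// => sr.
have key : cabs (f (a + s%:C * (b - a)) - f (a + t%:C * (b - a))) <= N * `|s - t|.
  have hE : cabs ((s - t)%:C * (b - a)) = `|s - t| * cabs (b - a) by rewrite cabsM cabs_real.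
  have := Hr ((s - t)%:C * (b - a)); rewrite hE => /(_ sr).
  have -> : a + t%:C * (b - a) + (s - t)%:C * (b - a) = a + s%:C * (b - a).
    by rewrite -addrA -mulrDl -rmorphD /= (_ : t + (s - t) = s)//; ring.
  set A := f _ - f _; move=> HA; rewrite -(subrK (d * ((s - t)%:C * (b - a))) A).
  apply: (le_trans (cabsD _ _)); rewrite cabsM hE /N.
  have h1 : cabs d * (`|s - t| * cabs (b - a)) <= M * (`|s - t| * cabs (b - a)).
    by rewrite ler_wpM2r// mulr_ge0 ?cabs_ge0.
  have h2 : e / cabs (b - a) * (`|s - t| * cabs (b - a)) = e * `|s - t|.
    by field; rewrite gt_eqF.
  by rewrite h2 in HA; lra.
split=> st.
  by move: key; rewrite cabs_distC ler0_norm ?subr_le0// opprB.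
by move: key; rewrite ger0_norm ?subr_ge0.
Qed.

End ComplexDerivative.

(** * Exponential and logarithm *)

Section ExpLog.
Variable R : realType.
Implicit Types (z w : R[i]).

Lemma is_derive_remainder (f : R -> R) (x d : R) : is_derive x (1:R) f d ->
  forall e : R, 0 < e -> exists2 r : R, 0 < r &
    forall h, `|h| < r -> `|f (x + h) - f x - d * h| <= e * `|h|.
Proof.
move=> [df dE] e e0; move: df => /cvg_ex [l Hl].
have lE : l = d by rewrite -dE; apply/esym/cvg_lim.
move: Hl; rewrite lE => /cvgrPdist_le /(_ e e0); rewrite near_withinE => /nbhs_ballP [r /= r0 Hr].
exists r => // h hr.
have [->|h0] := eqVneq h 0; first by rewrite addr0 subrr mulr0 subrr normr0 mulr0.
have := Hr h; rewrite /ball /= sub0r normrN => /(_ hr h0).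
rewrite /GRing.scale /= mulr1 [h + x]addrC => H.
have -> : f (x + h) - f x - d * h = - h * (d - h^-1 * (f (x + h) - f x)) by field.
by rewrite normrM normrN mulrC ler_wpM2r.
Qed.

Definition cexp z : R[i] :=
  (expR (complex.Re z) * cos (complex.Im z)) +i* (expR (complex.Re z) * sin (complex.Im z)).

Lemma cexp0 : cexp 0 = 1.
Proof. by rewrite /cexp /= expR0 cos0 sin0 mulr1 mulr0. Qed.

Lemma cexpD z w : cexp (z + w) = cexp z * cexp w.
Proof.
apply: complex_eq; rewrite ?Re_mul ?Im_mul /cexp /= Re_add Im_add expRD ?cosD ?sinD; ring.
Qed.

Lemma cabs_cexp z : cabs (cexp z) = expR (complex.Re z).
Proof.
rewrite /cabs /= !exprMn -mulrDr cos2Dsin2 mulr1 sqrtr_sqr ger0_norm//.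
Qed.

Lemma cexp_neq0 z : cexp z != 0.
Proof. by rewrite -cabs_gt0 cabs_cexp expR_gt0. Qed.

Lemma cexpN z : cexp (- z) = (cexp z)^-1.
Proof.
apply: (mulfI (cexp_neq0 z)); rewrite -cexpD subrr cexp0 divff//.
exact: cexp_neq0.
Qed.

Let cderiv_cexp0 : cderiv cexp 0 1.
Proof.
move=> e e0.
have [d [d0 dle1 dle]] : exists d : R, [/\ 0 < d, d <= 1 & d <= e / 12].
  exists (Num.min 1 (e / 12)); split; first by rewrite lt_min ltr01 divr_gt0.
    by rewrite ge_min lexx.
  by rewrite ge_min lexx orbT.
have [r1 r10 H1] := is_derive_remainder (is_derive_expR 0) d0.
have [r2 r20 H2] := is_derive_remainder (is_derive_cos 0) d0.
have [r3 r30 H3] := is_derive_remainder (is_derive_sin 0) d0.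
exists (Num.min d (Num.min r1 (Num.min r2 r3))); first by rewrite !lt_min d0 r10 r20.
move=> h; rewrite !lt_min => /andP[hd /andP[h1 /andP[h2 h3]]].
rewrite add0r cexp0 mul1r.
set x := complex.Re h; set y := complex.Im h.
have xh : `|x| <= cabs h := Re_le_cabs h.
have yh : `|y| <= cabs h := Im_le_cabs h.
have E1 : `|expR x - 1 - x| <= d * cabs h.
  have := H1 x (le_lt_trans xh h1); rewrite add0r expR0 mul1r => /le_trans; apply.
  by rewrite ler_wpM2l ?(ltW d0).
have E2 : `|cos y - 1| <= d * cabs h.
  have := H2 y (le_lt_trans yh h2); rewrite add0r cos0 sin0 oppr0 mul0r subr0.
  by move=> /le_trans; apply; rewrite ler_wpM2l ?(ltW d0).
have E3 : `|sin y - y| <= d * cabs h.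
  have := H3 y (le_lt_trans yh h3); rewrite add0r cos0 sin0 mul1r subr0.
  by move=> /le_trans; apply; rewrite ler_wpM2l ?(ltW d0).
have h0 := cabs_ge0 h.
have E4 : `|expR x - 1| <= 2 * cabs h.
  rewrite -(subrK x (expR x - 1)); apply: (le_trans (ler_normD _ _)); nra.
have E5 : `|expR x| <= 3.
  rewrite -(subrK 1 (expR x)); apply: (le_trans (ler_normD _ _)).
  by rewrite normr1; nra.
apply: (le_trans (cabs_le_ReIm _)).
rewrite !Re_add !Im_add !Re_opp !Im_opp /= -/x -/y subr0.
have -> : expR x * cos y - 1 - x = (expR x - 1 - x) + expR x * (cos y - 1) by ring.
have -> : expR x * sin y - y = expR x * (sin y - y) + (expR x - 1) * y by ring.
have F1 : `|expR x - 1 - x + expR x * (cos y - 1)| <= d * cabs h + 3 * (d * cabs h).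
  by apply: (le_trans (ler_normD _ _)); rewrite lerD// normrM ler_pM.
have F2 : `|expR x * (sin y - y) + (expR x - 1) * y| <= 3 * (d * cabs h) + 2 * cabs h * d.
  apply: (le_trans (ler_normD _ _)); rewrite lerD// normrM ler_pM//.
  by rewrite (le_trans yh)// ltW.
apply: (le_trans (lerD F1 F2)).
have -> : d * cabs h + 3 * (d * cabs h) + (3 * (d * cabs h) + 2 * cabs h * d) =
  9 * d * cabs h by ring.
by rewrite ler_wpM2r//; lra.
Qed.

Lemma cderiv_cexp z : cderiv cexp z (cexp z).
Proof.
have := cderivZ (cexp z) cderiv_cexp0; rewrite mulr1 => H e e0.
have [r r0 Hr] := H e e0; exists r => // h /Hr.
by rewrite add0r cexp0 cexpD mulr1.
Qed.

(** The principal logarithm on the right half plane *)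
Definition Log z : R[i] :=
  (ln (cabs z)) +i* (atan (complex.Im z / complex.Re z)).

Lemma Re_gt0_cabs z : 0 < complex.Re z -> 0 < cabs z.
Proof. by move=> z0; apply: lt_le_trans (Re_le_cabs z); rewrite gtr0_norm. Qed.

Lemma Re_gt0_neq0 z : 0 < complex.Re z -> z != 0.
Proof. by move=> /Re_gt0_cabs; rewrite cabs_gt0. Qed.

Lemma cexp_Log z : 0 < complex.Re z -> cexp (Log z) = z.
Proof.
move=> z0; have az := Re_gt0_cabs z0.
rewrite /cexp /= lnK ?posrE//; set t := _ / _.
have E : Num.sqrt (1 + t ^+ 2) = cabs z / complex.Re z.
  have -> : 1 + t ^+ 2 = (cabs z / complex.Re z) ^+ 2.
    by rewrite [RHS]exprMn cabs_sqr /t; field; rewrite gt_eqF.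
  by rewrite sqrtr_sqr ger0_norm// divr_ge0 ?cabs_ge0 ?ltW.
have C : cos (atan t) = complex.Re z / cabs z by rewrite cos_atan E invf_div.
have cn0 : cos (atan t) != 0 by rewrite C mulf_neq0 ?invr_eq0 ?gt_eqF.
have S : sin (atan t) = complex.Im z / cabs z.
  have := atanK t; rewrite /tan => /(canRL (mulfVK cn0)); rewrite C => ->.
  by rewrite /t; field; rewrite !gt_eqF.
by rewrite C S; apply: complex_eq => /=; field; rewrite gt_eqF.
Qed.

Lemma Log_inj z w : 0 < complex.Re z -> 0 < complex.Re w -> Log z = Log w -> z = w.
Proof. by move=> z0 w0 E; rewrite -(cexp_Log z0) E cexp_Log. Qed.

Lemma Im_Log_lt z : `|complex.Im (Log z)| < pi / 2.
Proof. by rewrite ltr_norml /= atan_gtNpi2 atan_ltpi2. Qed.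

Let atan_le (t : R) : 0 <= t -> atan t <= t.
Proof.
move=> t0; have [->|t1] := eqVneq t 0; first by rewrite atan0.
have {t1 t0} t0 : 0 < t by rewrite lt_neqAle eq_sym t1.
have dE (s : R) : is_derive s (1:R) atan (1 + s ^+ 2)^-1 := is_derive1_atan s.
have [|c /= _ E] := MVT t0 (fun s _ => dE s).
  by apply: continuous_subspaceT => s; exact: continuous_atan.
move: E; rewrite atan0 !subr0 => ->; rewrite ler_piMl ?(ltW t0)// invf_le1 ?lerDl ?sqr_ge0//.
by rewrite ltr_pwDl// sqr_ge0.
Qed.

Lemma Im_Log_le z : 0 < complex.Re z ->
  `|complex.Im (Log z)| <= `|complex.Im z| / complex.Re z.
Proof.
move=> z0 /=; have [y0|y0] := leP 0 (complex.Im z).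
  have t0 : 0 <= complex.Im z / complex.Re z by rewrite divr_ge0// ltW.
  have := le_atan t0; rewrite atan0 => a0.
  by rewrite !ger0_norm ?atan_le.
rewrite -normrN -atanN -mulNr [X in _ <= X / _]ltr0_norm//.
have t0 : 0 <= - complex.Im z / complex.Re z by rewrite divr_ge0 ?oppr_ge0 ?ltW.
by have := le_atan t0; rewrite atan0 => a0; rewrite ger0_norm ?atan_le.
Qed.

Lemma Log_continuous z : 0 < complex.Re z -> {for z, continuous (Log : Cplx R -> Cplx R)}.
Proof.
move=> z0; have -> : (Log : Cplx R -> Cplx R) =
    (fun w => toC (ln (cabs w), atan (complex.Im w / complex.Re w))) by [].
have H1 : {for z, continuous ((fun w => ln (cabs w)) : Cplx R -> R)}.
  exact: (continuous_comp (@continuous_cabs R z) (continuous_ln (Re_gt0_cabs z0))).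
have H2 : {for z, continuous ((fun w => atan (complex.Im w / complex.Re w)) : Cplx R -> R)}.
  have H3 : {for z, continuous ((fun w => complex.Im w / complex.Re w) : Cplx R -> R)}.
    apply: (@continuousM R (Cplx R) (@complex.Im R) (fun w => (complex.Re w)^-1)).
      exact: continuous_Im.
    by apply: (@continuousV R (Cplx R) (@complex.Re R)); [rewrite gt_eqF|exact: continuous_Re].
  exact: (@continuous_comp (Cplx R) R R
    (fun w => complex.Im w / complex.Re w) atan z H3 (@continuous_atan R _)).
exact: (continuous_comp (cvg_pair H1 H2) (@continuous_toC R _)).
Qed.

(** The derivative of an inverse function: [Log] is continuous and a right
    inverse of [cexp], whose derivative does not vanish. *)
Lemma cderiv_Log z : 0 < complex.Re z -> cderiv Log z z^-1.
Proof.
move=> z0 e e0; have zn0 := Re_gt0_neq0 z0; have az := Re_gt0_cabs z0.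
have [d [d0 dle2 dle]] : exists d : R, [/\ 0 < d, d <= 2^-1 & d <= e * cabs z / 2].
  exists (Num.min 2^-1 (e * cabs z / 2)); split.
  - by rewrite lt_min invr_gt0 ltr0n/= divr_gt0// mulr_gt0.
  - by rewrite ge_min lexx.
  - by rewrite ge_min lexx orbT.
have [r r0 Hr] := cderiv_cexp0 d0.
have [s s0 Hs] := (cplx_continuousP _ _).1 (Log_continuous z0) r r0.
exists (Num.min s (complex.Re z)); first by rewrite lt_min s0.
move=> h; rewrite lt_min => /andP[hs hz].
have zh0 : 0 < complex.Re (z + h).
  rewrite Re_add; have := le_lt_trans (Re_le_cabs h) hz; rewrite ltr_norml => /andP[]; lra.
have := Hs (z + h); rewrite (_ : z + h - z = h); last by rewrite addrAC subrr add0r.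
move=> /(_ hs); set k := Log (z + h) - Log z => /Hr.
rewrite add0r cexp0 mul1r.
have -> : cexp k = 1 + h / z.
  by rewrite /k cexpD cexpN !cexp_Log// mulrDl divff.
rewrite (_ : 1 + h / z - 1 - k = - (k - z^-1 * h)); last by ring.
rewrite cabsN => H.
have kle : cabs k <= 2 * (cabs h / cabs z).
  have := cabs_sub_le k (z^-1 * h); rewrite cabsM cabsV [_ * cabs h]mulrC.
  move: H; have := cabs_ge0 k; set A := cabs (k - _); set B := _ / _; nra.
apply: (le_trans H); apply: (@le_trans _ _ (d * (2 * (cabs h / cabs z)))).
  by rewrite ler_wpM2l ?(ltW d0).
have -> : d * (2 * (cabs h / cabs z)) = d * (2 / cabs z) * cabs h by ring.
rewrite ler_wpM2r ?cabs_ge0// mulrA ler_pdivrMr//; lra.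
Qed.

Lemma cexp_eq1 z : cexp z = 1 -> `|complex.Im z| < 2 * pi -> z = 0.
Proof.
case: z => x y; rewrite /cexp /= => -[E1 E2] yb.
have ex := expR_gt0 x.
have sy : sin y = 0 by move/eqP: E2; rewrite mulf_eq0 gt_eqF//= => /eqP.
have cy2 : cos y ^+ 2 = 1 by have := cos2Dsin2 y; rewrite sy expr0n addr0.
have cy : cos y = 1.
  move/eqP: cy2; rewrite sqrf_eq1 => /orP[/eqP//|/eqP cy].
  by move: E1 ex; rewrite cy; lra.
have x0 : x = 0.
  by apply: (@expR_inj R); rewrite expR0; move: E1; rewrite cy mulr1.
suff -> : y = 0 by rewrite x0.
have H (t : R) : 0 <= t -> t < 2 * pi -> cos t = 1 -> t = 0.
  move=> t0 t2 ct; have pi0 := pi_gt0 R.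
  have [tpi|pit] := leP t pi.
    have E : cos t = cos 0 by rewrite cos0.
    by apply: (cos_inj _ _ E); rewrite in_itv /= ?lexx ?t0 ?tpi// ltW.
  have : 2 * pi - t = 0.
    have E : cos (2 * pi - t) = cos 0.
      have -> : 2 * pi - t = - t + pi *+ 2 by ring.
      by rewrite cosD2pi cosN cos0.
    by apply: (cos_inj _ _ E); rewrite in_itv /=; apply/andP; split; lra.
  lra.
have [y0|y0] := leP 0 y; first by apply: H => //; rewrite -(ger0_norm y0).
apply/eqP; rewrite -oppr_eq0; apply/eqP; apply: H; rewrite ?oppr_ge0 ?ltW ?cosN//.
by rewrite -(ltr0_norm y0).
Qed.

End ExpLog.

(** * The spiral *)

Section Spiral.
Variable R : realType.
Implicit Types (L u z w : R[i]).

Lemma expR_ge_affine (a : R) : 4 <= a -> 8 + 2 * a <= expR a.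
Proof.
move=> a4; have h : 1 + a / 4 <= expR (a / 4) by exact: expR_ge1Dx.
have -> : expR a = expR (a / 4) ^+ 4 by rewrite -expRM_natl; congr expR; field.
have t2 : 2 <= 1 + a / 4 by lra.
apply: (@le_trans _ _ ((1 + a / 4) ^+ 4)); last first.
  by rewrite ler_pXn2r ?nnegrE ?expR_ge0//; lra.
move: t2; set t := 1 + a / 4; move=> t2.
have -> : 8 + 2 * a = 8 * t by rewrite /t; field.
rewrite exprSr ler_wpM2r//; first by lra.
have -> : (8 : R) = 2 ^+ 3 by ring.
by rewrite ler_pXn2r ?nnegrE//; lra.
Qed.

(** The bound [expR 4] keeps [Log L] in the half plane [Re u >= 4], where [Log]
    is a strong contraction. *)
Definition half_strip L := expR 4 <= complex.Re L /\ `|complex.Im L| <= 2.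

(** This is [e^(i u) / u] with [u = Log L], written so that its modulus and its
    derivative can be read off. *)
Definition spiral L : R[i] := cexp ('i * Log L - Log (Log L)).

Section half_strip_bounds.
Variable L : R[i].
Hypothesis HL : half_strip L.

Lemma half_strip_Re_ge : 16 <= complex.Re L.
Proof. by apply: le_trans HL.1; apply: le_trans (expR_ge_affine (lexx 4)); lra. Qed.

Lemma half_strip_Re_gt0 : 0 < complex.Re L.
Proof. by have := half_strip_Re_ge; lra. Qed.

Lemma half_strip_cabs_gt0 : 0 < cabs L.
Proof. exact: Re_gt0_cabs half_strip_Re_gt0. Qed.

Lemma half_strip_Re_Log : 4 <= complex.Re (Log L).
Proof.
rewrite /= -[leLHS]expRK ler_ln ?posrE ?expR_gt0 ?half_strip_cabs_gt0//.
by apply: le_trans HL.1 _; apply: le_trans (ler_norm _) (Re_le_cabs _).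
Qed.

Lemma half_strip_Re_Log_gt0 : 0 < complex.Re (Log L).
Proof. by apply: lt_le_trans half_strip_Re_Log. Qed.

(** The argument of [L] is at most [|Im L| / Re L], and [Re L] is at least
    [cabs L - 2]. *)
Lemma half_strip_Im_Log : `|complex.Im (Log L)| <= 2 / (expR (complex.Re (Log L)) - 2).
Proof.
apply: (le_trans (Im_Log_le half_strip_Re_gt0)).
rewrite /= lnK ?posrE ?half_strip_cabs_gt0//.
have h1 := half_strip_Re_ge; have [_ h2] := HL.
have h3 := cabs_le_ReIm L; have h4 : cabs L - 2 <= complex.Re L.
  by move: h3; rewrite (ger0_norm (ltW half_strip_Re_gt0)); lra.
have h5 : 14 <= cabs L - 2 by have := le_trans (ler_norm _) (Re_le_cabs L); lra.
rewrite ler_pdivrMr ?half_strip_Re_gt0//; apply: (le_trans h2).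
by rewrite mulrAC ler_pdivlMr ?ler_pM2l//; lra.
Qed.

Lemma half_strip_Im_Log_le : `|complex.Im (Log L)| <= 2^-1.
Proof.
apply: (le_trans half_strip_Im_Log).
have := expR_ge_affine half_strip_Re_Log; have := half_strip_Re_Log.
by move=> h1 h2; rewrite ler_pdivrMr; lra.
Qed.

Lemma half_strip_cabs_Log : 4 <= cabs (Log L).
Proof. exact: le_trans half_strip_Re_Log (le_trans (ler_norm _) (Re_le_cabs _)). Qed.

Lemma cabs_spiral : cabs (spiral L) = expR (- complex.Im (Log L)) / cabs (Log L).
Proof.
rewrite cabs_cexp Re_add Re_opp Re_mul [complex.Re 'i]/= [complex.Im 'i]/= mul0r mul1r sub0r.
rewrite expRD [X in _ * X]expRN; congr (_ / _).
by rewrite [complex.Re (Log (Log L))]/= lnK// posrE; apply: lt_le_trans half_strip_cabs_Log.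
Qed.

Lemma spiral_le : cabs (spiral L) <= 2 / cabs (Log L).
Proof.
rewrite cabs_spiral ler_wpM2r ?invr_ge0 ?cabs_ge0//.
have := half_strip_Im_Log_le; rewrite ler_norml => /andP[h1 h2].
apply: (@le_trans _ _ (expR 2^-1)); first by rewrite ler_expR; lra.
rewrite -[leLHS]invrK -expRN -[leRHS]invrK lef_pV2 ?posrE ?expR_gt0//.
by apply: le_trans (expR_ge1Dx _); lra.
Qed.

Lemma spiral_ge : 2^-1 / cabs (Log L) <= cabs (spiral L).
Proof.
rewrite cabs_spiral ler_wpM2r ?invr_ge0 ?cabs_ge0//.
have := half_strip_Im_Log_le; rewrite ler_norml => /andP[h1 h2].
by apply: le_trans (expR_ge1Dx _); lra.
Qed.

Definition spiral_deriv := spiral L * (('i - (Log L)^-1) * L^-1).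

Lemma cderiv_spiral : cderiv (@spiral) L spiral_deriv.
Proof.
have d1 := cderiv_Log half_strip_Re_gt0.
have d2 := cderiv_comp d1 (cderiv_Log half_strip_Re_Log_gt0).
have d3 := cderiv_comp (cderivB (cderivZ 'i d1) d2) (cderiv_cexp _).
by rewrite /spiral_deriv mulrBl; exact: d3.
Qed.

Lemma cderiv_LogLog : cderiv (fun L => Log (Log L)) L ((Log L)^-1 * L^-1).
Proof.
exact: cderiv_comp (cderiv_Log half_strip_Re_gt0) (cderiv_Log half_strip_Re_Log_gt0).
Qed.

Let inv_Log_le : cabs (Log L)^-1 <= 4^-1.
Proof.
rewrite cabsV lef_pV2 ?posrE//; first exact: half_strip_cabs_Log.
exact: lt_le_trans half_strip_cabs_Log.
Qed.

Lemma spiral_deriv_le : cabs spiral_deriv <= 5 / 2 / (cabs (Log L) * cabs L).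
Proof.
rewrite /spiral_deriv !cabsM [cabs L^-1]cabsV invfM mulrA mulrA ler_wpM2r ?invr_ge0 ?cabs_ge0//.
have -> : 5 / 2 / cabs (Log L) = 2 / cabs (Log L) * (5 / 4).
  by field; rewrite gt_eqF// (lt_le_trans _ half_strip_cabs_Log).
rewrite ler_pM ?cabs_ge0 ?spiral_le//.
by apply: (le_trans (cabsB _ _)); rewrite cabs_i; have := inv_Log_le; lra.
Qed.

(** The derivatives of [Log (Log L)] and of [spiral L] have the common factor
    [L^-1]; the others are [(Log L)^-1] and [spiral L], of comparable modulus,
    times ['i - (Log L)^-1], which is close to ['i]. *)
Lemma LogLog_deriv_lt : cabs ((Log L)^-1 * L^-1) < 3 * cabs spiral_deriv.
Proof.
rewrite /spiral_deriv !cabsM mulrA mulrA ltr_pM2r; last first.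
  by rewrite cabsV invr_gt0 half_strip_cabs_gt0.
have uL : 0 < cabs (Log L) by apply: lt_le_trans half_strip_cabs_Log.
rewrite [cabs (Log L)^-1]cabsV.
have h1 : 3 / 4 <= cabs ('i - (Log L)^-1).
  by have := cabs_sub_le 'i (Log L)^-1; rewrite cabs_i; have := inv_Log_le; lra.
apply: (@lt_le_trans _ _ (3 * (2^-1 / cabs (Log L)) * (3 / 4))).
  have -> : 3 * (2^-1 / cabs (Log L)) * (3 / 4) = 9 / 8 * (cabs (Log L))^-1.
    by field; rewrite gt_eqF.
  by rewrite ltr_pMl ?invr_gt0//; lra.
rewrite -!mulrA ler_pM2l// [leLHS]mulrA; apply: ler_pM => //; last exact: spiral_ge.
by rewrite divr_ge0// ltW.
Qed.

End half_strip_bounds.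

Let Log_contract u u' : 4 <= complex.Re u -> 4 <= complex.Re u' ->
  cabs (Log u - Log u') <= 4^-1 * cabs (u - u').
Proof.
move=> h h'; apply: cderiv_mean_value => // t /andP[t0 t1].
have re : 4 <= complex.Re (u' + t%:C * (u - u')).
  rewrite Re_add Re_mul /= Re_add Re_opp; nra.
exists (u' + t%:C * (u - u'))^-1; first by apply: cderiv_Log; apply: lt_le_trans re.
have c4 := le_trans re (le_trans (ler_norm _) (Re_le_cabs _)).
by rewrite cabsV lef_pV2 ?posrE//; apply: lt_le_trans c4.
Qed.

(** Distinct turns of the spiral are disjoint: one turn to the next changes
    the modulus by more than the width of the corridor. *)
Lemma spiral_inj L L' : half_strip L -> half_strip L' -> spiral L = spiral L' -> L = L'.
Proof.
wlog aa : L L' / complex.Re (Log L) <= complex.Re (Log L').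
  move=> W HL HL' E; have [h|h] := leP (complex.Re (Log L)) (complex.Re (Log L')).
    exact: W.
  by apply/esym; apply: W => //; exact: ltW.
move=> HL HL' E; apply: (Log_inj (half_strip_Re_gt0 HL) (half_strip_Re_gt0 HL')).
have a4 := half_strip_Re_Log HL; have a4' := half_strip_Re_Log HL'.
have b1 := half_strip_Im_Log_le HL; have b1' := half_strip_Im_Log_le HL'.
have b2 := half_strip_Im_Log HL; have b2' := half_strip_Im_Log HL'.
have mod_eq : expR (- complex.Im (Log L)) / cabs (Log L) =
    expR (- complex.Im (Log L')) / cabs (Log L').
  by rewrite -!cabs_spiral// E.
have cu : 0 < cabs (Log L) by apply: lt_le_trans (half_strip_cabs_Log HL).
have cu' : 0 < cabs (Log L') by apply: lt_le_trans (half_strip_cabs_Log HL').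
move: E mod_eq aa a4 a4' b1 b1' b2 b2' cu cu'; rewrite /spiral {HL HL'}.
move: (Log L) (Log L') => u u' E mod_eq aa a4 a4' b1 b1' b2 b2' cu cu'.
(* For close angles the logarithms determine [u], as [Log] is a contraction in
   this region.  For angles further apart, hence on different turns, the moduli
   differ. *)
have [near3|far3] := ltP (complex.Re u' - complex.Re u) 3.
  have arg (v : R[i]) : 4 <= complex.Re v -> `|complex.Im v| <= 2^-1 ->
      `|complex.Im (Log v)| <= 8^-1.
    move=> v4 v2; have v0 : 0 < complex.Re v by apply: lt_le_trans v4.
    apply: (le_trans (Im_Log_le v0)); rewrite ler_pdivrMr//; lra.
  have z0 : ('i * u - Log u) - ('i * u' - Log u') = 0.
    apply: cexp_eq1.
      rewrite cexpD cexpN E divff//; exact: cexp_neq0.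
    have := arg u a4 b1; have := arg u' a4' b1'; have := pi_ge2 R.
    rewrite !(Im_add, Im_opp, Im_mul) [complex.Re 'i]/= [complex.Im 'i]/= !mul0r !mul1r !add0r.
    rewrite !ler_norml ltr_norml => pi2 /andP[i1 i2] /andP[i3 i4].
    by move: near3 aa pi2 i1 i2 i3 i4; clear => *; apply/andP; split; lra.
  have := Log_contract a4 a4'.
  have -> : Log u - Log u' = 'i * (u - u').
    by apply/eqP; rewrite -subr_eq0 -oppr_eq0 -z0; apply/eqP; ring.
  rewrite cabsM cabs_i mul1r => H.
  by apply/eqP; rewrite -subr_eq0 -cabs_eq0 eq_le cabs_ge0 andbT; lra.
exfalso.
set a := complex.Re u in a4 aa far3 b2.
have ea := expR_ge_affine a4.
have ea' : expR a <= expR (complex.Re u') by rewrite ler_expR.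
have ub : cabs u <= a + 2^-1.
  by have := cabs_le_ReIm u; rewrite -/a (ger0_norm (le_trans _ a4))//; lra.
have ub' : a + 3 <= cabs u'.
  by have := le_trans (ler_norm _) (Re_le_cabs u'); lra.
have q : 2 / (expR (complex.Re u') - 2) <= 2 / (expR a - 2).
  by rewrite ler_pM2l// lef_pV2 ?posrE; move: ea ea' a4; clear; lra.
have im : complex.Im u - complex.Im u' <= 4 / (expR a - 2).
  move: b2 b2' q; rewrite !ler_norml => /andP[_ ?] /andP[? _] ?.
  have -> : 4 / (expR a - 2) = 2 / (expR a - 2) + 2 / (expR a - 2) by ring.
  lra.
have lnE : cabs u / cabs u' = expR (complex.Im u' - complex.Im u).
  have -> : cabs u = cabs u' * (expR (- complex.Im u) / expR (- complex.Im u')).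
    move: mod_eq => /(congr1 (fun x => x * (cabs u * cabs u'))) e.
    have {}e : expR (- complex.Im u) * cabs u' = expR (- complex.Im u') * cabs u.
      by move: e; rewrite mulrA mulfVK ?gt_eqF// => ->; field; rewrite gt_eqF.
    by apply: (mulfI (lt0r_neq0 (expR_gt0 (- complex.Im u')))); rewrite -e; field; rewrite gt_eqF ?expR_gt0.
  rewrite -expRB mulrAC divff ?gt_eqF// mul1r; congr expR; ring.
have := expR_ge1Dx (complex.Im u' - complex.Im u); rewrite -lnE.
have rat : cabs u / cabs u' <= (a + 2^-1) / (a + 3).
  by rewrite ler_pM ?cabs_ge0 ?invr_ge0 ?cabs_ge0// lef_pV2 ?posrE//; move: a4 ub ub'; clear; lra.
have r2 : (a + 2^-1) / (a + 3) = 1 - (5 / 2) / (a + 3) by field; rewrite gt_eqF//; move: a4; clear; lra.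
have r3 : 4 / (expR a - 2) < (5 / 2) / (a + 3).
  rewrite ltr_pdivrMr; last by move: ea a4; clear; lra.
  by rewrite mulrAC ltr_pdivlMr; move: ea a4; clear; lra.
by move: im rat r2 r3; clear; lra.
Qed.

End Spiral.

(** * The conformal map of the disk *)

Section DiskMap.
Variable R : realType.
Implicit Types (z w h : R[i]).

Lemma unit_diskE z : unit_disk z <-> cabs z < 1.
Proof. by rewrite /unit_disk /= normcE -ltcR. Qed.

Lemma closed_unit_diskE z : closed_unit_disk z <-> cabs z <= 1.
Proof. by rewrite /closed_unit_disk /= normcE -lecR. Qed.

Lemma unit_circleE z : unit_circle z <-> cabs z = 1.
Proof.
rewrite /unit_circle /= normcE; split=> [|->//].
by move=> /(@complexI R).
Qed.

(** Near [z] the increments of [f] and [p] are their linear parts up to a small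
    multiple of [cabs h], for which the strict inequality leaves room. *)
Lemma cderiv_compare (f p : R[i] -> R[i]) z a b (K : R) : 0 < K ->
  cderiv f z a -> cderiv p z b -> cabs b < K * cabs a ->
  exists2 r : R, 0 < r & forall h, cabs h < r ->
    cabs (p (z + h) - p z) <= K * cabs (f (z + h) - f z).
Proof.
move=> K0 Hf Hp ba; pose e := (K * cabs a - cabs b) / (K + 1).
have e0 : 0 < e by rewrite divr_gt0 ?subr_gt0// addr_gt0.
have eE : e * (K + 1) = K * cabs a - cabs b by rewrite mulfVK// gt_eqF// addr_gt0.
have [r r0 Hr] := Hf _ e0; have [s s0 Hs] := Hp _ e0.
exists (Num.min r s); first by rewrite lt_min r0.
move=> h; rewrite lt_min => /andP[/Hr H1 /Hs H2].
have h1 : cabs (p (z + h) - p z) <= (cabs b + e) * cabs h.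
  rewrite -[X in cabs X](subrK (b * h)); apply: (le_trans (cabsD _ _)).
  by rewrite cabsM mulrDl addrC lerD2l.
have h2 : (cabs a - e) * cabs h <= cabs (f (z + h) - f z).
  have := cabs_sub_le (a * h) (- (f (z + h) - f z - a * h)).
  rewrite cabsN opprK cabsM (_ : a * h + (f (z + h) - f z - a * h) = f (z + h) - f z); last by ring.
  by rewrite mulrBl; lra.
apply: (le_trans h1); apply: (@le_trans _ _ (K * ((cabs a - e) * cabs h))); last first.
  by rewrite ler_pM2l.
by rewrite mulrA ler_wpM2r ?cabs_ge0//; lra.
Qed.

(** The domain of the conformal coordinates: the boundary point [1] corresponds
    to the end of the corridor. *)
Definition punctured z := cabs z <= 1 /\ z != 1.

Definition cayley z : R[i] := 2 / (1 - z).

Definition strip_coord z : R[i] := (expR 4)%:C + Log (cayley z).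

Definition disk_map z : R[i] := if z == 1 then 0 else spiral (strip_coord z).

Definition depth z : R[i] := Log (Log (strip_coord z)).

Let one_sub_neq0 z : z != 1 -> 1 - z != 0.
Proof. by rewrite subr_eq0 eq_sym. Qed.

Lemma cabs_two : cabs (2 : R[i]) = 2.
Proof. by rewrite -[2 : R[i]](rmorph_nat (real_complex R)) cabs_real ger0_norm. Qed.

Lemma Re_cayley_ge1 z : punctured z -> 1 <= complex.Re (cayley z).
Proof.
move=> [z1 zn1]; have c0 : 0 < cabs (1 - z) by rewrite cabs_gt0 one_sub_neq0.
have -> : cayley z = (2 : R)%:C * (1 - z)^-1 by rewrite rmorph_nat.
rewrite Re_mul /= mul0r subr0 Re_inv mulrA ler_pdivlMr ?exprn_gt0// mul1r cabs_sqr.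
rewrite !Re_add !Im_add !Re_opp !Im_opp /= sub0r sqrrN.
have : cabs z ^+ 2 <= 1 by rewrite expr_le1// cabs_ge0.
rewrite cabs_sqr; nra.
Qed.

Lemma Re_cayley_gt0 z : punctured z -> 0 < complex.Re (cayley z).
Proof. by move=> /Re_cayley_ge1; apply: lt_le_trans. Qed.

Lemma cabs_cayley_ge1 z : punctured z -> 1 <= cabs (cayley z).
Proof. by move=> /Re_cayley_ge1 /le_trans; apply; apply: le_trans (Re_le_cabs _); exact: ler_norm. Qed.

Lemma strip_coord_half_strip z : punctured z -> half_strip (strip_coord z).
Proof.
move=> pz; split.
  rewrite /strip_coord Re_add /= lerDl ln_ge0//; exact: cabs_cayley_ge1.
rewrite /strip_coord Im_add [complex.Im (_%:C)]/= add0r.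
by apply: ltW; apply: lt_trans (Im_Log_lt _) (pihalf_lt2 R).
Qed.

Lemma disk_map_inj z w : cabs z <= 1 -> cabs w <= 1 -> disk_map z = disk_map w -> z = w.
Proof.
move=> z1 w1; rewrite /disk_map.
have [->|zn1] := eqVneq z 1; have [->|wn1] := eqVneq w 1 => //.
- by move=> /esym/eqP; rewrite (negPf (cexp_neq0 _)).
- by move=> /eqP; rewrite (negPf (cexp_neq0 _)).
have pz : punctured z by []; have pw : punctured w by [].
move=> /(spiral_inj (strip_coord_half_strip pz) (strip_coord_half_strip pw)).
move=> /addrI /(Log_inj (Re_cayley_gt0 pz) (Re_cayley_gt0 pw)) /eqP.
rewrite /cayley (inj_eq (mulfI _)) ?pnatr_eq0// (inj_eq invr_inj) (inj_eq (addrI _)).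
by rewrite (inj_eq oppr_inj) => /eqP.
Qed.

Lemma cderiv_strip_coord z : punctured z ->
  exists2 d, d != 0 & cderiv strip_coord z d.
Proof.
move=> pz; have [z1 zn1] := pz; have n0 := one_sub_neq0 zn1.
have d1 := cderivZ 2 (cderiv_comp (cderivB (cderiv_cst 1 z) (cderiv_id z)) (cderiv_inv n0)).
have d2 := cderivD (cderiv_cst (expR 4)%:C z) (cderiv_comp d1 (cderiv_Log (Re_cayley_gt0 pz))).
eexists; last exact: d2.
rewrite add0r /cayley sub0r mulrNN mulr1 !mulf_neq0 ?invr_eq0 ?mulf_neq0 ?invr_eq0 ?pnatr_eq0//.
Qed.

Lemma disk_map_near z : z != 1 -> exists2 r : R, 0 < r &
  forall h, cabs h < r -> spiral (strip_coord (z + h)) = disk_map (z + h).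
Proof.
move=> zn1; exists (cabs (1 - z)); first by rewrite cabs_gt0 one_sub_neq0.
move=> h hz; rewrite /disk_map; case: eqVneq => // E.
by move: hz; rewrite -E (_ : z + h - z = h) ?ltxx// addrAC subrr add0r.
Qed.

Lemma disk_map_derivs z : punctured z -> exists a b,
  [/\ cderiv disk_map z a, a != 0, cderiv depth z b & cabs b < 3 * cabs a].
Proof.
move=> pz; have [d d0 Hd] := cderiv_strip_coord pz.
have HL := strip_coord_half_strip pz; have [_ zn1] := pz.
have [r r0 Hr] := disk_map_near zn1.
have d1 := cderiv_near r0 Hr (cderiv_comp Hd (cderiv_spiral HL)).
have d2 := cderiv_comp Hd (cderiv_LogLog HL).
have lt3 := LogLog_deriv_lt HL.
eexists; eexists; split; [exact: d1| |exact: d2|].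
  by rewrite mulf_neq0// -cabs_gt0; have := le_lt_trans (cabs_ge0 _) lt3; lra.
by rewrite [X in X < _]cabsM [X in _ < _ * X]cabsM mulrA ltr_pM2r ?cabs_gt0.
Qed.

(** The depth of a point of the corridor is a Lipschitz function of its
    position, for the inner distance of the corridor. *)
Lemma depth_control z : punctured z -> exists2 r : R, 0 < r &
  forall h, cabs h < r -> cabs (depth (z + h) - depth z) <= 3 * cabs (disk_map (z + h) - disk_map z).
Proof.
move=> /disk_map_derivs [a [b [Ha _ Hb ab]]].
by apply: (cderiv_compare (f := disk_map)) Ha Hb ab.
Qed.

Lemma cabs_strip_coord_ge z : punctured z -> ln (cabs (cayley z)) <= cabs (strip_coord z).
Proof.
move=> pz; apply: le_trans (Re_le_cabs _); apply: le_trans (ler_norm _).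
by rewrite /strip_coord Re_add /= lerDr expR_ge0.
Qed.

Lemma cabs_Log_strip_coord_ge z (s : R) : punctured z ->
  expR (expR s) <= cabs (cayley z) -> s <= cabs (Log (strip_coord z)).
Proof.
move=> pz H; apply: le_trans (Re_le_cabs _); apply: le_trans (ler_norm _).
have HL := strip_coord_half_strip pz.
rewrite /= -[leLHS]expRK ler_ln ?posrE ?expR_gt0 ?half_strip_cabs_gt0//.
apply: le_trans (cabs_strip_coord_ge pz).
by rewrite -[leLHS]expRK ler_ln ?posrE ?expR_gt0// (lt_le_trans (expR_gt0 _) H).
Qed.

(** Each of the three logarithms between [cayley z] and [depth z] undoes one
    exponential. *)
Lemma depth_ge z (s : R) : punctured z ->
  expR (expR (expR s)) <= cabs (cayley z) -> s <= complex.Re (depth z).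
Proof.
move=> pz H; have HL := strip_coord_half_strip pz.
rewrite /= -[leLHS]expRK ler_ln ?posrE ?expR_gt0//; first exact: cabs_Log_strip_coord_ge.
by apply: lt_le_trans (half_strip_cabs_Log HL).
Qed.

Lemma disk_map_continuous :
  {within @closed_unit_disk R, continuous (disk_map : Cplx R -> Cplx R)}.
Proof.
apply/cplx_withinP => z /closed_unit_diskE z1 e e0.
have [->|zn1] := eqVneq z 1; last first.
  have pz : punctured z by [].
  have [a [_ [Ha _ _ _]]] := disk_map_derivs pz.
  have [r r0 Hr] := (cplx_continuousP _ _).1 (cderiv_continuous_at Ha) e e0.
  by exists r => // w _; exact: Hr.
exists (expR (- expR (4 / e))); first exact: expR_gt0.
move=> w /closed_unit_diskE w1 wr; rewrite /disk_map eqxx subr0.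
case: eqVneq => [_|wn1]; first by rewrite cabs0.
have pw : punctured w by [].
have HL := strip_coord_half_strip pw.
have cw : 0 < cabs (1 - w) by rewrite cabs_gt0 one_sub_neq0.
have H : 4 / e <= cabs (Log (strip_coord w)).
  apply: cabs_Log_strip_coord_ge => //; rewrite /cayley cabsM cabsV cabs_two.
  rewrite ler_pdivlMr//; move: wr; rewrite cabs_distC expRN => wr.
  have ee := expR_gt0 (expR (4 / e)).
  have : cabs (1 - w) * expR (expR (4 / e)) < 1 by rewrite -ltr_pdivlMr// div1r.
  rewrite mulrC => /ltW /le_trans; apply; lra.
apply: le_lt_trans (spiral_le HL) _.
have q0 : 0 < 4 / e by rewrite divr_gt0.
rewrite ltr_pdivrMr ?(lt_le_trans q0)//.
have := ler_wpM2l (ltW e0) H; rewrite mulrCA divff ?gt_eqF// mulr1; lra.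
Qed.

End DiskMap.

(** * Images of the closed disk as Jordan domains *)

Section JordanDomain.
Variable R : realType.
Local Notation C := (Cplx R).
Implicit Types (z w : C).

Lemma closed_closed_unit_disk : closed (@closed_unit_disk R).
Proof.
have -> : @closed_unit_disk R = (@cabs R : C -> R) @^-1` [set x | x <= 1].
  by apply/seteqP; split=> z /=; rewrite closed_unit_diskE.
apply: closed_comp; last exact: closed_le.
by move=> z _; exact: continuous_cabs.
Qed.

Lemma compact_closed_unit_disk : compact (@closed_unit_disk R).
Proof.
have cI : compact (@toC R @` (`[-1, 1]%classic `*` `[-1, 1]%classic)).
  apply: continuous_compact.
    by apply: continuous_subspaceT; exact: continuous_toC.
  by apply: compact_setX; exact: segment_compact.
apply: subclosed_compact cI _; first exact: closed_closed_unit_disk.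
move=> z /closed_unit_diskE z1; exists (complex.Re z, complex.Im z); last by case: z {z1}.
split; rewrite /= in_itv /= -ler_norml.
  exact: le_trans (Re_le_cabs z) z1.
exact: le_trans (Im_le_cabs z) z1.
Qed.

Lemma unit_circle_closed_disk : @unit_circle R `<=` @closed_unit_disk R.
Proof. by move=> z /unit_circleE z1; apply/closed_unit_diskE; rewrite z1. Qed.

Lemma unit_disk_closed_disk : @unit_disk R `<=` @closed_unit_disk R.
Proof. by move=> z /unit_diskE z1; apply/closed_unit_diskE; rewrite ltW. Qed.

Lemma closed_disk_split z : closed_unit_disk z -> unit_disk z \/ unit_circle z.
Proof.
move=> /closed_unit_diskE; rewrite le_eqVlt => /orP[/eqP|] z1.
  by right; exact/unit_circleE.
by left; exact/unit_diskE.
Qed.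

Lemma compact_unit_circle : compact (@unit_circle R).
Proof.
apply: subclosed_compact compact_closed_unit_disk unit_circle_closed_disk.
have -> : @unit_circle R = (@cabs R : C -> R) @^-1` [set 1].
  by apply/seteqP; split=> z /=; rewrite unit_circleE.
apply: closed_comp; last exact: closed_eq.
by move=> z _; exact: continuous_cabs.
Qed.

Lemma connected_unit_disk : connected (@unit_disk R).
Proof.
pose S (z : C) : set C := (fun t : R => t%:C * z) @` `[0, 1]%classic.
have -> : @unit_disk R = \bigcup_(z in @unit_disk R) S z.
  apply/seteqP; split=> [z Dz|w [z /unit_diskE z1 [t /=]]].
    by exists z => //; exists 1; rewrite ?rmorph1 ?mul1r//= in_itv /= ler01 lexx.
  rewrite in_itv /= => /andP[t0 t1] <-; apply/unit_diskE.
  by rewrite cabsM cabs_real ger0_norm// (le_lt_trans _ z1)// ler_piMl// cabs_ge0.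
apply: bigcup_connected.
  exists 0 => z _ /=; exists 0; rewrite ?rmorph0 ?mul0r//=.
  by rewrite in_itv /= lexx ler01.
move=> z _; apply: connected_continuous_connected.
  by apply/connected_intervalP; exact: interval_is_interval.
apply: continuous_subspaceT => t A /cplx_nbhsP [e e0 HA].
apply/nbhs_ballP; exists (e / (cabs z + 1)) => /=.
  by rewrite divr_gt0// ltr_wpDl// cabs_ge0.
move=> s; rewrite /ball /= => ts; apply: HA.
rewrite -mulrBl -rmorphB /= cabsM cabs_real distrC.
move: ts; rewrite ltr_pdivlMr ?ltr_wpDl ?cabs_ge0//; apply: le_lt_trans.
by rewrite ler_wpM2l// lerDl.
Qed.

Variable f : C -> C.
Hypothesis cf : {within @closed_unit_disk R, continuous f}.
Hypothesis injf : {in @closed_unit_disk R &, injective f}.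
Hypothesis df : forall z, unit_disk z -> exists2 a : R[i], a != 0 & cderiv f z a.

Let Omega := f @` @unit_disk R.
Let G := f @` @unit_circle R.
Let K := f @` @closed_unit_disk R.

Let within_sub (A : set C) : A `<=` @closed_unit_disk R -> {within A, continuous f}.
Proof. by move=> AD; apply: continuous_subspaceW AD _. Qed.

Let cK : closed K.
Proof.
apply: compact_closed; first exact: norm_hausdorff.
exact: continuous_compact cf compact_closed_unit_disk.
Qed.

Let OmegaG w : Omega w -> ~ G w.
Proof.
move=> [z zD <-] [z' z'C E].
have zz' : z' = z.
  apply: injf => //; apply/mem_set; [exact: unit_circle_closed_disk|exact: unit_disk_closed_disk].
move: zD z'C; rewrite zz' => /unit_diskE + /unit_circleE z1.
by rewrite z1 ltxx.
Qed.

Let KE w : K w -> Omega w \/ G w.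
Proof. by move=> [z /closed_disk_split [zD|zC] <-]; [left|right]; exists z. Qed.

Let within_cabs (A : set C) w : A `<=` @closed_unit_disk R ->
  {within A, continuous ((fun z => cabs (f z - w)) : C -> R)}.
Proof.
move=> /within_sub cA; apply/subspace_continuousP => z Az.
have cz := (subspace_continuousP A f).1 cA z Az.
apply: (@cvg_comp _ _ _ f (fun x => cabs (x - w)) _ _ _ cz).
apply: (@continuous_comp C C R (fun x => x - w) (@cabs R)); last exact: continuous_cabs.
apply: (@continuousB R[i] C C id (cst w)); first exact: cvg_id.
exact: cst_continuous.
Qed.

(** Open mapping by minimization: a minimum of the distance from [f] to a point
    near the image of the open disk is interior, and there the derivative
    points towards the target unless it has been reached. *)
Lemma image_open : open Omega.
Proof.
rewrite openE => _ [z0 z0D <-]; rewrite /interior.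
have C0 : @unit_circle R !=set0 by exists 1; apply/unit_circleE; exact: cabs1.
have D0 : @closed_unit_disk R !=set0 by exists 0; apply/closed_unit_diskE; rewrite cabs0.
have [c cC cmin] := compact_EVT_min C0 compact_unit_circle
  (@within_cabs _ (f z0) unit_circle_closed_disk).
set d := cabs (f c - f z0) in cmin.
have d0 : 0 < d.
  rewrite cabs_gt0 subr_eq0; apply/eqP => E.
  apply: (@OmegaG (f z0)); first by exists z0.
  by exists c => //; exact/set_mem.
apply/cplx_nbhsP; exists (d / 2); first by rewrite divr_gt0.
move=> w wz0.
have [z1 z1D zmin] := compact_EVT_min D0 compact_closed_unit_disk
  (@within_cabs _ w (@subset_refl _ _)).
have le0 : cabs (f z1 - w) <= cabs (f z0 - w).
  by apply: zmin; apply/mem_set; exact: unit_disk_closed_disk.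
have z1in : unit_disk z1.
  have /closed_disk_split [//|z1C] := set_mem z1D.
  have := cmin z1 (mem_set z1C); have := cabs_dist_triangle w (f z1) (f z0).
  by move: le0; rewrite [cabs (f z0 - w)]cabs_distC => *; lra.
exists z1 => //; apply/eqP; rewrite -subr_eq0 -cabs_eq0; apply/negP => /negP n0.
set v := f z1 - w in n0.
have v0 : 0 < cabs v by rewrite lt_def n0 cabs_ge0.
have [a a0 Ha] := df z1in; have aa : 0 < cabs a by rewrite cabs_gt0.
have aa2 : 0 < cabs a / 2 by rewrite divr_gt0.
have [r r0 Hr] := Ha _ aa2.
have /unit_diskE z1lt := z1in.
(* A Newton step of length [q] towards [w], short enough to stay in the disk
   and in the region where the derivative is a good approximation. *)
have [q [q0 q1 q2 q3]] : exists q : R, [/\ 0 < q, q <= 1,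
    q * (cabs v / cabs a) < r & q * (cabs v / cabs a) <= 1 - cabs z1].
  pose q := Num.min 1 (Num.min (r / 2) (1 - cabs z1) / (cabs v / cabs a)).
  have va : 0 < cabs v / cabs a by rewrite divr_gt0.
  have m0 : 0 < Num.min (r / 2) (1 - cabs z1) by rewrite lt_min subr_gt0 z1lt divr_gt0.
  exists q; split; first by rewrite lt_min ltr01 divr_gt0.
  - by rewrite ge_min lexx.
  - apply: (@le_lt_trans _ _ (r / 2)); last by lra.
    by rewrite -ler_pdivlMr// ge_min ler_pM2r ?invr_gt0// ge_min lexx orbT.
  - by rewrite -ler_pdivlMr// ge_min ler_pM2r ?invr_gt0// ge_min lexx !orbT.
pose h : R[i] := - q%:C * (v / a).
have hE : cabs h = q * (cabs v / cabs a).
  by rewrite /h cabsM cabsN cabs_real cabsM cabsV ger0_norm// ltW.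
have h1 : closed_unit_disk (z1 + h).
  by apply/closed_unit_diskE; apply: le_trans (cabsD _ _) _; rewrite hE; lra.
have := zmin _ (mem_set h1); rewrite -/v leNgt => /negP; apply.
have := Hr h; rewrite hE => /(_ q2) H.
have -> : f (z1 + h) - w = (1 - q)%:C * v + (f (z1 + h) - f z1 - a * h).
  rewrite rmorphB rmorph1 /= /h /v; field; exact: a0.
apply: le_lt_trans (cabsD _ _) _.
rewrite cabsM cabs_real ger0_norm ?subr_ge0//.
have e2 : cabs a / 2 * (q * (cabs v / cabs a)) = q * cabs v / 2 by field; rewrite gt_eqF.
rewrite e2 in H.
have : 0 < q * cabs v by rewrite mulr_gt0.
by rewrite mulrBl mul1r; lra.
Qed.

(** The image of the closed disk is compact, hence closed, and a boundary point
    is approached by the images of its contractions towards [0]. *)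
Lemma image_closure : closure Omega = K.
Proof.
apply/seteqP; split.
  rewrite closureE => w; apply; split; first exact: cK.
  by apply: image_subset; exact: unit_disk_closed_disk.
move=> _ [z zD <-]; rewrite /closure /= => B /cplx_nbhsP [e e0 HB].
have [r r0 Hr] := (cplx_withinP _ _).1 cf z zD e e0.
have /closed_unit_diskE z1 := zD.
pose t : R := Num.min (r / 2) 1.
have t0 : 0 < t by rewrite lt_min divr_gt0 ?ltr01.
have t1 : t <= 1 by rewrite ge_min lexx orbT.
have tr : t < r.
  by apply: (@le_lt_trans _ _ (r / 2)); [rewrite ge_min lexx|lra].
have [z0|zn0] := eqVneq z 0.
  exists (f z); split; last by apply: HB; rewrite subrr cabs0.
  by exists z => //; apply/unit_diskE; rewrite z0 cabs0.
pose z' : C := (1 - t)%:C * z.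
have z'E : cabs z' = (1 - t) * cabs z by rewrite cabsM cabs_real ger0_norm// subr_ge0.
have z'D : unit_disk z' by apply/unit_diskE; rewrite z'E; have := cabs_ge0 z; nra.
exists (f z'); split; first by exists z'.
apply: HB; apply: Hr; first exact: unit_disk_closed_disk.
rewrite (_ : z' - z = - t%:C * z); last by rewrite /z' rmorphB rmorph1; ring.
by rewrite cabsM cabsN cabs_real ger0_norm ?ltW// (le_lt_trans _ tr)// ler_piMr// ltW.
Qed.

Lemma image_boundary : boundary Omega = G.
Proof.
rewrite /boundary image_closure ((interior_id _).1 image_open).
apply/seteqP; split=> w.
  by move=> [/KE [|//]].
move=> Gw; split; last by move=> /OmegaG.
by case: Gw => z zC <-; exists z => //; exact: unit_circle_closed_disk.
Qed.

Lemma image_jordan_curve : jordan_curve G.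
Proof.
exists f; apply: compact_homeomorphism.
- exact: compact_unit_circle.
- exact: within_sub unit_circle_closed_disk.
- move=> x y /set_mem Cx /set_mem Cy; apply: injf; apply/mem_set;
    exact: unit_circle_closed_disk.
Qed.

(** The image of the open disk is connected, open, and closed in the complement
    of the curve. *)
Lemma image_jordan_domain : jordan_domain Omega.
Proof.
exists G; first exact: image_jordan_curve.
split.
  have D0 : @closed_unit_disk R !=set0 by exists 0; apply/closed_unit_diskE; rewrite cabs0.
  have [M MD Mmax] := compact_EVT_max D0 compact_closed_unit_disk
    (@within_cabs _ 0 (@subset_refl _ _)).
  exists (cabs (f M - 0))%:C; split; first by apply/complex_realP; eexists.
  move=> x Mx _ [z zD <-]; apply: le_trans _ (ltW Mx).
  rewrite normcE lecR; have := Mmax z; rewrite subr0; apply.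
  exact/mem_set/unit_disk_closed_disk.
have O0 : Omega (f 0) by exists 0 => //; apply/unit_diskE; rewrite cabs0.
have nG0 : (~` G) (f 0) by exact: OmegaG.
exists (f 0) => //; apply/seteqP; split.
  apply: connected_component_max => //.
  apply: connected_continuous_connected; first exact: connected_unit_disk.
  exact: within_sub unit_disk_closed_disk.
have compc := @component_connected _ (~` G) (f 0).
have sub := @connected_component_sub _ (~` G) (f 0).
rewrite -(compc (connected_component (~` G) (f 0) `&` Omega)).
- by move=> w [].
- exists (f 0); split => //; exact: connected_component_refl.
- by exists Omega => //; exact: image_open.
- exists K; first exact: cK.
  apply/seteqP; split=> w [cw Ow]; split => //.
    by case: Ow => z zD <-; exists z => //; exact: unit_disk_closed_disk.
  by have [|/(sub w cw)] := KE Ow.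
Qed.

End JordanDomain.

(** * Hyperbolic distance to the center of the disk *)

Section HyperbolicBound.
Variable R : realType.
Local Notation mu := (@lebesgue_measure R).

(** The radius from [z] to [0], run at constant speed, has density
    [2 * r / (1 - s ^+ 2)] at modulus [s <= 1], which is at most
    [2 * r / (1 - s)] with [r] the modulus of [z]. *)
Lemma hyperbolic_dist_disk_le (z : Cplx R) : cabs z < 1 ->
  (hyperbolic_dist_disk z 0%R <= (- 2 * ln (1 - cabs z))%:E)%E.
Proof.
move=> z1; set a := complex.Re z; set b := complex.Im z; set r := cabs z.
have r0 : 0 <= r := cabs_ge0 z.
have r1 : r < 1 := z1.
have rE : r ^+ 2 = a ^+ 2 + b ^+ 2 by rewrite /r cabs_sqr.
pose g (t : R) : Cplx R := ((1 - t) * a) +i* ((1 - t) * b).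
have dline (c t : R) : is_derive t (1:R) (fun t : R => (1 - t) * c) (- c).
  have Hd : is_derive (-1 * t + 1) (1:R) (fun y => y * c) c.
    apply: (is_derive_eq (is_deriveM (is_derive_id _ _) (is_derive_cst c _ _))).
    by rewrite scaler0 add0r /GRing.scale /= mulr1.
  have := is_derive_affine Hd; rewrite mulN1r.
  have -> // : (fun x => (-1 * x + 1) * c) = (fun t : R => (1 - t) * c).
  by apply/funext => x; ring.
have dlineE (c : R) : derive1 (fun t : R => (1 - t) * c) = cst (- c).
  by apply/funext => t; rewrite derive1E; case: (dline c t).
have path : C1_path (@unit_disk R) z 0 g.
  split=> [||t _|].
  - by rewrite /g subr0 subrr !mul1r !mul0r; split=> //; rewrite /a /b; case: (z).
  - move=> t; rewrite in_itv /= => /andP[t0 t1]; apply/unit_diskE.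
    have -> : g t = (1 - t)%:C * z by apply: complex_eq; rewrite ?Re_mul ?Im_mul /=; ring.
    rewrite cabsM cabs_real ger0_norm ?subr_ge0//; apply: le_lt_trans z1.
    by rewrite ler_piMl ?cabs_ge0// lerBlDr lerDl.
  - by split; [case: (dline a t)|case: (dline b t)].
  - by rewrite /= !dlineE; split; apply: continuous_subspaceT; exact: cst_continuous.
apply: (@le_trans _ _ (hyperbolic_length g)); first by apply: ereal_inf_lbound; exists g.
rewrite /hyperbolic_length /= !dlineE /=.
have den (t : R) : 0 <= t <= 1 -> 0 < 1 - (1 - t) * r.
  by move=> /andP[t0 t1]; nra.
pose k (t : R) := 2 * r / (1 - (1 - t) * r).
have ck : {within `[0%R, 1%R], continuous k}.
  apply: continuous_in_subspaceT => t /set_mem /=; rewrite in_itv /= => t01.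
  apply: (@continuousM R R (cst (2 * r)) (fun t => (1 - (1 - t) * r)^-1)).
    exact: cst_continuous.
  apply: (@continuousV R R (fun t => 1 - (1 - t) * r)); first by rewrite gt_eqF// den.
  apply: (@continuousB R R R (cst 1) (fun t => (1 - t) * r)); first exact: cst_continuous.
  exact: is_derive_continuous (dline r t).
apply: (@le_trans _ _ (\int[mu]_(t in `[0%R, 1%R]) (k t)%:E)%E).
  have kge (t : R) : 0 <= t <= 1 -> 0 <= 2 * Num.sqrt ((- a) ^+ 2 + (- b) ^+ 2) /
      (1 - (((1 - t) * a) ^+ 2 + ((1 - t) * b) ^+ 2)) <= k t.
    move=> t01; have /andP[t0 t1] := t01.
    have -> : Num.sqrt ((- a) ^+ 2 + (- b) ^+ 2) = r by rewrite !sqrrN -rE sqrtr_sqr ger0_norm.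
    have -> : ((1 - t) * a) ^+ 2 + ((1 - t) * b) ^+ 2 = ((1 - t) * r) ^+ 2.
      by rewrite !exprMn rE mulrDr.
    have d1 := den t t01.
    have s0 : 0 <= (1 - t) * r by rewrite mulr_ge0// subr_ge0.
    have s1 : ((1 - t) * r) ^+ 2 <= (1 - t) * r by nra.
    have d2 : 0 < 1 - ((1 - t) * r) ^+ 2 by lra.
    apply/andP; split; first by rewrite divr_ge0 ?mulr_ge0// ltW.
    by rewrite ler_wpM2l ?mulr_ge0// lef_pV2 ?posrE//; lra.
  apply: ge0_le_integral => //.
  - by move=> t /=; rewrite in_itv /= lee_fin => /kge /andP[].
  - apply/measurable_EFinP; apply: subspace_continuous_measurable_fun => //.
    apply: continuous_in_subspaceT => t /set_mem /=; rewrite in_itv /= => t01.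
    apply: (@continuousM R R (cst (2 * Num.sqrt ((- a) ^+ 2 + (- b) ^+ 2)))
      (fun t => (1 - (((1 - t) * a) ^+ 2 + ((1 - t) * b) ^+ 2))^-1)).
      exact: cst_continuous.
    apply: (@continuousV R R (fun t => 1 - (((1 - t) * a) ^+ 2 + ((1 - t) * b) ^+ 2))).
      have := den t t01; have /andP[t0 t1] := t01; move=> d1.
      have -> : ((1 - t) * a) ^+ 2 + ((1 - t) * b) ^+ 2 = ((1 - t) * r) ^+ 2.
        by rewrite !exprMn rE mulrDr.
      have s0 : 0 <= (1 - t) * r by rewrite mulr_ge0// subr_ge0.
      by rewrite gt_eqF//; nra.
    apply: (@continuousB R R R (cst 1)
      (fun t => ((1 - t) * a) ^+ 2 + ((1 - t) * b) ^+ 2)); first exact: cst_continuous.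
    have cX (c : R) : {for t, continuous (fun t : R => ((1 - t) * c) ^+ 2)}.
      have cc := is_derive_continuous (dline c t).
      exact: (@continuousM R R (fun t => (1 - t) * c) (fun t => (1 - t) * c) t cc cc).
    exact: (@continuousD R R R (fun t => ((1 - t) * a) ^+ 2) (fun t => ((1 - t) * b) ^+ 2)).
  - by apply/measurable_EFinP; apply: subspace_continuous_measurable_fun.
  - by move=> t /=; rewrite in_itv /= lee_fin => /kge /andP[].
pose F (t : R) := 2 * ln (1 - (1 - t) * r).
have dF (t : R) : 0 <= t <= 1 -> is_derive t (1:R) F (k t).
  move=> t01; have d0 := den t t01.
  have dd : is_derive t (1:R) (fun t : R => 1 - (1 - t) * r) r.
    apply: (is_derive_eq (is_deriveB (is_derive_cst (1:R) t (1:R)) (dline r t))).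
    by rewrite sub0r opprK.
  have H := is_deriveZ (2:R)
    (@is_derive1_comp R (@ln R) (fun t : R => 1 - (1 - t) * r) t _ _ (is_derive1_ln d0) dd).
  have -> : k t = 2 *: ((1 - (1 - t) * r)^-1 * r).
    by rewrite /k /GRing.scale /= mulrA mulrAC.
  exact: H.
rewrite (@continuous_FTC2 R k F 0 1 ltr01 ck).
- rewrite /F subrr mul0r !subr0 mul1r ln1 mulr0 -EFinB lee_fin; lra.
- split=> [t||].
  + by rewrite in_itv /= => /andP[t0 t1]; case: (dF t); rewrite ?ltW.
  + apply: cvg_at_right_filter; apply: (is_derive_continuous (dF 0 _)).
    by rewrite lexx ler01.
  + apply: cvg_at_left_filter; apply: (is_derive_continuous (dF 1 _)).
    by rewrite lexx ler01.
- move=> t; rewrite in_itv /= => /andP[t0 t1]; rewrite derive1E.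
  by case: (dF t); rewrite ?ltW.
Qed.

End HyperbolicBound.

(** * Coordinates in a band *)

Section Strip.
Variable R : realType.
Implicit Types (z w t : R[i]).

Let sin_le (y : R) : 0 <= y -> sin y <= y.
Proof.
move=> y0; have [->|y1] := eqVneq y 0; first by rewrite sin0.
have {y1 y0} y0 : 0 < y by rewrite lt_neqAle eq_sym y1.
have [|c /= _ E] := MVT y0 (fun s _ => is_derive_sin s).
  by apply: continuous_subspaceT => s; exact: continuous_sin.
move: E; rewrite sin0 !subr0 => ->; rewrite ler_piMl ?(ltW y0)//.
Qed.

(** On [[0, 1]] the cosine is at least [1 / 2], so that [sin y >= y / 2]; from
    [1] to [pi / 2] the sine does not decrease. *)
Lemma sin_ge_quarter (y : R) : 0 <= y -> y <= pi / 2 -> y / 4 <= sin y.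
Proof.
move=> y0 yp; have p2 := pihalf_lt2 R.
have cos_ge (x : R) : 0 <= x -> x <= 1 -> 2^-1 <= cos x.
  move=> x0 x1; have -> : x = x / 2 *+ 2 by rewrite -mulr_natr; field.
  rewrite cos_mulr2n cos2sin2.
  have s1 : sin (x / 2) <= x / 2 by apply: sin_le; lra.
  have s0 : 0 <= sin (x / 2).
    have [->|xn0] := eqVneq x 0; first by rewrite mul0r sin0.
    have {xn0} x0' : 0 < x by rewrite lt_neqAle eq_sym xn0.
    by apply/ltW/sin2_gt0; apply/andP; split; lra.
  have s2 : sin (x / 2) ^+ 2 <= 4^-1.
    have -> : 4^-1 = 2^-1 ^+ 2 :> R by field.
    by rewrite ler_pXn2r ?nnegrE//; lra.
  move: (sin (x / 2) ^+ 2) s2 => s s2.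
  have -> : (1 - s) *+ 2 = 2 - 2 * s by ring.
  lra.
have small (x : R) : 0 <= x -> x <= 1 -> x / 2 <= sin x.
  move=> x0 x1; have [->|xn0] := eqVneq x 0; first by rewrite sin0 mul0r.
  have {xn0} x0' : 0 < x by rewrite lt_neqAle eq_sym xn0.
  have [|c /= cx E] := MVT x0' (fun s _ => is_derive_sin s).
    by apply: continuous_subspaceT => s; exact: continuous_sin.
  move: cx; rewrite in_itv /= => /andP[c0 cx]; move: E; rewrite sin0 !subr0 => ->.
  rewrite mulrC ler_wpM2r//; apply: cos_ge; lra.
have [y1|y1] := leP y 1; first by have := small y y0 y1; lra.
have [|c /= cx E] := MVT y1 (fun s _ => is_derive_sin s).
  by apply: continuous_subspaceT => s; exact: continuous_sin.
move: cx; rewrite in_itv /= => /andP[c1 cy].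
have cc : 0 <= cos c by apply/ltW/cos_gt0_pihalf; apply/andP; split; lra.
have := small 1 ler01 (lexx _); have : 0 <= cos c * (y - 1) by rewrite mulr_ge0// subr_ge0 ltW.
rewrite -E; lra.
Qed.

Definition band t := `|complex.Im t| < pi / 2.

Lemma Re_cexp_gt0 t : band t -> 0 < complex.Re (cexp t).
Proof.
rewrite /band ltr_norml => tb.
by rewrite /= mulr_gt0 ?expR_gt0// cos_gt0_pihalf.
Qed.

(** The corridor in the coordinate [t] with [cexp t = (1 + z) / (1 - z)], hence
    [cayley z = 1 + cexp t]. *)
Definition strip_map t : R[i] := spiral ((expR 4)%:C + Log (1 + cexp t)).

(** With [m = (1 + z) / (1 - z)], the identity
    [1 - |z| ^+ 2 = 4 * Re m / |1 + m| ^+ 2] turns the distance to the circle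
    into a function of [t = Log m]. *)
Lemma disk_map_strip z : cabs z < 1 -> exists t, [/\ band t, disk_map z = strip_map t &
  expR (- `|complex.Re t|) * cos (complex.Im t) / 2 <= 1 - cabs z].
Proof.
move=> z1.
have zn1 : z != 1 by apply/eqP => E; move: z1; rewrite E cabs1 ltxx.
have n0 : 1 - z != 0 by rewrite subr_eq0 eq_sym.
have c0 : 0 < cabs (1 - z) by rewrite cabs_gt0.
pose m := (1 + z) / (1 - z).
have cay : cayley z = 1 + m by rewrite /cayley /m; field.
have zm : 1 - cabs z ^+ 2 = 4 * complex.Re m / cabs (1 + m) ^+ 2.
  have -> : complex.Re m = (1 - cabs z ^+ 2) / cabs (1 - z) ^+ 2.
    have D : cabs (1 - z) ^+ 2 != 0 by rewrite gt_eqF// exprn_gt0.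
    move: D; rewrite /m Re_mul Re_inv Im_inv !cabs_sqr !Re_add !Im_add !Re_opp !Im_opp /=.
    move: (complex.Re z) (complex.Im z) => a b; rewrite add0r => D.
    by field.
  rewrite -cay /cayley cabsM cabsV cabs_two; field; rewrite gt_eqF//.
have z2 : cabs z ^+ 2 < 1 by rewrite expr_lt1// cabs_ge0.
have cm0 : 0 < cabs (1 + m).
  by rewrite -cay /cayley cabsM cabsV cabs_two divr_gt0.
have rm0 : 0 < complex.Re m.
  have : 0 < 4 * complex.Re m / cabs (1 + m) ^+ 2 by rewrite -zm subr_gt0.
  by rewrite pmulr_lgt0 ?invr_gt0 ?exprn_gt0// pmulr_rgt0.
pose t := Log m; have et : cexp t = m := cexp_Log rm0.
exists t; split.
- exact: Im_Log_lt.
- by rewrite /disk_map (negPf zn1) /strip_map et -cay.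
have h1 : (1 - cabs z ^+ 2) / 2 <= 1 - cabs z.
  by have := cabs_ge0 z; nra.
apply: le_trans h1; rewrite zm.
have -> : complex.Re m = expR (complex.Re t) * cos (complex.Im t) by rewrite -et.
have ct : 0 < cos (complex.Im t).
  by apply: cos_gt0_pihalf; have := Im_Log_lt m; rewrite ltr_norml.
have am : cabs m = expR (complex.Re t) by rewrite -et cabs_cexp.
have h2 : cabs (1 + m) ^+ 2 * expR (- `|complex.Re t|) <= 4 * expR (complex.Re t).
  have h3 : cabs (1 + m) <= 1 + expR (complex.Re t) by rewrite -am -(@cabs1 R) cabsD.
  set s := complex.Re t in h3 *.
  have es := expR_gt0 s; have esn := expR_gt0 (- `|s|).
  apply: (@le_trans _ _ ((1 + expR s) ^+ 2 * expR (- `|s|))).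
    by rewrite ler_pM2r// ler_sqr ?nnegrE ?cabs_ge0// addr_ge0// ltW.
  have [s0|s0] := leP 0 s.
    have e1 : 1 <= expR s by rewrite -expR0 ler_expR.
    rewrite ger0_norm// expRN ler_pdivrMr//; nra.
  have e1 : expR s <= 1 by rewrite -expR0 ler_expR ltW.
  rewrite ltr0_norm// opprK; nra.
rewrite !mulrA; rewrite ler_pM2r ?invr_gt0//.
have -> : 4 * expR (complex.Re t) * cos (complex.Im t) / cabs (1 + m) ^+ 2 =
   4 * expR (complex.Re t) / cabs (1 + m) ^+ 2 * cos (complex.Im t) by ring.
by rewrite ler_pM2r// ler_pdivlMr ?exprn_gt0// mulrC.
Qed.

(** A bound for the derivative of [strip_map] at distance [x] from the imaginary
    axis; up to a constant, the width of the corridor there *)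
Definition width (x : R) : R := 5 / 2 / (ln (expR 4 + x) * (expR 4 + x)).

Let T16 : 16 <= expR 4 :> R.
Proof. by apply: le_trans (expR_ge_affine (lexx 4)); lra. Qed.

Lemma ln_shift_ge4 (x : R) : 0 <= x -> 4 <= ln (expR 4 + x).
Proof.
move=> x0; rewrite -[leLHS]expRK ler_ln ?posrE ?expR_gt0 ?lerDl//.
by rewrite ltr_pwDl ?expR_gt0.
Qed.

Lemma width_ge0 x : 0 <= x -> 0 <= width x.
Proof.
move=> x0; rewrite divr_ge0// mulr_ge0//; last by have := T16; lra.
by have := ln_shift_ge4 x0; lra.
Qed.

Lemma width_le x y : 0 <= x -> x <= y -> width y <= width x.
Proof.
move=> x0 xy; have T := T16; have lx := ln_shift_ge4 x0.
have ly : ln (expR 4 + x) <= ln (expR 4 + y).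
  by rewrite ler_ln ?posrE; lra.
have d0 : 0 < ln (expR 4 + x) * (expR 4 + x) by rewrite mulr_gt0//; lra.
rewrite ler_wpM2l ?divr_ge0// lef_pV2 ?posrE//.
  by rewrite ler_pM//; lra.
by rewrite mulr_gt0//; lra.
Qed.

(** The derivative of [spiral] at [L] is of order [1 / (|L| * |Log L|)].  To the
    right, [L] has modulus at least [expR 4 + Re t].  To the left, [L] stays
    bounded below and the factor [cexp t / (1 + cexp t)] decays exponentially in
    [|Re t|], faster than [width]. *)
Lemma cderiv_strip_map t : band t ->
  exists2 d, cderiv strip_map t d & cabs d <= width `|complex.Re t|.
Proof.
move=> tb; have r0 := Re_cexp_gt0 tb; set w := cexp t in r0.
have rw1 : 1 <= complex.Re (1 + w) by rewrite Re_add /= lerDl ltW.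
have rw0 : 0 < complex.Re (1 + w) by apply: lt_le_trans rw1.
have cw1 : 1 <= cabs (1 + w) by apply: le_trans rw1 (le_trans (ler_norm _) (Re_le_cabs _)).
have cw : 0 < cabs (1 + w) by apply: lt_le_trans cw1.
have aw : cabs w = expR (complex.Re t) by rewrite cabs_cexp.
have cww : cabs w <= cabs (1 + w).
  rewrite -(@ler_pXn2r _ 2) ?nnegrE ?cabs_ge0// !cabs_sqr Re_add Im_add add0r.
  rewrite -[complex.Re 1]/(1 : R).
  by rewrite lerD2r; nra.
set L := (expR 4)%:C + Log (1 + w).
have HL : half_strip L.
  split; first by rewrite /L Re_add /= lerDl ln_ge0.
  rewrite /L Im_add [complex.Im (_%:C)]/= add0r.
  by apply: ltW; apply: lt_trans (Im_Log_lt _) (pihalf_lt2 R).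
have d1 := cderivD (cderiv_cst 1 t) (cderiv_cexp t).
have d2 := cderivD (cderiv_cst (expR 4)%:C t) (cderiv_comp d1 (cderiv_Log rw0)).
have d3 := cderiv_comp d2 (cderiv_spiral HL).
eexists; first exact: d3.
rewrite !add0r cabsM -/w -/L; apply: (@le_trans _ _
  (5 / 2 / (cabs (Log L) * cabs L) * (cabs w / cabs (1 + w)))).
  rewrite ler_pM ?cabs_ge0 ?spiral_deriv_le// cabsM cabsV mulrC//.
have ReL : expR 4 + ln (cabs (1 + w)) <= cabs L.
  by apply: le_trans (Re_le_cabs L); apply: le_trans (ler_norm _); rewrite /L Re_add.
have cL := half_strip_cabs_gt0 HL.
have LL : ln (cabs L) <= cabs (Log L).
  by apply: le_trans (Re_le_cabs _); exact: ler_norm.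
have T := T16.
have ll := half_strip_cabs_Log HL.
move: (complex.Re t) aw => s aw.
have [s0|s0] := leP 0 s.
  have sL : expR 4 + s <= cabs L.
    apply: le_trans ReL; rewrite lerD2l -[leLHS]expRK ler_ln ?posrE ?expR_gt0//.
    by rewrite -aw.
  have lL : ln (expR 4 + s) <= cabs (Log L).
    by apply: le_trans LL; rewrite ler_ln ?posrE//; lra.
  have l4 := ln_shift_ge4 s0.
  have p0 : 0 < ln (expR 4 + s) * (expR 4 + s) by rewrite mulr_gt0//; lra.
  have pT : 0 < expR 4 + s by lra.
  have pl : 0 < ln (expR 4 + s) by lra.
  have pp : 0 < cabs (Log L) * cabs L by rewrite mulr_gt0//; lra.
  rewrite (ger0_norm s0) /width -[leRHS]mulr1; apply: ler_pM.
  - by rewrite divr_ge0// mulr_ge0 ?cabs_ge0.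
  - by rewrite divr_ge0 ?cabs_ge0.
  - rewrite ler_wpM2l ?divr_ge0// lef_pV2 ?posrE//.
    by apply: ler_pM => //; apply: ltW.
  - by rewrite ler_pdivrMr// mul1r.
rewrite /width; set x := - s; have x0 : 0 < x by rewrite oppr_gt0.
have l4 := ln_shift_ge4 (ltW x0).
have TL : expR 4 <= cabs L.
  by apply: le_trans ReL; rewrite lerDl ln_ge0.
have ew : cabs w / cabs (1 + w) <= expR (- x).
  rewrite /x opprK -aw ler_pdivrMr// ler_peMr ?cabs_ge0//.
have lx : ln (expR 4 + x) <= 4 * expR (x / 2).
  have h0 : 1 + x / 2 <= expR (x / 2) := expR_ge1Dx _.
  have h : ln (expR 4 + x) <= 4 + x / expR 4.
    have -> : expR 4 + x = expR 4 * (1 + x / expR 4) by field; rewrite gt_eqF ?expR_gt0.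
    have q0 : 0 < 1 + x / expR 4 by rewrite ltr_pwDl// divr_ge0 ?expR_ge0// ltW.
    rewrite lnM ?posrE ?expR_gt0// expRK lerD2l; apply: le_ln1Dx.
    by rewrite (lt_le_trans _ (divr_ge0 (ltW x0) (expR_ge0 4))).
  have : x / expR 4 <= x.
    by rewrite ler_pdivrMr ?expR_gt0// ler_peMr; move: x0 T; clear; lra.
  by move: x0 h0 h; clear; lra.
have Tx : expR 4 + x <= expR 4 * expR (x / 2).
  have h0 : 1 + x / 2 <= expR (x / 2) := expR_ge1Dx _.
  nra.
have exx : expR (- x) = (expR (x / 2) * expR (x / 2))^-1.
  by rewrite -expRD expRN; congr (expR _)^-1; field.
have ex0 := expR_gt0 (x / 2).
apply: (@le_trans _ _ (5 / 2 / (4 * expR 4) * (expR (x / 2) * expR (x / 2))^-1)).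
  apply: ler_pM.
  - by rewrite divr_ge0// mulr_ge0 ?cabs_ge0.
  - by rewrite divr_ge0 ?cabs_ge0.
  - rewrite ler_wpM2l ?divr_ge0// lef_pV2 ?posrE ?mulr_gt0 ?expR_gt0//; last lra.
    by rewrite ler_pM// expR_ge0.
  - by rewrite -exx.
rewrite ltr0_norm// -/x -mulrA -invfM ler_wpM2l ?divr_ge0// lef_pV2 ?posrE; last 2 first.
- by rewrite !mulr_gt0 ?expR_gt0.
- by rewrite mulr_gt0//; move: l4 T x0; clear; lra.
have -> : 4 * expR 4 * (expR (x / 2) * expR (x / 2)) =
  (4 * expR (x / 2)) * (expR 4 * expR (x / 2)) by ring.
by rewrite ler_pM//; move: l4 T x0; clear; lra.
Qed.

(** Points on the same side of the imaginary axis are joined by a segment that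
    stays at distance at least [x] from that axis. *)
Lemma strip_map_lipschitz t t' (x : R) (sg : bool) : 0 <= x -> band t -> band t' ->
  x <= (-1) ^+ sg * complex.Re t -> x <= (-1) ^+ sg * complex.Re t' ->
  cabs (strip_map t - strip_map t') <= width x * cabs (t - t').
Proof.
move=> x0 tb tb' xt xt'; apply: cderiv_mean_value; first exact: width_ge0.
move=> l /andP[l0 l1]; set c := t' + _.
have cR : complex.Re c = (1 - l) * complex.Re t' + l * complex.Re t.
  by rewrite /c Re_add Re_mul /= Re_add Re_opp; ring.
have cI : complex.Im c = (1 - l) * complex.Im t' + l * complex.Im t.
  by rewrite /c Im_add Im_mul /= Im_add Im_opp; ring.
have cb : band c.
  move: tb tb'; rewrite /band !ltr_norml cI.
  move: (pi / 2) (complex.Im t) (complex.Im t') => p a b /andP[? ?] /andP[? ?].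
  have [ab|ab] := leP a b.
    have : 0 <= (1 - l) * (b - a) by rewrite mulr_ge0; lra.
    have : 0 <= l * (b - a) by rewrite mulr_ge0; lra.
    by move=> ? ?; apply/andP; split; lra.
  have : 0 <= (1 - l) * (a - b) by rewrite mulr_ge0; lra.
  have : 0 <= l * (a - b) by rewrite mulr_ge0; lra.
  by move=> ? ?; apply/andP; split; lra.
have xc : x <= `|complex.Re c|.
  apply: (@le_trans _ _ ((-1) ^+ sg * complex.Re c)).
    rewrite cR mulrDr !(mulrCA ((-1) ^+ sg)).
    have : 0 <= (1 - l) * ((-1) ^+ sg * complex.Re t' - x) by rewrite mulr_ge0; lra.
    have : 0 <= l * ((-1) ^+ sg * complex.Re t - x) by rewrite mulr_ge0; lra.
    lra.
  by apply: le_trans (ler_norm _) _; rewrite normrM normrX normrN1 expr1n mul1r.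
have [d Hd dle] := cderiv_strip_map cb; exists d => //.
by apply: le_trans dle (width_le x0 xc).
Qed.

End Strip.

(** * A majorant of finite integral *)

Section LowerIntegral.
Local Open Scope ereal_scope.

(** The integral of a nonnegative function is a supremum over the simple
    functions below it, so that it is monotone even where [f] is not measurable;
    this spares a proof that the hyperbolic distance is. *)
Lemma le_integral_majorant d (T : measurableType d) (R : realType)
    (mu : {measure set T -> \bar R}) (D : set T) (f h : T -> \bar R) :
  (forall x, 0 <= h x) -> (forall x, D x -> f x <= h x) ->
  \int[mu]_(x in D) f x <= \int[mu]_x h x.
Proof.
move=> h0 fh; rewrite integralE.
apply: (@le_trans _ _ (\int[mu]_(x in D) f^\+ x)).
  by rewrite -[leRHS]adde0 leeD2l// oppe_le0 integral_ge0.
rewrite ge0_integralE// ge0_integralTE//; apply: le_ereal_sup => _ /= [g gf <-].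
exists g => // x; apply: (le_trans (gf x)); rewrite patchE; case: ifPn => [|_] //.
by rewrite inE => Dx; rewrite funeposE ge_max fh//= h0.
Qed.

Lemma nneseries_le (R : realType) (u : nat -> \bar R) (C : \bar R) :
  (forall n, 0 <= u n) -> (forall N, \sum_(0 <= n < N) u n <= C) ->
  \sum_(n <oo) u n <= C.
Proof.
move=> u0 uC; apply: lime_le; first by apply: is_cvg_nneseries => n _ _; exact: u0.
by apply: nearW => N; exact: uC.
Qed.

Lemma nneseries_telescope (R : realType) (u a : nat -> R) :
  (forall n, 0 <= u n)%R -> (forall n, 0 <= a n)%R ->
  (forall n, u n <= a n - a n.+1)%R ->
  \sum_(n <oo) (u n)%:E <= (a 0%N)%:E.
Proof.
move=> u0 a0 ua; apply: nneseries_le => [n|N]; first by rewrite lee_fin.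
rewrite sumEFin lee_fin; apply: (@le_trans _ _ (a 0%N - a N)%R).
  elim: N => [|N IH]; first by rewrite big_geq// subrr.
  rewrite big_nat_recr//=; have := ua N; lra.
by rewrite gerBl.
Qed.

Lemma le_nneseries_term (R : realType) (u : nat -> \bar R) n :
  (forall n, 0 <= u n) -> u n <= \sum_(n <oo) u n.
Proof.
move=> u0; apply: le_trans (nneseries_lim_ge n.+1 (fun k _ _ => u0 k)).
by rewrite big_nat_recr//= leeDr// sume_ge0.
Qed.

End LowerIntegral.

Section Majorant.
Variable R : realType.
Local Notation mu2 := (@plane_measure R).
Local Notation plane := (measurableTypeR R * measurableTypeR R)%type.
Implicit Types (z w t : R[i]).

Definition cell_index (k : nat) : finType := ('I_(2 ^ k) * (bool * bool))%type.

(** The cell of indices [n], [k] and [i] consists of the [t] with [|Re t|]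
    between [n + j / 2 ^+ k] and [n + (j + 1) / 2 ^+ k] and with
    [pi / 2 - |Im t|] between [1 / 2 ^+ k] and [2 / 2 ^+ k], where [j] is the
    first component of [i] and the two booleans are the signs of [Re t] and
    [Im t].  The point below is its corner closest to the imaginary axis and to
    the sides of the band. *)
Definition cell_center (n k : nat) (i : cell_index k) : R[i] :=
  ((-1) ^+ i.2.1 * (n%:R + (i.1 : nat)%:R / 2 ^+ k)) +i*
  ((-1) ^+ i.2.2 * (pi / 2 - (2 ^+ k)^-1)).

(** The diameter of a cell is at most [2 / 2 ^+ k], and [width n] is a Lipschitz
    constant. *)
Definition cell_radius (n k : nat) : R := 2 * width n%:R / 2 ^+ k.

Definition cell_box (n k : nat) (i : cell_index k) : set plane :=
  let c := strip_map (cell_center n i) in let r := cell_radius n k in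
  `[complex.Re c - r, complex.Re c + r]%classic `*`
  `[complex.Im c - r, complex.Im c + r]%classic.

(** A bound for the hyperbolic distance on the cell *)
Definition cell_weight (n k : nat) : R := 4 * (n%:R + 2) * (k%:R + 2).

Definition majorant (p : plane) : \bar R :=
  (\sum_(n <oo) \sum_(k <oo) \sum_(i : cell_index k)
    (cell_weight n k * \1_(cell_box n i) p)%:E)%E.

Lemma cell_radius_ge0 n k : 0 <= cell_radius n k.
Proof. by rewrite divr_ge0 ?exprn_ge0// mulr_ge0// width_ge0. Qed.

Lemma cell_weight_ge0 n k : 0 <= cell_weight n k.
Proof. by rewrite !mulr_ge0 ?addr_ge0. Qed.

Let term_ge0 n k (i : cell_index k) p :
  (0 <= (cell_weight n k * \1_(cell_box n i) p)%:E)%E.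
Proof. by rewrite lee_fin mulr_ge0 ?cell_weight_ge0// indicE ler0n. Qed.

Let measurable_cell n k (i : cell_index k) : measurable (cell_box n i).
Proof. exact: measurable_box. Qed.

Let measurable_term n k (i : cell_index k) : measurable_fun setT
  (fun p : plane => (cell_weight n k * \1_(cell_box n i) p)%:E).
Proof.
apply/measurable_EFinP; apply: measurable_funM; first exact: measurable_cst.
exact: measurable_indic.
Qed.

Let integral_term n k (i : cell_index k) :
  (\int[mu2]_p (cell_weight n k * \1_(cell_box n i) p)%:E =
   (cell_weight n k * (2 * cell_radius n k) ^+ 2)%:E)%E.
Proof.
under eq_integral do rewrite EFinM.
rewrite ge0_integralZl_EFin ?cell_weight_ge0//; last first.
  by apply/measurable_EFinP; exact: measurable_indic.
rewrite integral_indic// setIT [X in (_ * X)%E]plane_measure_box; last 2 first.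
- by have := cell_radius_ge0 n k; lra.
- by have := cell_radius_ge0 n k; lra.
by rewrite -EFinM; congr (_ * _)%:E; ring.
Qed.

Let sum_term n k : (\sum_(i : cell_index k)
    (cell_weight n k * (2 * cell_radius n k) ^+ 2)%:E =
  (256 * (n%:R + 2) * width n%:R ^+ 2 * ((k%:R + 2) / 2 ^+ k))%:E)%E.
Proof.
rewrite sumEFin sumr_const !card_prod card_ord !card_bool -[_ *+ _]mulr_natr.
rewrite /cell_weight /cell_radius !natrM natrX; congr (_%:E).
have : 2 ^+ k != 0 :> R by rewrite expf_neq0.
by move: (2 ^+ k) (width _) => u v u0; field.
Qed.

Let sum_k n : (\sum_(k <oo)
  (256 * (n%:R + 2) * width n%:R ^+ 2 * ((k%:R + 2) / 2 ^+ k))%:E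
  <= (6 * (256 * (n%:R + 2) * width n%:R ^+ 2))%:E :> \bar R)%E.
Proof.
have c0 : 0 <= 256 * (n%:R + 2) * width n%:R ^+ 2 :> R.
  by apply: mulr_ge0; [apply: mulr_ge0; [exact: ler0n|exact: addr_ge0]|exact: sqr_ge0].
pose a k : R := 256 * (n%:R + 2) * width n%:R ^+ 2 * (2 * (k%:R + 3) / 2 ^+ k).
have -> : 6 * (256 * (n%:R + 2) * width n%:R ^+ 2) = a 0%N.
  by rewrite /a expr0; field.
apply: nneseries_telescope => k.
- rewrite mulr_ge0// divr_ge0 ?addr_ge0 ?exprn_ge0.
- by rewrite /a mulr_ge0// divr_ge0 ?exprn_ge0// mulr_ge0 ?addr_ge0.
rewrite /a -mulrBr ler_wpM2l// exprS -(natr1 k).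
have : 2 ^+ k != 0 :> R by rewrite expf_neq0.
by move: (2 ^+ k) => u u0; rewrite le_eqVlt; apply/orP; left; apply/eqP; field.
Qed.

Let sum_n C : 0 <= C -> (\sum_(n <oo) (C * ((n%:R + 2) * width n%:R ^+ 2))%:E < +oo :> \bar R)%E.
Proof.
move=> C0.
pose T : R := expR 4; have T16 : 16 <= T.
  by apply: le_trans (expR_ge_affine (lexx 4)); lra.
pose a n : R := 25 / 4 * C / ln (T + n%:R - 1).
have l0 n : 0 < ln (T + n%:R - 1).
  by rewrite ln_gt0//; have : 0 <= n%:R :> R by []; lra.
apply: (@le_lt_trans _ _ (a 0%N)%:E); last exact: ltry.
apply: nneseries_telescope => n.
- by apply: mulr_ge0 => //; apply: mulr_ge0; [exact: addr_ge0|exact: sqr_ge0].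
- by apply: divr_ge0; [exact: mulr_ge0|exact: ltW].
rewrite /a /width -/T -(natr1 n).
have -> : T + (n%:R + 1) - 1 = T + n%:R by ring.
have n0 : 0 <= n%:R :> R by [].
have x2 : n%:R + 2 <= T + n%:R by lra.
have := l0 n; move: (T + n%:R) x2 => x x2; set l' := ln (x - 1) => l'0.
have x0 : 0 < x by lra.
have ll : x^-1 <= ln x - l'.
  have xi : x^-1 < 1 by rewrite invf_lt1//; lra.
  have : ln (1 + - x^-1) <= - x^-1 by apply: le_ln1Dx; rewrite ltrN2.
  have -> : 1 + - x^-1 = (x - 1) / x by field; lra.
  rewrite ln_div ?posrE//; last by lra.
  by rewrite -/l'; lra.
have xi0 : 0 < x^-1 by rewrite invr_gt0.
have l0' : l' < ln x by lra.
have lx : 0 < ln x by lra.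
have -> : (25 / 4 * C) / l' - (25 / 4 * C) / ln x = (25 / 4 * C) * (ln x - l') / (l' * ln x).
  by field; rewrite !gt_eqF.
have -> : C * ((n%:R + 2) * (5 / 2 / (ln x * x)) ^+ 2) =
   (25 / 4 * C) * ((n%:R + 2) / x ^+ 2) / (ln x * ln x).
  by field; rewrite !gt_eqF.
apply: ler_pM.
- by apply: mulr_ge0; [exact: mulr_ge0|rewrite divr_ge0 ?sqr_ge0//; lra].
- by rewrite invr_ge0 mulr_ge0// ltW.
- apply: ler_wpM2l; first exact: mulr_ge0.
  apply: le_trans ll.
  rewrite ler_pdivrMr ?exprn_gt0// expr2 mulKf ?gt_eqF//.
- rewrite lef_pV2 ?posrE ?mulr_gt0//; apply: ler_pM; lra.
Qed.

(** There are [4 * 2 ^+ k] cells of indices [n] and [k], with boxes of area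
    [16 * width n ^+ 2 / 4 ^+ k].  The sum over [k] telescopes with
    [(k + 3) / 2 ^+ k], and the sum over [n], of terms of order
    [1 / (n * ln n ^+ 2)], with [1 / ln (n - 1)]. *)
Lemma integral_majorant : (\int[mu2]_p majorant p < +oo)%E.
Proof.
rewrite /majorant integral_nneseries//; last 2 first.
- move=> n; apply: ge0_emeasurable_sum => [k p _ _|k].
    by rewrite sume_ge0.
  by move=> _; apply: emeasurable_sum => i; exact: measurable_term.
- by move=> n p _; apply: nneseries_ge0 => k _ _; rewrite sume_ge0.
have c0 : 0 <= 6 * 256 :> R by apply: mulr_ge0; exact: ler0n.
apply: le_lt_trans (sum_n c0); apply: lee_nneseries => [n _ _|n _].
  by apply: integral_ge0 => p _; apply: nneseries_ge0 => k _ _; rewrite sume_ge0.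
rewrite integral_nneseries//; last 2 first.
- by move=> k; apply: emeasurable_sum => i; exact: measurable_term.
- by move=> k p _; rewrite sume_ge0.
rewrite -mulrA [in leRHS](mulrA 256); apply: le_trans (sum_k n); apply: lee_nneseries => [k _ _|k _].
  by apply: integral_ge0 => p _; rewrite sume_ge0.
rewrite ge0_integral_sum//.
rewrite -(sum_term n k) le_eqVlt; apply/orP; left; apply/eqP.
by apply: eq_bigr => i _; exact: integral_term.
Qed.

Lemma majorant_ge0 p : (0 <= majorant p)%E.
Proof.
by apply: nneseries_ge0 => n _ _; apply: nneseries_ge0 => k _ _; rewrite sume_ge0.
Qed.

Lemma le_majorant n k (i : cell_index k) (p : plane) : cell_box n i p ->
  ((cell_weight n k)%:E <= majorant p)%E.
Proof.
move=> ip; pose G n k := (\sum_(i : cell_index k)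
    (cell_weight n k * \1_(cell_box n i) p)%:E)%E.
have G0 m l : (0 <= G m l)%E by rewrite sume_ge0.
apply: (@le_trans _ _ (\sum_(l <oo) G n l)%E); last first.
  apply: (@le_nneseries_term _ (fun m => \sum_(l <oo) G m l)%E) => m.
  by apply: nneseries_ge0 => l _ _.
apply: le_trans (le_nneseries_term k (G0 n)).
rewrite /G (bigD1 i)//= indicE mem_set// mulr1 leeDl// sume_ge0//.
Qed.

End Majorant.

(** * Finiteness of the hyperbolic integral *)

Section Cover.
Variable R : realType.
Implicit Types (z w t : R[i]).

Lemma dyadic_above (q : R) : 0 < q -> q < 2 ->
  exists k, (2 ^+ k)^-1 < q /\ q <= 2 / 2 ^+ k.
Proof.
move=> q0 q2.
have ex : exists k, (2 ^+ k)^-1 < q.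
  exists (Num.truncn q^-1).+1; rewrite invf_plt ?posrE ?exprn_gt0//.
  apply: lt_le_trans (truncnS_gt _) _.
  by rewrite -natrX ler_nat ltnW// ltn_expl.
case: (ex_minnP ex) => k kq kmin; exists k; split=> //.
case: k kq kmin => [|k] kq kmin; first by rewrite expr0 divr1 ltW.
rewrite exprS invfM mulrA divff// mul1r leNgt; apply/negP => qk.
by have := kmin k qk; rewrite ltnn.
Qed.

Lemma dyadic_floor (s : R) k : 0 <= s -> exists n (j : 'I_(2 ^ k)),
  [/\ n%:R + (j : nat)%:R / 2 ^+ k <= s,
     s < n%:R + (j : nat)%:R / 2 ^+ k + (2 ^+ k)^-1 & s < n%:R + 1].
Proof.
move=> s0; pose n := Num.truncn s; have /andP[ns sn] := truncn_itv s0.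
have K0 : 0 < 2 ^+ k :> R by rewrite exprn_gt0.
have f0 : 0 <= (s - n%:R) * 2 ^+ k by rewrite mulr_ge0 ?subr_ge0// ltW.
have /andP[jf fj] := truncn_itv f0.
have jk : (Num.truncn ((s - n%:R) * 2 ^+ k) < 2 ^ k)%N.
  rewrite -(ltr_nat R) natrX; apply: le_lt_trans jf _.
  rewrite -[ltRHS]mul1r ltr_pM2r// ltrBlDr addrC.
  by move: sn; rewrite -(natr1 (Num.truncn s)).
exists n, (Ordinal jk) => /=; move: jf fj; rewrite -(natr1 (Num.truncn (_ * _))).
move: (Num.truncn (_ * _))%:R K0 => j K0 jf fj; split; last by rewrite natr1.
  by rewrite -lerBrDl ler_pdivrMr.
by rewrite -[X in _ + X]mul1r -addrA -mulrDl -ltrBlDl ltr_pdivlMr.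
Qed.

Lemma box_mem w w' (r : R) : cabs (w - w') <= r ->
  (`[complex.Re w' - r, complex.Re w' + r]%classic `*`
   `[complex.Im w' - r, complex.Im w' + r]%classic) (complex.Re w, complex.Im w).
Proof.
move=> wr; have := le_trans (Re_le_cabs _) wr; have := le_trans (Im_le_cabs _) wr.
rewrite Re_add Im_add Re_opp Im_opp !ler_norml => /andP[? ?] /andP[? ?].
by split; rewrite /= in_itv /=; apply/andP; split; lra.
Qed.

(** On the cell [1 - |z|] is at least [expR (- |Re t|) * cos (Im t) / 2], and
    [cos (Im t)] is at least a quarter of the distance [pi / 2 - |Im t|] to the
    sides of the band. *)
Lemma cell_cover z : cabs z < 1 -> exists n k (i : cell_index k),
  cell_box n i (complex.Re (disk_map z), complex.Im (disk_map z)) /\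
  - 2 * ln (1 - cabs z) <= cell_weight R n k.
Proof.
move=> z1; have [t [tb -> zt]] := disk_map_strip z1.
have p2 := pihalf_lt2 R; have tb' := tb; rewrite /band in tb'.
pose q := pi / 2 - `|complex.Im t|.
have q0 : 0 < q by rewrite subr_gt0.
have q2 : q < 2 by have := normr_ge0 (complex.Im t); rewrite /q; lra.
have [k [kq qk]] := dyadic_above q0 q2.
have [n [j [js sj sn]]] := dyadic_floor k (normr_ge0 (complex.Re t)).
have K1 : 1 <= 2 ^+ k :> R by rewrite exprn_ege1// ler1n.
have K0 : 0 < 2 ^+ k :> R by lra.
have Ki0 : 0 < (2 ^+ k)^-1 :> R by rewrite invr_gt0.
have Ki1 : (2 ^+ k)^-1 <= 1 :> R by rewrite invf_le1.
pose i : cell_index k := (j, (complex.Re t < 0, complex.Im t < 0)).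
exists n, k, i; split.
  have p1 := pihalf_ge1 R.
  have cb : band (cell_center R n i).
    rewrite /band /= normrM normrX normrN1 expr1n mul1r ltr_norml; apply/andP; split; lra.
  have n0 : 0 <= n%:R :> R by [].
  have j0 : 0 <= (j : nat)%:R / 2 ^+ k :> R by rewrite divr_ge0// ltW.
  have sgs b x : (-1) ^+ b * ((-1) ^+ b * x) = x :> R by rewrite signrMK.
  have L : cabs (strip_map t - strip_map (cell_center R n i)) <=
           width n%:R * cabs (t - cell_center R n i).
    apply: (@strip_map_lipschitz _ _ _ _ (complex.Re t < 0)) => //.
      by rewrite -normrEsign; lra.
    by rewrite /= sgs lerDl.
  have D : cabs (t - cell_center R n i) <= 2 / 2 ^+ k.
    apply: le_trans (cabs_le_ReIm _) _; rewrite Re_add Im_add Re_opp Im_opp /=.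
    have sgB x y : `|x - (-1) ^+ (x < 0)%R * y| = `| `|x| - y| :> R.
      by rewrite {1}[x]numEsign -mulrBr normrM normrX normrN1 expr1n mul1r.
    rewrite !sgB [leRHS](_ : _ = (2 ^+ k)^-1 + (2 ^+ k)^-1); last by ring.
    by rewrite lerD// ler_norml; apply/andP; split;
      move: js sj qk kq; rewrite /q; clear; lra.
  have L2 : cabs (strip_map t - strip_map (cell_center R n i)) <= cell_radius R n k.
    apply: le_trans L _; rewrite /cell_radius [leRHS](_ : _ = width n%:R * (2 / 2 ^+ k)).
      by apply: ler_wpM2l D; exact: width_ge0.
    by field; rewrite gt_eqF.
  exact: box_mem.
have ct : (2 ^+ k)^-1 / 4 <= cos (complex.Im t).
  have -> : cos (complex.Im t) = sin q.
    rewrite /q sinB sin_pihalf cos_pihalf mul1r mul0r subr0.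
    by have [//|_] := ger0P (complex.Im t); rewrite cosN.
  apply: le_trans (sin_ge_quarter (ltW q0) _); first by lra.
  by have := normr_ge0 (complex.Im t); rewrite /q; lra.
have h : expR (- (n%:R + 1 + k%:R + 3)) <= 1 - cabs z.
  apply: le_trans zt.
  rewrite -addrA opprD expRD -mulrA; apply: ler_pM; rewrite ?expR_ge0//.
    by rewrite ler_expR lerN2 ltW.
  apply: (@le_trans _ _ ((2 ^+ k)^-1 / 4 / 2)); last by rewrite ler_pM2r.
  have e2 : 2 <= expR 1 :> R by apply: le_trans (expR_ge1Dx 1); lra.
  have e3 : 2 ^+ (k + 3) <= expR (k%:R + 3) :> R.
    have -> : k%:R + 3 = (k + 3)%:R * 1 :> R by rewrite mulr1 natrD.
    by rewrite expRM_natl lerXn2r ?nnegrE ?expR_ge0.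
  rewrite expRN -!invfM lef_pV2 ?posrE ?expR_gt0//.
  by apply: le_trans e3; rewrite exprD le_eqVlt; apply/orP; left; apply/eqP; ring.
have z0 : 0 < 1 - cabs z by rewrite subr_gt0.
have : - (n%:R + 1 + k%:R + 3) <= ln (1 - cabs z).
  by rewrite -[leLHS]expRK ler_ln ?posrE ?expR_gt0.
have n0 : 0 <= n%:R :> R by [].
have k0 : 0 <= k%:R :> R by [].
rewrite /cell_weight; have := mulr_ge0 n0 k0; lra.
Qed.

Lemma disk_map_conformal :
  conformal_bijection (@unit_disk R) (@disk_map R @` @unit_disk R) (@disk_map R).
Proof.
split=> [z /unit_diskE z1|].
  have [|a [b [Ha _ _ _]]] := @disk_map_derivs _ z.
    by split; [exact: ltW|apply/eqP => E; move: z1; rewrite E cabs1 ltxx].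
  exact: cderiv_derivable Ha.
split=> [z z1|z w|w [z z1 <-]]; [by exists z| |by exists z].
by rewrite !inE => /unit_diskE z1 /unit_diskE w1; apply: disk_map_inj; exact: ltW.
Qed.

Lemma hyperbolic_integral_finite :
  (\int[@plane_measure R]_(p in @toC R @^-1` (@disk_map R @` @unit_disk R))
     hyperbolic_dist (@disk_map R @` @unit_disk R) (toC p) (@disk_map R 0%R) < +oo)%E.
Proof.
apply: le_lt_trans (integral_majorant R).
apply: le_integral_majorant => [p|p [z /unit_diskE z1 zp]]; first exact: majorant_ge0.
have [n [k [i [zi hz]]]] := cell_cover z1.
apply: (@le_trans _ _ (cell_weight R n k)%:E); last first.
  by apply: (le_majorant (i := i)); move: zi; rewrite zp; case: (p).
apply: (@le_trans _ _ (hyperbolic_dist_disk (z : Cplx R) 0%R)); last first.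
  by apply: le_trans (hyperbolic_dist_disk_le z1) _; rewrite lee_fin.
apply: ereal_inf_lbound; exists (@disk_map R), z, 0; split=> //.
- exact: disk_map_conformal.
- by split; apply/unit_diskE; rewrite // cabs0.
Qed.

End Cover.

(** * The homeomorphism of the circle *)

Section BoundaryMap.
Variable R : realType.
Local Notation C := (Cplx R).
Implicit Types (z w : C) (m : R).

(** A homeomorphism of the line that grows exponentially at [+oo]; the term [m]
    makes it surjective. *)
Definition expshift m : R := m + expR m.

Lemma expshift_inj : injective expshift.
Proof.
suff mono x y : x < y -> expshift x < expshift y.
  move=> x y E; have [/mono|/mono|//] := ltgtP x y; by rewrite E ltxx.
by move=> xy; rewrite ltrD// ltr_expR.
Qed.

Lemma le_expshift x y : x <= y -> expshift x <= expshift y.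
Proof. by move=> xy; rewrite lerD// ler_expR. Qed.

Lemma continuous_expshift : continuous expshift.
Proof. by move=> x; apply: (@continuousD _ _ _ id expR); [exact: cvg_id|exact: continuous_expR]. Qed.

(** Properness, which gives continuity at the fixed point [1] of the
    circle. *)
Lemma expshift_norm m : `|m| - 1 <= `|expshift m|.
Proof.
have e0 := expR_gt0 m; rewrite /expshift.
have [m0|m0] := leP 0 m.
  by rewrite (ger0_norm m0) ger0_norm ?addr_ge0 ?expR_ge0//; lra.
have e1 : expR m <= 1 by rewrite -expR0 ler_expR ltW.
by have := ler_norm (- (m + expR m)); rewrite normrN (ltr0_norm m0); lra.
Qed.

Lemma expshift_surj (v : R) : exists m, expshift m = v.
Proof.
have vv := ler_norm v; have := ler_norm (- v); rewrite normrN => vn.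
have v0 := normr_ge0 v.
have le : - (`|v| + 1) <= `|v| + 1 by lra.
have [||m _ <-] := @IVT R expshift _ _ v le; last by exists m.
  by apply: continuous_subspaceT; exact: continuous_expshift.
have h1 := expR_ge0 (`|v| + 1).
have h2 : expR (- (`|v| + 1)) <= 1 by rewrite -[leRHS]expR0 ler_expR; lra.
by rewrite ge_min le_max /expshift; apply/andP; split; apply/orP; [left|right]; lra.
Qed.

(** One exponential more than the three that [depth_ge] consumes *)
Definition tower m : R := expshift (expshift (expshift (expshift m))).

Lemma tower_inj : injective tower.
Proof. by move=> x y /expshift_inj /expshift_inj /expshift_inj /expshift_inj. Qed.

Lemma tower_surj (v : R) : exists m, tower m = v.
Proof.
have [a <-] := expshift_surj v; have [b <-] := expshift_surj a.
have [c <-] := expshift_surj b; have [d <-] := expshift_surj c.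
by exists d.
Qed.

Lemma continuous_tower : continuous tower.
Proof.
have ce := continuous_expshift; move=> x.
have c2 := continuous_comp (ce x) (ce (expshift x)).
have c3 := continuous_comp c2 (ce _).
exact: continuous_comp c3 (ce _).
Qed.

Lemma tower_norm m : `|m| - 4 <= `|tower m|.
Proof.
rewrite /tower.
have := expshift_norm m; move: (expshift m) => a ha.
have := expshift_norm a; move: (expshift a) => b hb.
have := expshift_norm b; move: (expshift b) => c hc.
by have := expshift_norm c; lra.
Qed.

Lemma tower_ge m : 0 <= m -> expR (expR (expR (expR m))) <= tower m.
Proof.
move=> m0; have e1 x : 0 <= x -> expR x <= expshift x by rewrite /expshift => ?; rewrite lerDr.
have h2 x : 0 <= x -> expR (expR x) <= expshift (expshift x).
  by move=> x0; apply: le_trans (e1 _ (expR_ge0 x)) _; apply/le_expshift/e1.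
apply: le_trans (h2 _ (expR_ge0 _)) _; rewrite /tower; do 2! apply: le_expshift.
exact: h2.
Qed.

(** The stereographic parametrization of the circle without [1], the inverse of
    [m = Im (cayley z)] *)
Definition circle_point m : C := 1 - 2 / (1 +i* m).

Let line_neq0 m : (1 +i* m : R[i]) != 0.
Proof. by apply/eqP => -[/eqP]; rewrite oner_eq0. Qed.

Let two_neq0 : (2 : R[i]) != 0. Proof. by rewrite pnatr_eq0. Qed.

Lemma circle_point_neq1 m : circle_point m != 1.
Proof.
rewrite /circle_point -subr_eq0 addrAC subrr add0r oppr_eq0 mulf_neq0 ?invr_eq0//.
Qed.

Lemma circle_point_circle m : cabs (circle_point m) = 1.
Proof.
have -> : circle_point m = ((-1) +i* m) / (1 +i* m).
  rewrite /circle_point; have -> : ((-1) +i* m : R[i]) = (1 +i* m) - 2.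
    by apply: complex_eq; rewrite ?Re_add ?Im_add ?Re_opp ?Im_opp /=; ring.
  by field; exact: line_neq0.
rewrite cabsM cabsV; have -> : cabs ((-1) +i* m) = cabs (1 +i* m) :> R.
  by rewrite /cabs /= sqrrN.
by rewrite mulfV// cabs_eq0 line_neq0.
Qed.

Lemma cayley_circle_point m : cayley (circle_point m) = 1 +i* m.
Proof. by rewrite /cayley /circle_point subKr invf_div mulrC divfK. Qed.

Lemma circle_point_inj : injective circle_point.
Proof.
by move=> m m' /(congr1 (fun w => complex.Im (cayley w))); rewrite !cayley_circle_point.
Qed.

Lemma circle_pointK z : cabs z = 1 -> z != 1 -> circle_point (complex.Im (cayley z)) = z.
Proof.
move=> z1 zn1; have n0 : 1 - z != 0 by rewrite subr_eq0 eq_sym.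
have c0 : cabs (1 - z) ^+ 2 != 0 by rewrite expf_neq0// cabs_eq0.
have re : complex.Re (cayley z) = 1.
  have -> : cayley z = (2 : R)%:C * (1 - z)^-1 by rewrite rmorph_nat.
  rewrite Re_mul /= mul0r subr0 Re_inv mulrA.
  have E : cabs (1 - z) ^+ 2 = 2 * complex.Re (1 - z).
    have : cabs z ^+ 2 = 1 by rewrite z1 expr1n.
    by rewrite !cabs_sqr !Re_add !Im_add !Re_opp !Im_opp [complex.Re 1]/= [complex.Im 1]/=; lra.
  by rewrite -E mulfV.
transitivity (1 - 2 / cayley z).
  by rewrite /circle_point; move: re; case: (cayley z) => a b /= ->.
by rewrite /cayley invf_div mulrC divfK// subKr.
Qed.

Definition circle_homeo z : C :=
  if z == 1 then 1 else circle_point (tower (complex.Im (cayley z))).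

Lemma circle_homeo_circle z : cabs (circle_homeo z) = 1.
Proof. by rewrite /circle_homeo; case: eqP => _; [exact: cabs1|exact: circle_point_circle]. Qed.

Lemma circle_homeo_neq1 z : z != 1 -> circle_homeo z != 1.
Proof. by rewrite /circle_homeo => /negPf ->; exact: circle_point_neq1. Qed.

Lemma circle_homeo_image : circle_homeo @` @unit_circle R = @unit_circle R.
Proof.
apply/seteqP; split=> [_ [z _ <-]|w /unit_circleE w1].
  by apply/unit_circleE; exact: circle_homeo_circle.
have [->|wn1] := eqVneq w 1.
  by exists 1; [apply/unit_circleE; exact: cabs1|rewrite /circle_homeo eqxx].
have [m mw] := tower_surj (complex.Im (cayley w)).
exists (circle_point m); first by apply/unit_circleE; exact: circle_point_circle.
by rewrite /circle_homeo (negPf (circle_point_neq1 m)) cayley_circle_point mw circle_pointK.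
Qed.

Lemma circle_homeo_inj : {in @unit_circle R &, injective circle_homeo}.
Proof.
move=> z w /set_mem/unit_circleE z1 /set_mem/unit_circleE w1.
have [->|zn1] := eqVneq z 1; have [->|wn1] := eqVneq w 1; first by [].
- by rewrite {1}/circle_homeo eqxx => /esym/eqP; rewrite (negPf (circle_homeo_neq1 wn1)).
- by rewrite {2}/circle_homeo eqxx => /eqP; rewrite (negPf (circle_homeo_neq1 zn1)).
rewrite /circle_homeo (negPf zn1) (negPf wn1) => /circle_point_inj /tower_inj E.
by rewrite -(circle_pointK z1 zn1) E circle_pointK.
Qed.

Lemma continuous_circle_point : continuous circle_point.
Proof.
move=> m; apply: (@continuous_comp _ _ _ (fun m : R => 1 +i* m : C) (fun w : C => 1 - 2 * w^-1)).
  move=> A /cplx_nbhsP [e e0 HA]; apply/nbhs_ballP; exists e => // m' mm'.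
  apply: HA; have -> : (1 +i* m' : C) - (1 +i* m) = 0 +i* (m' - m).
    by apply: complex_eq; rewrite /= ?subrr.
  by apply: le_lt_trans (cabs_le_ReIm _) _; rewrite /= normr0 add0r distrC.
have d := cderivB (cderiv_cst 1 _) (cderivZ 2 (cderiv_inv (line_neq0 m))).
exact: cderiv_continuous_at d.
Qed.

Lemma circle_homeo_continuous : {within @unit_circle R, continuous circle_homeo}.
Proof.
apply/cplx_withinP => z /unit_circleE z1 e e0.
have [->|zn1] := eqVneq z 1; last first.
  have n0 : 1 - z != 0 by rewrite subr_eq0 eq_sym.
  have cay : {for z, continuous (@cayley R : C -> C)}.
    have d := cderivZ 2 (cderiv_comp (cderivB (cderiv_cst 1 z) (cderiv_id z)) (cderiv_inv n0)).
    exact: cderiv_continuous_at d.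
  have cF : {for z, continuous (fun w : C => circle_point (tower (complex.Im (cayley w))))}.
    apply: (@continuous_comp _ _ _ (fun w : C => tower (complex.Im (cayley w))) circle_point); last first.
      exact: continuous_circle_point.
    apply: (@continuous_comp _ _ _ (fun w : C => complex.Im (cayley w)) tower); last first.
      exact: continuous_tower.
    by apply: (@continuous_comp _ _ _ (@cayley R : C -> C) (@complex.Im R : C -> R)); last exact: continuous_Im.
  have [r r0 Hr] := (cplx_continuousP _ _).1 cF e e0.
  exists (Num.min r (cabs (1 - z))); first by rewrite lt_min r0 cabs_gt0.
  move=> w _; rewrite lt_min => /andP[wr wz].
  rewrite /circle_homeo (negPf zn1); case: (eqVneq w 1) => [w1|_]; last exact: Hr.
  by move: wz; rewrite w1 ltxx.
have d0 : 0 < 2 / e + 5 by rewrite ltr_wpDl// divr_ge0// ltW.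
exists (2 / (2 / e + 5)); first by rewrite divr_gt0.
move=> w /unit_circleE w1 wz; rewrite /circle_homeo eqxx.
case: (eqVneq w 1) => [_|wn1]; first by rewrite subrr cabs0.
have n0 : 1 - w != 0 by rewrite subr_eq0 eq_sym.
pose m := complex.Im (cayley w).
have cm : 2 / e + 5 < `|m| + 1.
  apply: (@lt_le_trans _ _ (cabs (cayley w))).
    rewrite /cayley cabsM cabsV cabs_two cabs_distC.
    rewrite ltr_pdivlMr ?cabs_gt0 1?subr_eq0// mulrC.
    by move: wz; rewrite ltr_pdivlMr.
  have -> : cayley w = 1 +i* m by rewrite -(cayley_circle_point m) circle_pointK.
  by apply: le_trans (cabs_le_ReIm _) _; rewrite /= normr1 addrC.
have tm := tower_norm m; rewrite -/m.
have s0 : 2 / e < `|tower m| by lra.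
have sp : 0 < `|tower m| by apply: le_lt_trans s0; rewrite divr_ge0// ltW.
rewrite /circle_point addrAC subrr add0r cabsN cabsM cabsV cabs_two.
have sl : `|tower m| <= cabs (1 +i* tower m : R[i]) := Im_le_cabs (1 +i* tower m).
rewrite ltr_pdivrMr; last by apply: lt_le_trans sl.
by move: s0; rewrite ltr_pdivrMr// => s0; apply: lt_le_trans s0 _; rewrite mulrC ler_pM2l.
Qed.

End BoundaryMap.

(** * The boundary map and its extensions *)

Section NoExtension.
Variable R : realType.
Local Notation C := (Cplx R).
Local Notation dmap := (@disk_map R : C -> C).
Implicit Types (z w : C).

(** The stereographic coordinate of the point of height [y] is [(1 + x) / y] with
    [x >= 1 / 2], and [expR m] is at least [(1 + m / 2) ^+ 2]. *)
Lemma depth_circle (y : R) : 0 < y < 2^-1 ->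
  y ^- 2 / 2 <= complex.Re (depth (circle_homeo (Num.sqrt (1 - y ^+ 2) +i* y))).
Proof.
move=> /andP[y0 y1]; set x := Num.sqrt _.
have yy : y ^+ 2 <= 4^-1.
  have -> : 4^-1 = 2^-1 ^+ 2 :> R by field.
  by rewrite ler_pXn2r ?nnegrE//; lra.
have xx : x ^+ 2 = 1 - y ^+ 2 by rewrite sqr_sqrtr//; lra.
have x0 : 0 <= x := sqrtr_ge0 _.
have x2 : 2^-1 <= x by rewrite leNgt; apply/negP => x2; nra.
have x1 : x < 1 by rewrite ltNge; apply/negP => x1; have := exprn_gt0 2 y0; nra.
pose z : C := x +i* y.
have z1 : cabs z = 1 by rewrite /cabs /= xx subrK sqrtr1.
have zn1 : z != 1 by apply/eqP => -[E]; move: x1; rewrite E ltxx.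
pose m := complex.Im (cayley z).
have mE : m = (1 + x) / y.
  rewrite /m; have -> : cayley z = (2 : R)%:C * (1 - z)^-1 by rewrite rmorph_nat.
  rewrite Im_mul [complex.Re (_%:C)]/= [complex.Im (_%:C)]/= mul0r addr0 Im_inv cabs_sqr Re_add Im_add Re_opp Im_opp /=.
  have -> : (1 - x) ^+ 2 + (0 - y) ^+ 2 = 2 * (1 - x).
    have -> : (1 - x) ^+ 2 + (0 - y) ^+ 2 = 1 - 2 * x + x ^+ 2 + y ^+ 2 by ring.
    by rewrite xx; ring.
  have n1 : 2 * (1 - x) != 0 by rewrite gt_eqF//; lra.
  have n2 : y != 0 by rewrite gt_eqF.
  rewrite sub0r opprK mulrA; apply/eqP; rewrite eqr_div//.
  apply/eqP; have -> : (1 + x) * (2 * (1 - x)) = 2 * (1 - x ^+ 2) by ring.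
  by rewrite xx; ring.
have m3 : 3 / 2 / y <= m by rewrite mE ler_pM2r ?invr_gt0//; lra.
have yi : 0 < y^-1 by rewrite invr_gt0.
have m0 : 0 <= m by lra.
apply: (@le_trans _ _ (expR m)).
  have -> : expR m = expR (m / 2) ^+ 2 by rewrite -expRM_natl; congr expR; field.
  have e1 : 1 + m / 2 <= expR (m / 2) := expR_ge1Dx _.
  have e2 : 3 / 4 * y^-1 <= expR (m / 2) by lra.
  apply: (@le_trans _ _ ((3 / 4 * y^-1) ^+ 2)).
    by rewrite exprMn -exprVn; have := exprn_gt0 2 yi; lra.
  by rewrite ler_pXn2r ?nnegrE ?expR_ge0//; lra.
apply: depth_ge.
  by split; [rewrite circle_homeo_circle|exact: circle_homeo_neq1].
rewrite /circle_homeo (negPf zn1) cayley_circle_point -/m.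
apply: le_trans (tower_ge m0) _; apply: le_trans (ler_norm _) _.
exact: (Im_le_cabs (1 +i* tower m)).
Qed.

Let disk_mapI : {in @closed_unit_disk R &, injective dmap}.
Proof.
move=> z w /set_mem/closed_unit_diskE z1 /set_mem/closed_unit_diskE w1.
exact: disk_map_inj.
Qed.

Let disk_map_deriv z : unit_disk z -> exists2 a : R[i], a != 0 & cderiv dmap z a.
Proof.
move=> /unit_diskE z1; have [|a [b [Ha a0 _ _]]] := @disk_map_derivs _ z; last by exists a.
by split; [exact: ltW|apply/eqP => E; move: z1; rewrite E cabs1 ltxx].
Qed.

Lemma disk_map_jordan : jordan_domain (dmap @` @unit_disk R).
Proof. exact: image_jordan_domain (@disk_map_continuous R) disk_mapI disk_map_deriv. Qed.

Lemma disk_map_boundary : boundary (dmap @` @unit_disk R) = dmap @` @unit_circle R.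
Proof. exact: image_boundary (@disk_map_continuous R) disk_mapI disk_map_deriv. Qed.

Lemma disk_map_closure : closure (dmap @` @unit_disk R) = dmap @` @closed_unit_disk R.
Proof. exact: image_closure (@disk_map_continuous R). Qed.

Definition boundary_map z : C := dmap (circle_homeo z).

Lemma boundary_map_homeomorphism :
  homeomorphism_on (@unit_circle R) (boundary (dmap @` @unit_disk R)) boundary_map.
Proof.
have homeo_closed z : @unit_circle R z -> @closed_unit_disk R (circle_homeo z).
  by move=> _; apply/closed_unit_diskE; rewrite circle_homeo_circle.
rewrite disk_map_boundary -{2}(@circle_homeo_image R) image_comp.
apply: compact_homeomorphism; first exact: compact_unit_circle.
  apply/cplx_withinP => z Cz e e0.
  have [r r0 Hr] := (cplx_withinP _ _).1 (@disk_map_continuous R) _ (homeo_closed z Cz) e e0.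
  have [r' r'0 Hr'] := (cplx_withinP _ _).1 (@circle_homeo_continuous R) z Cz r r0.
  exists r' => // w Cw wz; apply: Hr; [exact: homeo_closed|exact: Hr'].
move=> z w Cz Cw E; apply: (circle_homeo_inj Cz Cw).
have Dz : circle_homeo z \in @closed_unit_disk R by apply/mem_set/homeo_closed/set_mem.
have Dw : circle_homeo w \in @closed_unit_disk R by apply/mem_set/homeo_closed/set_mem.
exact: disk_mapI Dz Dw E.
Qed.

Variable Phi : C -> C.
Hypothesis homeo : homeomorphism_on (@closed_unit_disk R) (closure (dmap @` @unit_disk R)) Phi.
Hypothesis extends : {in @unit_circle R, Phi =1 boundary_map}.

Let K := dmap @` @closed_unit_disk R.

(** [Phi] read in the disk through the inverse of [disk_map], which is continuous
    up to the boundary by compactness *)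
Let pullback : exists2 Psi : C -> C, {within @closed_unit_disk R, continuous Psi} &
  forall z, closed_unit_disk z -> closed_unit_disk (Psi z) /\ dmap (Psi z) = Phi z.
Proof.
have [[PhiK _ _] cPhi _] := homeo.
have [_ _ [g [cg gK]]] := compact_homeomorphism (@compact_closed_unit_disk R)
  (@disk_map_continuous R) disk_mapI.
have PK z : closed_unit_disk z -> K (Phi z).
  by move=> /PhiK; rewrite disk_map_closure.
exists (g \o Phi); last first.
  move=> z /PK [w Dw E]; rewrite /= -E gK//; exact/mem_set.
apply/cplx_withinP => z Dz e e0.
have [r r0 Hr] := (cplx_withinP _ _).1 cg _ (PK z Dz) e e0.
have [r' r'0 Hr'] := (cplx_withinP _ _).1 cPhi z Dz r r0.
by exists r' => // w Dw wz; apply: Hr; [exact: PK|exact: Hr'].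
Qed.

Let Phi_continuous (p : R * R) : disk2 p -> {for p, continuous (fun q => Phi (toC q))}.
Proof.
move=> pD; have [_ cPhi _] := homeo.
have pD' : @unit_disk R (toC p) by have : (@toC R @^-1` @unit_disk R) p by rewrite preimage_unit_disk.
apply: (@continuous_comp _ _ _ (@toC R) Phi); first exact: continuous_toC.
have p1 : 0 < 1 - cabs (toC p) by rewrite subr_gt0; exact/unit_diskE.
apply/cplx_continuousP => e e0.
have [r r0 Hr] := (cplx_withinP _ _).1 cPhi _ (unit_disk_closed_disk pD') e e0.
exists (Num.min r (1 - cabs (toC p))); first by rewrite lt_min r0.
move=> w; rewrite lt_min => /andP[wr wp]; apply: Hr => //.
apply/closed_unit_diskE; have := cabs_sub_le w (toC p); lra.
Qed.

(** [Phi] takes the value [disk_map 1] only at [1], by injectivity, so that the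
    depth is defined and continuous on the closed disk without [1]. *)
Lemma no_W11_extension : W11 (@unit_disk R) Phi -> False.
Proof.
rewrite /W11 preimage_unit_disk => -[[iF1 /(_ (1, 0)) wF1] [iF2 /(_ (1, 0)) wF2]].
have [g1 ig1 wd1] := wF1 (or_introl erefl).
have [g2 ig2 wd2] := wF2 (or_introl erefl).
have [Psi cPsi PsiP] := pullback.
have Psi1 z : closed_unit_disk z -> z != 1 -> punctured (Psi z).
  move=> Dz zn1; have [/closed_unit_diskE Pz E] := PsiP z Dz; split=> //.
  apply/eqP => P1; move: zn1; apply/negP; rewrite negbK; apply/eqP.
  have D1 : @closed_unit_disk R 1 by apply/closed_unit_diskE; rewrite cabs1.
  have [[_ inj _] _ _] := homeo; apply: inj; [exact/mem_set|exact/mem_set|].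
  have C1 : (1 : C) \in @unit_circle R by apply/mem_set/unit_circleE; exact: cabs1.
  rewrite (extends C1).
  by rewrite -E P1 /boundary_map /circle_homeo eqxx.
pose Q z : R := complex.Re (depth (Psi z)).
have cQ z : closed_unit_disk z -> z != 1 -> forall e : R, 0 < e -> exists2 r : R, 0 < r &
    forall w, closed_unit_disk w -> cabs (w - z) < r -> `|Q w - Q z| < e.
  move=> Dz zn1 e e0; have [a [b [_ _ Hb _]]] := disk_map_derivs (Psi1 z Dz zn1).
  have [r r0 Hr] := cderiv_continuous Hb e0.
  have [r' r'0 Hr'] := (cplx_withinP _ _).1 cPsi z Dz r r0.
  exists r' => // w Dw wz; rewrite /Q -Re_opp -Re_add.
  apply: le_lt_trans (Re_le_cabs _) _; have := Hr (Psi w - Psi z) (Hr' w Dw wz).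
  by rewrite (addrC (Psi z)) subrK.
have disk2E x y : disk2 (x, y) -> @unit_disk R (x +i* y).
  by move=> H; have : (@toC R @^-1` @unit_disk R) (x, y) by rewrite preimage_unit_disk.
have disk_n1 z : unit_disk z -> z != 1.
  by move=> /unit_diskE z1; apply/eqP => E; move: z1; rewrite E cabs1 ltxx.
have Dcl z : unit_disk z -> closed_unit_disk z by exact: unit_disk_closed_disk.
have lip (p : R * R) : disk2 p -> exists2 r : R, 0 < r & forall x, `|x - p.1| < r ->
    `|Q (toC (x, p.2)) - Q (toC p)| <=
    3 * (`|complex.Re (Phi (toC (x, p.2))) - complex.Re (Phi (toC p))| +
         `|complex.Im (Phi (toC (x, p.2))) - complex.Im (Phi (toC p))|).
  case: p => p1 p2 pD /=; have zD := disk2E _ _ pD; rewrite /toC /=.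
  set z : C := p1 +i* p2 in zD *.
  have [r r0 Hr] := depth_control (Psi1 z (Dcl z zD) (disk_n1 z zD)).
  have [r' r'0 Hr'] := (cplx_withinP _ _).1 cPsi z (Dcl z zD) r r0.
  have z1 : 0 < 1 - cabs z by rewrite subr_gt0; exact/unit_diskE.
  exists (Num.min r' (1 - cabs z)); first by rewrite lt_min r'0.
  move=> x; rewrite lt_min => /andP[xr xz]; pose w : C := x +i* p2.
  have wz : cabs (w - z) <= `|x - p1|.
    by apply: le_trans (cabs_le_ReIm _) _; rewrite /= subrr normr0 addr0.
  have wD : @closed_unit_disk R w.
    apply/Dcl/unit_diskE; have := cabs_sub_le w z; lra.
  have H := Hr (Psi w - Psi z) (Hr' w wD (le_lt_trans wz xr)).
  rewrite -/w; move: H; rewrite (addrC (Psi z)) subrK (PsiP w wD).2 (PsiP z (Dcl z zD)).2 => H.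
  rewrite /Q -!Re_opp -!Re_add -!Im_opp -!Im_add.
  apply: le_trans (Re_le_cabs _) (le_trans H _).
  by rewrite ler_pM2l//; exact: cabs_le_ReIm.
have [Q0 HQ0] : exists Q0 : R, forall y : R, 0 < y < 2^-1 -> `|Q (toC (0, y))| <= Q0.
  have h0 : 0 <= 2^-1 :> R by [].
  have cseg : {within `[0, 2^-1]%classic, continuous (fun y : R => `|Q (toC (0, y))|)}.
    apply/subspace_continuousP => y; rewrite /= in_itv /= => /andP[y0 y1].
    have seg_disk (t : R) : - 2^-1 < t -> t < 1 -> @unit_disk R (0 +i* t).
      by move=> t0 t1; apply: disk2E; rewrite /disk2 /= expr0n /= add0r; nra.
    have yD : @unit_disk R (0 +i* y) by apply: seg_disk; lra.
    move=> A /nbhs_ballP [e /= e0 HA].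
    have [r r0 Hr] := cQ _ (Dcl _ yD) (disk_n1 _ yD) e e0.
    apply/nbhs_ballP; exists (Num.min r 2^-1) => /=; first by rewrite lt_min r0 invr_gt0 ltr0n.
    move=> y'; rewrite /ball /= lt_min distrC => /andP[yr]; rewrite ltr_norml => /andP[yl yu] _.
    have yD' : @unit_disk R (0 +i* y') by apply: seg_disk; move: y0 y1 yl yu; lra.
    apply: HA; rewrite /ball /= distrC; apply: le_lt_trans (ler_dist_dist _ _) _.
    apply: (Hr (0 +i* y')); first exact: Dcl.
    by apply: le_lt_trans (cabs_le_ReIm _) _; rewrite /= subrr normr0 add0r.
  have [c _ Hc] := EVT_max h0 cseg.
  exists `|Q (toC (0, c))| => y /andP[y0 y1]; apply: Hc.
  by rewrite in_itv /= !ltW.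
apply: (@no_steep_boundary R (fun p => complex.Re (Phi (toC p)))
  (fun p => complex.Im (Phi (toC p))) g1 g2 (fun p => Q (toC p)) 3 _ iF1 iF2 ig1 ig2
  wd1 wd2 _ _ lip Q0 HQ0).
- by [].
- move=> p pD; apply: (@continuous_comp _ _ _ (fun q => Phi (toC q)) (@complex.Re R : C -> R)).
    exact: Phi_continuous.
  exact: continuous_Re.
- move=> p pD; apply: (@continuous_comp _ _ _ (fun q => Phi (toC q)) (@complex.Im R : C -> R)).
    exact: Phi_continuous.
  exact: continuous_Im.
move=> y y01; have /andP[y0 y1] := y01.
pose x := Num.sqrt (1 - y ^+ 2); pose z : C := x +i* y.
have yy : y ^+ 2 < 1 by rewrite expr_lt1//; lra.
have x0 : 0 < x by rewrite sqrtr_gt0 subr_gt0.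
have xx : x ^+ 2 = 1 - y ^+ 2 by rewrite sqr_sqrtr// subr_ge0 ltW.
have zC : cabs z = 1 by rewrite /cabs /= xx subrK sqrtr1.
have Dz : closed_unit_disk z by apply/closed_unit_diskE; rewrite zC.
have zn1 : z != 1 by apply/eqP => -[_ E]; move: y0; rewrite E ltxx.
have Qz : y ^- 2 / 2 <= Q z.
  have [_ E] := PsiP z Dz.
  rewrite /Q (_ : Psi z = circle_homeo z); first exact: depth_circle.
  apply: disk_map_inj; [exact/closed_unit_diskE/(PsiP z Dz).1|by rewrite circle_homeo_circle|].
  by rewrite E extends//; apply/mem_set/unit_circleE.
have [r r0 Hr] := cQ z Dz zn1 1 ltr01.
(* A point of the chord close to its right end *)
pose b := x - Num.min r x / 2.
have mr : Num.min r x <= r by rewrite ge_min lexx.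
have mx : Num.min r x <= x by rewrite ge_min lexx orbT.
have m0 : 0 < Num.min r x by rewrite lt_min r0.
have b0 : 0 < b by move: mx m0; rewrite /b; lra.
have bx : b < x by move: m0; rewrite /b; lra.
have br : x - b < r by move: mr m0; rewrite /b; lra.
have bD : disk2 (b, y) by move: b0 bx xx; rewrite /disk2 /==> *; nra.
exists b; split; [exact: b0|exact: bD|].
have := Hr (b +i* y) (Dcl _ (disk2E _ _ bD)).
have -> : (b +i* y : C) - z = (b - x)%:C by apply: complex_eq; rewrite /= ?subrr.
have nb : `|b - x| = x - b by rewrite ler0_norm ?opprB// subr_le0 ltW.
rewrite cabs_real nb => /(_ br); rewrite ltr_norml => /andP[+ _].
rewrite -/(toC (b, y)); move: (Q _) (Q z) Qz => q q'; lra.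
Qed.

End NoExtension.

Theorem theorem1p3 (R : realType) :
  exists (Omega : set (Cplx R)) (phi : Cplx R -> Cplx R),
    [/\ jordan_domain Omega,
        homeomorphism_on (@unit_circle R) (boundary Omega) phi,
        exists z0 : Cplx R, Omega z0 /\
          (\int[@plane_measure R]_(p in @toC R @^-1` Omega)
             hyperbolic_dist Omega (toC p) z0 < +oo)%E &
        ~ exists Phi : Cplx R -> Cplx R,
            [/\ homeomorphism_on (@closed_unit_disk R) (closure Omega) Phi,
                {in @unit_circle R, Phi =1 phi} &
                W11 (@unit_disk R) Phi]].
Proof.
exists (@disk_map R @` @unit_disk R), (@boundary_map R); split.
- exact: disk_map_jordan.
- exact: boundary_map_homeomorphism.
- exists (@disk_map R 0); split; last exact: hyperbolic_integral_finite.
  by exists 0 => //; apply/unit_diskE; rewrite cabs0.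
- by move=> [Phi [homeo extends]]; exact: no_W11_extension homeo extends.
Qed.
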